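(* Let $p\ge1$, let $q\in(1,\infty]$ satisfy $\frac1p+\frac1q=1$, let $i\in\{1,\dots,n-1\}$, and let $\nu(n,p,i)$ be the smallest constant such that for any anti-blocking bodies $A,B\subset\mathbb{R}^n_+$ and any coordinate subspace $E$ of dimension $i$ (with $|P_EA|,|P_EB|>0$), $$\frac{|A|}{|P_EA|}+\frac{|B|}{|P_EB|}\le\nu(n,p,i)\,\frac{|A\oplus_p(-B)|}{|P_E(A\oplus_p(-B))|}.$$ Then $$\nu(n,p,i)=\max_{j}\left(d_{n,2}(i,j)\,\frac{\Gamma\left(1+\frac{i+j-n}{q}\right)\Gamma\left(1+\frac nq\right)}{\Gamma\left(1+\frac iq\right)\Gamma\left(1+\frac jq\right)}\right),$$ where the maximum is over all integers $0\le j\le n$ with $i+j-n\ge0$ and $$d_{n,2}(i,j)=\frac{\binom{i}{i+j-n}\binom{j}{i+j-n}}{\binom{n}{i+j-n}}.$$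
   Context: $\mathbb{R}^n_+=[0,\infty)^n$. A convex body is a nonempty compact convex set. A coordinate subspace is one spanned by a subset of the standard basis $e_1,\dots,e_n$. A convex body $K\subset\mathbb{R}^n_+$ is anti-blocking if $P_EK=K\cap E$ for every coordinate subspace $E$, where $P_E$ is the orthogonal projection onto $E$. The $L_p$-sum of $K,L\subset\mathbb{R}^n$ is, for $p>1$, $K\oplus_pL=\{(1-t)^{1/q}x+t^{1/q}y:x\in K,y\in L,t\in[0,1]\}$ with $\frac1p+\frac1q=1$; for $p=1$, $K\oplus_1L=K+L$ is the Minkowski sum. When $p=1$, $q=\infty$ and $x/q=0$. For $L\subset\mathbb{R}^n$, $|L|$ is $n$-dimensional Lebesgue measure and $|P_EL|$ is $(\dim E)$-dimensional Lebesgue measure on $E$. *)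

(* Defs.v *)
From HB Require Import structures.
From mathcomp Require Import all_boot all_order all_algebra.
From mathcomp Require Import all_classical all_reals all_analysis.

Set Implicit Arguments.
Unset Strict Implicit.
Unset Printing Implicit Defensive.

Import Order.TTheory GRing.Theory Num.Theory.
Import numFieldNormedType.Exports.

Local Open Scope classical_set_scope.
Local Open Scope ring_scope.

(* Lebesgue measure on R^n as the n-fold product of [lebesgue_measure] on R:
   [product_measure1 m1 m2 A] is [\int[m1]_x (m2 (xsection A x))], unfolded
   here along the first coordinate.  It is only meant for Borel sets (below it
   is applied to compact sets), where it is the Lebesgue measure.  R^0 is a
   point of mass 1. *)
Fixpoint lebesgue_vol (R : realType) (n : nat) : set 'rV[R]_n -> \bar R :=
  match n return set 'rV[R]_n -> \bar R with
  | 0 => fun A => ((0 : 'rV[R]_0) \in A)%:R%:E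
  | n'.+1 => fun A =>
      (\int[lebesgue_measure]_x
         lebesgue_vol [set v : 'rV[R]_n' | A (row_mx (x%:M : 'rV[R]_1) v)])%E
  end.

Definition volume (R : realType) (n : nat) (A : set 'rV[R]_n) : R :=
  fine (lebesgue_vol A).

Lemma lebesgue_vol0 (R : realType) (n : nat) :
  lebesgue_vol (set0 : set 'rV[R]_n) = 0%E.
Proof.
elim: n => [|n IHn] /=; first by rewrite in_set0.
by rewrite integral0_eq// => x _; rewrite IHn.
Qed.

Lemma lebesgue_vol_box (R : realType) (n : nat) (a b : 'rV[R]_n)
    (leab : forall k, a 0 k <= b 0 k) :
  lebesgue_vol [set x | forall k, a 0 k <= x 0 k <= b 0 k] =
  (\prod_(k < n) (b 0 k - a 0 k))%:E.
Proof.
elim: n a b leab => [|n IHn] a b leab /=.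
  by rewrite big_ord0 mem_set// => -[].
have Rsub (c : 'rV[R]_n.+1) k : rsubmx (c : 'rV_(1 + n)) 0 k = c 0 (lift ord0 k).
  by rewrite mxE; congr (c 0 _); apply: val_inj.
pose P := \prod_(k < n) (b 0 (lift ord0 k) - a 0 (lift ord0 k)).
pose ab := `[a 0 ord0, b 0 ord0]%classic.
rewrite [RHS](_ : _ = P%:E * lebesgue_measure ab)%E; last first.
  rewrite lebesgue_measure_itv/= lte_fin big_ord_recl.
  case: ltP => ba; first by rewrite -EFinD -EFinM mulrC.
  by rewrite (@le_anti _ _ (a 0 ord0) (b 0 ord0)) ?leab// subrr mul0r mule0.
rewrite -integral_cst; last exact: measurable_itv.
rewrite [RHS]integral_mkcond/=.
apply: eq_integral => /= x _; rewrite patchE.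
have row0 (v : 'rV[R]_n) : (row_mx (x%:M : 'rV[R]_1) v : 'rV[R]_n.+1) 0 ord0 = x.
  transitivity (row_mx (x%:M : 'rV[R]_1) v 0 (lshift n (ord0 : 'I_1))).
    by congr (row_mx _ _ 0 _); apply: val_inj.
  by rewrite row_mxEl mxE eqxx mulr1n.
have rowS (v : 'rV[R]_n) k :
    (row_mx (x%:M : 'rV[R]_1) v : 'rV[R]_n.+1) 0 (lift ord0 k) = v 0 k.
  transitivity (row_mx (x%:M : 'rV[R]_1) v 0 (rshift 1 k)).
    by congr (row_mx _ _ 0 _); apply: val_inj.
  by rewrite row_mxEr.
case: ifPn => [|/negP xab].
  rewrite mem_setE/= in_itv/= => xab.
  rewrite (_ : [set v | _] = [set v : 'rV[R]_n | forall k,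
    rsubmx (a : 'rV_(1 + n)) 0 k <= v 0 k <= rsubmx (b : 'rV_(1 + n)) 0 k]).
    rewrite IHn; last by move=> k; rewrite !Rsub.
    by congr (_%:E); apply: eq_bigr => k _; rewrite !Rsub.
  apply/seteqP; split => v /= H k; first by rewrite !Rsub -rowS.
  by case: (unliftP ord0 k) => [j|] ->; rewrite ?row0// rowS -!Rsub.
rewrite (_ : [set v | _] = set0); first exact: lebesgue_vol0.
apply/seteqP; split => v //= /(_ ord0); rewrite row0 => xI.
by apply: xab; rewrite mem_setE in_itv.
Qed.

(* The coordinate subspace spanned by the [e_k] with [k \in I]. *)
Definition coord_vspace (R : realType) (n : nat) (I : {set 'I_n}) :
    {vspace 'rV[R]_n} :=
  (<<[seq (delta_mx 0 k)%R | k <- enum I]>>)%VS.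

Definition coord_proj (R : realType) (n : nat) (I : {set 'I_n})
    (x : 'rV[R]_n) : 'rV[R]_n :=
  \row_k (if k \in I then x 0 k else 0).

(* [#|I|]-dimensional volume of a subset [L] of the coordinate subspace
   indexed by [I], identified with R^#|I| through the coordinates in [I]. *)
Definition coord_volume (R : realType) (n : nat) (I : {set 'I_n})
    (L : set 'rV[R]_n) : R :=
  volume ((fun x => \row_(k < #|I|) x 0 (enum_val k)) @` L).

Lemma mem_coord_vspace (R : realType) (n : nat) (I : {set 'I_n})
    (x : 'rV[R]_n) :
  reflect (forall k, k \notin I -> x 0 k = 0) (x \in coord_vspace R I).
Proof.
apply: (iffP idP) => [xI k kI|x0].
  rewrite (coord_span xI) summxE big1// => j _.
  rewrite mxE (nth_map k) ?mxE/=; last by rewrite -cardE.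
  case: eqP => [kE|]; last by rewrite mulr0.
  by case/negP: kI; rewrite kE -mem_enum mem_nth// -cardE.
rewrite [x]row_sum_delta; apply: memv_suml => k _.
have [kI|/x0 ->] := boolP (k \in I); last by rewrite scale0r mem0v.
by apply/memvZ/memv_span/map_f; rewrite mem_enum.
Qed.

Lemma dim_coord_vspace (R : realType) (n : nat) (I : {set 'I_n}) :
  (\dim (coord_vspace R I) = #|I|)%VS.
Proof.
have : free [seq (delta_mx 0 k : 'rV[R]_n) | k <- enum I].
  apply/freeP => c c0 j.
  have jI : (j < size (enum I))%N by rewrite -cardE.
  have x0 : 'I_n by apply: (@tnth _ _ (in_tuple (enum I)) (Ordinal jI)).
  have := congr1 (fun x : 'rV[R]_n => x 0 (nth x0 (enum I) j)) c0.
  rewrite summxE (bigD1 j)//= big1 ?addr0 => [|l lj].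
    by rewrite mxE (nth_map x0)// !mxE !eqxx mulr1.
  have lI : (l < size (enum I))%N by rewrite -cardE.
  rewrite mxE (nth_map x0)// mxE nth_uniq ?enum_uniq//.
  by rewrite eq_sym (negbTE (lj : nat_of_ord l != j)) mulr0.
by rewrite /free => /eqP; rewrite size_map cardE.
Qed.

Lemma coord_proj_orthogonal (R : realType) (n : nat) (I : {set 'I_n})
    (x : 'rV[R]_n) :
  coord_proj I x \in coord_vspace R I /\
  forall y, y \in coord_vspace R I -> (x - coord_proj I x) *m y^T = 0.
Proof.
split=> [|y /mem_coord_vspace yI].
  by apply/mem_coord_vspace => k kI; rewrite mxE (negbTE kI).
apply/matrixP => a b; rewrite !mxE big1// => k _; rewrite !mxE (ord1 a) (ord1 b).
by have [kI|/yI ->] := boolP (k \in I); rewrite ?subrr ?mul0r// mulr0.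
Qed.

Definition convex_body (R : realType) (n : nat) (K : set 'rV[R]_n) : Prop :=
  [/\ K !=set0, compact K & convex_set K].

Definition anti_blocking (R : realType) (n : nat) (K : set 'rV[R]_n) : Prop :=
  [/\ convex_body K,
      K `<=` [set x | forall k, 0 <= x 0 k] &
      forall I : {set 'I_n},
        coord_proj I @` K = K `&` [set` coord_vspace R I]].

(* [1/q], with [1/oo = 0]. *)
Definition rinv (R : realType) (q : \bar R) : R := fine (q^-1)%E.

(* To be used with [q] the conjugate exponent of [p]. *)
Definition lp_sum (R : realType) (n : nat) (p : R) (q : \bar R)
    (K L : set 'rV[R]_n) : set 'rV[R]_n :=
  if p == 1 then [set z | exists2 x, K x & exists2 y, L y & z = x + y]
  else [set z | exists x y t, [/\ K x, L y, 0 <= t <= 1 &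
         z = ((1 - t) `^ rinv q) *: x + (t `^ rinv q) *: y]].

Definition gamma_fun (R : realType) (x : R) : R :=
  \int[lebesgue_measure]_(t in `]0, +oo[) (t `^ (x - 1) * expR (- t)).

(* [i + j - n] is truncated subtraction; [d2] and [nu_term] are only meant for
   [n <= i + j].  All values of [nu_term] are nonnegative. *)
Definition d2 (R : realType) (n i j : nat) : R :=
  ('C(i, i + j - n) * 'C(j, i + j - n))%:R / 'C(n, i + j - n)%:R.

Definition nu_term (R : realType) (n : nat) (q : \bar R) (i j : nat) : R :=
  d2 R n i j *
  (gamma_fun (1 + (i + j - n)%:R * rinv q) * gamma_fun (1 + n%:R * rinv q) /
   (gamma_fun (1 + i%:R * rinv q) * gamma_fun (1 + j%:R * rinv q))).

(* [c] is a valid constant in the inequality for dimension [n], exponent [p]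
   and coordinate subspaces of dimension [i]. *)
Definition nu_admissible (R : realType) (n : nat) (p : R) (q : \bar R)
    (i : nat) (c : R) : Prop :=
  forall (A B : set 'rV[R]_n) (I : {set 'I_n}),
    anti_blocking A -> anti_blocking B -> #|I| = i ->
    0 < coord_volume I (coord_proj I @` A) ->
    0 < coord_volume I (coord_proj I @` B) ->
    volume A / coord_volume I (coord_proj I @` A) +
    volume B / coord_volume I (coord_proj I @` B) <=
    c * (volume (lp_sum p q A (-%R @` B)) /
         coord_volume I (coord_proj I @` lp_sum p q A (-%R @` B))).

(* Main.v *)
(* Write [s = 1/q], [T] for the set of all coordinates, and [a J], [b J] for the
   [#|J|]-dimensional volume of the sections of [A], [B] by the coordinate subspace
   [R^J].

   Cutting [A (+)_p (-B)] along the orthants, the part of its projection to [R^E] with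
   nonnegative coordinates in [J] and negative ones in [E \ J] is, up to signs and a null
   set, the [L_p]-sum of the sections of [A] by [R^J] and of [B] by [R^(E \ J)].
   Integrating [exp (- inf {t | z \in t^s K})] gives the volume of an [L_p]-sum of bodies
   in complementary subspaces, so that the volume of the projection to [R^E] is the sum
   over [J \subset E] of
     [w |J| |E \ J| * a J * b (E \ J)], where [w k l = G(k s) G(l s) / G((k + l) s)]
   and [G x = Gamma (1 + x)].

   The upper bound compares these sums term by term: [J] is paired with [J \cup E^c] in
   the summand of [A], and with [J] in that of [B].  What is needed is the Berwald-type
   inequality
     [a T * a J <= kappa * a E * a (J \cup E^c)],
   with equality for the body [{x | |x_J|_oo + |x_(J^c)|_oo <= 1}] in the cube, where
   [kappa = d2 n i j] for [j = #|J \cup E^c|].  Let [f], [g] be the volumes of the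
   sections of [A] parallel to [R^(E \ J)] and [R^(E^c)].  By Brunn-Minkowski, the volume
   of [{f >= u}] crosses that of the extremal body, normalised to the same integral, only
   once, from above to below; likewise for [g].  Hence replacing both by the extremal ones
   increases the double integral of [min (|{f >= u}|) (|{g >= t}|)], which dominates
   [\int f g >= a T].

   The bound is approached by that extremal body and by the box with sides [M] along
   [E \ J] and [1 / M] along the other coordinates, as [M] tends to infinity. *)
Require Import Defs.
From HB Require Import structures.
From mathcomp Require Import all_boot all_order all_algebra.
From mathcomp Require Import all_classical all_reals all_analysis.
From mathcomp Require Import measurable_realfun ring lra zify.

Set Implicit Arguments.
Unset Strict Implicit.
Unset Printing Implicit Defensive.

Import Order.TTheory GRing.Theory Num.Theory.
Import numFieldNormedType.Exports.

Local Open Scope classical_set_scope.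
Local Open Scope ring_scope.

(** All volumes are taken with measures [mu J] on R^n itself, concentrated on R^J, so that bodies in
    different coordinate subspaces share one type. For a down-set the projection to R^J is also its
    section, and [mu J A] serves for both.

    The functional N_K(u) = inf {t | u in t^s K} is chosen because it turns a sum over complementary
    subspaces into an addition: its value at a + b for the L_p-sum of A and B is N_A(a) + N_B(b).
    Its exponential is therefore multiplicative, and by homogeneity the integral is Gamma (1 + #|J|
    s) times the volume, for every s >= 0, Minkowski sums (s = 0) included.

    The single crossing comes from interpolating between a level set and the base of A, its section
    by R^J: there the #|J|-th root of the extremal profile is affine, whereas Brunn-Minkowski bounds
    that of A from below by the interpolated value. For the extremal body the level sets are nested
    cubes and the sections over a point are products, so that each estimate becomes an equality;
    hence kappa is a ratio of volumes of such bodies. *)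

Definition mbox (R : realType) (n : nat) (S : 'I_n -> set R) : set 'rV[R]_n :=
  [set x | forall k, S k (x 0 k)].

Definition mboxes (R : realType) (n : nat) : set (set 'rV[R]_n) :=
  [set D | exists2 S : 'I_n -> set R, (forall k, measurable (S k)) & D = mbox S].

(** Generating by boxes makes measurability of a map into R^n a coordinatewise matter, and lets
    measures be compared on boxes only. *)
HB.instance Definition _ (R : realType) (n : nat) :=
  @isMeasurable.Build (sigma_display (@mboxes R n)) 'rV[R]_n <<s @mboxes R n >>
    (@sigma_algebra0 _ setT (@mboxes R n))
    (@sigma_algebraC _ (@mboxes R n))
    (@sigma_algebra_bigcup _ setT (@mboxes R n)).

(** * Lebesgue measure on coordinate subspaces *)

Section rv_measurable.
Variable R : realType.

Lemma measurable_mbox n (S : 'I_n -> set R) :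
  (forall k, measurable (S k)) -> measurable (mbox S).
Proof. by move=> mS; apply: sub_sigma_algebra; exists S. Qed.

Lemma measurable_coord n (k : 'I_n) :
  measurable_fun setT (fun x : 'rV[R]_n => x 0 k).
Proof.
move=> _ B mB; rewrite setTI.
rewrite (_ : _ @^-1` _ = mbox (fun j => if j == k then B else setT)).
  by apply: measurable_mbox => j; case: ifP.
apply/seteqP; split => x /= => [Bx j|/(_ k)]; last by rewrite eqxx.
by case: eqP => // ->.
Qed.

Lemma measurable_rv d (T : measurableType d) n (D : set T) (f : T -> 'rV[R]_n) :
  (forall k, measurable_fun D (fun t => f t 0 k)) -> measurable_fun D f.
Proof.
move=> mf; have [->|/set0P[t Dt]] := eqVneq D set0; first exact: measurable_fun_set0.
move=> mD; apply: (@measurability _ _ _ _ _ _ (@mboxes R n)) => //.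
move=> _ [_ [S mS ->] <-].
rewrite (_ : _ `&` _ = D `&` \bigcap_(k in [set: 'I_n]) (D `&` (fun t => f t 0 k) @^-1` S k)).
  apply: measurableI => //; apply: fin_bigcap_measurable => //.
  by move=> k _; exact: mf.
apply/seteqP; split => x /= [Dx H]; split => //.
  by move=> k _; split.
by move=> k; have [] := H k I.
Qed.

Lemma rv_cons0 n (a : R) (v : 'rV[R]_n) :
  (row_mx (a%:M : 'rV[R]_1) v : 'rV[R]_n.+1) 0 ord0 = a.
Proof.
transitivity (row_mx (a%:M : 'rV[R]_1) v 0 (lshift n (ord0 : 'I_1))).
  by congr (row_mx _ _ 0 _); apply: val_inj.
by rewrite row_mxEl mxE eqxx mulr1n.
Qed.

Lemma rv_consS n (a : R) (v : 'rV[R]_n) k :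
  (row_mx (a%:M : 'rV[R]_1) v : 'rV[R]_n.+1) 0 (lift ord0 k) = v 0 k.
Proof.
transitivity (row_mx (a%:M : 'rV[R]_1) v 0 (rshift 1 k)).
  by congr (row_mx _ _ 0 _); apply: val_inj.
by rewrite row_mxEr.
Qed.

Lemma measurable_row_mx n :
  measurable_fun setT (fun p : R * 'rV[R]_n => (row_mx (p.1%:M : 'rV[R]_1) p.2 : 'rV[R]_n.+1)).
Proof.
apply: measurable_rv => k; case: (unliftP ord0 k) => [j ->|->].
  under eq_fun do rewrite rv_consS.
  exact: (measurableT_comp (measurable_coord j)).
under eq_fun do rewrite rv_cons0.
exact: measurable_fst.
Qed.

End rv_measurable.

Section lebesgue_vol_measure.
Variable R : realType.
Local Open Scope ereal_scope.

Definition cube n (i : nat) : set 'rV[R]_n :=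
  mbox (fun _ => `[(- i%:R)%R, (i%:R)%R]%classic).

Lemma cube_cover n : \bigcup_i @cube n i = setT.
Proof.
apply/seteqP; split => // x _.
pose M := (\sum_(k < n) `|x 0%R k|)%R.
have M0 k : (`|x 0%R k| <= M)%R by rewrite /M (bigD1 k)//= lerDl sumr_ge0.
exists (Num.truncn M).+1 => //= k; rewrite /= in_itv/= -ler_norml.
exact: (le_trans (M0 k) (ltW (truncnS_gt _))).
Qed.

Lemma measurable_cube n i : measurable (@cube n i).
Proof. by apply: measurable_mbox => k; exact: measurable_itv. Qed.

Lemma sigma_finite_rv n (m : set 'rV[R]_n -> \bar R) :
  (forall i, m (@cube n i) < +oo) -> sigma_finite setT m.
Proof.
move=> moo; exists (@cube n); first by rewrite cube_cover.
by move=> i; split; [exact: measurable_cube|exact: moo].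
Qed.

Lemma fin_num_prod (I : finType) (F : I -> \bar R) :
  (forall k, F k \is a fin_num) -> \prod_k F k \is a fin_num.
Proof.
by move=> FF; elim/big_ind : _ => // a b; exact: fin_numM.
Qed.

Lemma cube_side_fin_num i :
  lebesgue_measure (`[(- i%:R)%R, (i%:R)%R]%classic : set R) \is a fin_num.
Proof. by rewrite lebesgue_measure_itv/=; case: ifP => // _; rewrite -EFinD. Qed.

Lemma sigma_finite_vol n (m : set 'rV[R]_n -> \bar R) :
  (forall S : 'I_n -> set R, (forall k, measurable (S k)) ->
    m (mbox S) = \prod_(k < n) lebesgue_measure (S k)) ->
  sigma_finite setT m.
Proof.
move=> mE; apply: sigma_finite_rv => i; rewrite mE; last first.
  by move=> k; exact: measurable_itv.
by rewrite ltey_eq fin_num_prod// => k; exact: cube_side_fin_num.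
Qed.

Section cons_measure.
Variables (n : nat) (m : {measure set 'rV[R]_n -> \bar R}).
Hypothesis sfm : sigma_finite setT m.

Let m' : set 'rV[R]_n -> \bar R := m.
HB.instance Definition _ := Measure.on m'.
HB.instance Definition _ := Measure_isSigmaFinite.Build _ _ _ m' sfm.

Let rowf (p : R * 'rV[R]_n) := (row_mx (p.1%:M : 'rV[R]_1) p.2 : 'rV[R]_n.+1).
(** Inductive step for turning [lebesgue_vol] into a measure: the product with Lebesgue measure,
    pushed forward along [row_mx]. *)
Lemma cons_measure_ex : exists mc : {measure set 'rV[R]_n.+1 -> \bar R},
  (forall A, measurable A -> mc A =
    \int[lebesgue_measure]_x m [set v | A (row_mx (x%:M : 'rV[R]_1) v)]) /\
  (forall S : 'I_n.+1 -> set R, (forall k, measurable (S k)) ->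
    mc (mbox S) =
    lebesgue_measure (S ord0) * m (mbox (fun k : 'I_n => S (lift ord0 k)))).
Proof.
exists (pushforward (lebesgue_measure \x m') rowf); split.
  move=> A mA; rewrite /pushforward /product_measure1 /=.
  apply: eq_integral => x _ /=; rewrite /m'.
  by congr (m _); apply/seteqP; split => v /=; rewrite /xsection/= inE.
move=> S mS; pose S' (k : 'I_n) := S (lift ord0 k).
have mS' : measurable (mbox S') by apply: measurable_mbox => k; exact: mS.
rewrite -[RHS](product_measure1E lebesgue_measure m' (mS ord0) mS').
congr ((_ \x _) _).
apply/seteqP; split => p /=; rewrite /rowf /=.
  move=> pS; split; first by have := pS ord0; rewrite rv_cons0.
  by move=> k; have := pS (lift ord0 k); rewrite rv_consS.
move=> [p1 p2] k; case: (unliftP ord0 k) => [j ->|->]; last by rewrite rv_cons0.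
by rewrite rv_consS; exact: p2.
Unshelve.
exact: measurable_row_mx.
Qed.

End cons_measure.

Lemma measurable_consE n (A : set 'rV[R]_n.+1) (x : R) : measurable A ->
  measurable [set v : 'rV[R]_n | A (row_mx (x%:M : 'rV[R]_1) v)].
Proof.
move=> mA; rewrite [X in measurable X](_ : _ = xsection
  ((fun p : R * 'rV[R]_n => (row_mx (p.1%:M : 'rV[R]_1) p.2 : 'rV[R]_n.+1)) @^-1` A) x).
  by apply: measurable_xsection; rewrite -[_ @^-1` _]setTI; exact: measurable_row_mx.
by apply/seteqP; split => v /=; rewrite /xsection/= inE.
Qed.

(** The box formula is carried through the induction because sigma-finiteness, required to form the
    next product, is read off it. *)
Lemma lebesgue_vol_measure_ex n : exists m : {measure set 'rV[R]_n -> \bar R},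
  (forall A, measurable A -> m A = lebesgue_vol A) /\
  (forall S : 'I_n -> set R, (forall k, measurable (S k)) ->
    m (mbox S) = \prod_(k < n) lebesgue_measure (S k)).
Proof.
elim: n => [|n [m [mE mbox_m]]].
  exists (dirac (0%R : 'rV[R]_0)); split; first by move=> A mA.
  move=> S mS; rewrite big_ord0 (_ : mbox S = setT).
    exact: diracT.
  by apply/seteqP; split => // x _ -[].
have [mc [mcE mcbox]] := cons_measure_ex (sigma_finite_vol mbox_m).
exists mc; split => [A mA|S mS].
  rewrite mcE//=; apply: eq_integral => x _; rewrite mE//.
  exact: measurable_consE.
by rewrite mcbox// big_ord_recl mbox_m.
Qed.

Variable n : nat.

Let vol0 : lebesgue_vol (set0 : set 'rV[R]_n) = 0.
Proof. exact: lebesgue_vol0. Qed.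

Let vol_ge0 (A : set 'rV[R]_n) : 0 <= lebesgue_vol A.
Proof.
elim: n A => [|k IH] A /=; first by rewrite lee_fin ler0n.
by apply: integral_ge0 => x _; exact: IH.
Qed.

Let vol_sigma_additive : semi_sigma_additive (@lebesgue_vol R n).
Proof.
have [m [mE _]] := lebesgue_vol_measure_ex n.
move=> F mF tF mUF; rewrite -mE//.
under eq_fun do under eq_bigr do rewrite -mE//.
exact: measure_semi_sigma_additive.
Qed.

HB.instance Definition _ := isMeasure.Build _ _ _ (@lebesgue_vol R n)
  vol0 vol_ge0 vol_sigma_additive.

Lemma lebesgue_vol_mbox (S : 'I_n -> set R) : (forall k, measurable (S k)) ->
  lebesgue_vol (mbox S) = \prod_(k < n) lebesgue_measure (S k).
Proof.
have [m [mE mS]] := lebesgue_vol_measure_ex n.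
by move=> mS'; rewrite -mE ?mS//; exact: measurable_mbox.
Qed.

HB.instance Definition _ := Measure_isSigmaFinite.Build _ _ _ (@lebesgue_vol R n)
  (sigma_finite_vol lebesgue_vol_mbox).

End lebesgue_vol_measure.

Section measure_rv_unique.
Variables (R : realType) (n : nat).
Local Open Scope ereal_scope.

(** Boxes are stable under intersection and the cubes exhaust the space, so the uniqueness theorem
    for measures on a generating pi-system applies. *)
Lemma measure_rv_unique (m1 m2 : {measure set 'rV[R]_n -> \bar R}) :
  (forall S : 'I_n -> set R, (forall k, measurable (S k)) ->
    m1 (mbox S) = m2 (mbox S)) ->
  (forall i, m1 (@cube R n i) < +oo) ->
  forall A, measurable A -> m1 A = m2 A.
Proof.
move=> m12 m1oo A mA; apply: (measure_unique (@mboxes R n) (@cube R n)) => //.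
- move=> _ _ [S mS ->] [S' mS' ->]; exists (fun k => S k `&` S' k).
    by move=> k; exact: measurableI.
  apply/seteqP; split => x /=.
    by move=> [] Sx Sx' k; split.
  by move=> Sx; split => k; have [] := Sx k.
- by move=> i; exists (fun=> `[(- i%:R)%R, i%:R%R]%classic).
- exact: cube_cover.
- by move=> _ [S mS ->]; exact: m12.
Qed.

Let ratbox (cm : 'rV[rat]_n * nat) : set 'rV[R]_n :=
  mbox (fun k => ball (ratr (cm.1 0%R k) : R) (cm.2.+1%:R^-1)).

(** Links the topology with the box sigma-algebra: an open set is the countable union of the boxes
    with rational centre and radius 1/(m+1) that it contains. *)
Lemma open_measurable_rv (O : set 'rV[R]_n) : open O -> measurable O.
Proof.
move=> oO.
rewrite [X in measurable X](_ : _ = \bigcup_cm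
    (if `[< ratbox cm `<=` O >] then ratbox cm else set0)).
  apply: countable_bigcupT_measurable => [|cm]; first exact: countableP.
  case: ifP => // _.
  by apply: measurable_mbox => k; exact: measurable_ball.
apply/seteqP; split => x.
  move=> Ox; have /nbhs_ballP[e /= e0 xeO] := open_nbhs_nbhs (conj oO Ox).
  (* The radius satisfies 2/(m+1) < e: one radius for the distance from [x] to the rational centre,
     one for the box around that centre. *)
  pose m := Num.truncn (2 / e)%R.
  have m0 : (0 < m.+1%:R^-1 :> R)%R by rewrite invr_gt0.
  have me : (m.+1%:R^-1 + m.+1%:R^-1 < e)%R.
    have := truncnS_gt (2 / e)%R; rewrite -/m ltr_pdivrMr// => me.
    rewrite (_ : _ + _ = 2 / m.+1%:R)%R; last by ring.
    by rewrite ltr_pdivrMr// mulrC.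
  have /choice[c cP] (k : 'I_n) : exists q : rat, ball (ratr q : R) m.+1%:R^-1 (x 0%R k).
    have /rat_in_itvoo[q qx] : (x 0%R k - m.+1%:R^-1 < x 0%R k + m.+1%:R^-1)%R.
      by rewrite ltrBlDr -addrA ltrDl addr_gt0.
    exists q; rewrite /ball/= ltr_distl.
    by move: qx; rewrite in_itv/= => /andP[q1 q2]; rewrite ltrBlDr q2 -ltrBlDr q1.
  exists ((\row_k c k)%R, m) => //; rewrite ifT.
    by move=> k /=; rewrite mxE; exact: cP.
  apply/asboolP => y yB; apply: xeO; split => // i k; rewrite ord1.
  have := yB k; rewrite /= mxE => yk.
  apply: (@le_ball _ _ _ (m.+1%:R^-1 + m.+1%:R^-1)%R); first exact: ltW.
  by apply: ball_triangle yk; apply: ball_sym.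
by move=> [cm _]; case: asboolP => // BO; exact: BO.
Qed.

Lemma closed_measurable_rv (C : set 'rV[R]_n) : closed C -> measurable C.
Proof.
move=> cC; rewrite -(setCK C); apply: measurableC; apply: open_measurable_rv.
exact: closed_openC.
Qed.

End measure_rv_unique.

Section coord_measure.
Variables (R : realType) (n : nat).
Implicit Types J : {set 'I_n}.
Local Open Scope ereal_scope.

Definition emb J (v : 'rV[R]_#|J|) : 'rV[R]_n :=
  (\row_k \sum_(l < #|J| | enum_val l == k) v 0 l)%R.

Lemma emb_val J (v : 'rV[R]_#|J|) l : emb v 0%R (enum_val l) = v 0%R l.
Proof.
by rewrite mxE (big_pred1 l)// => j; rewrite (inj_eq enum_val_inj).
Qed.

Lemma emb_in J (v : 'rV[R]_#|J|) k (kJ : k \in J) :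
  emb v 0%R k = v 0%R (enum_rank_in kJ k).
Proof. by rewrite -{1}(enum_rankK_in kJ kJ) emb_val. Qed.

Lemma emb_notin J (v : 'rV[R]_#|J|) k : k \notin J -> emb v 0%R k = 0%R.
Proof.
move=> kJ; rewrite mxE big_pred0// => l; apply: contraNF kJ => /eqP <-.
exact: enum_valP.
Qed.

Lemma measurable_emb J : measurable_fun setT (@emb J).
Proof.
apply: measurable_rv => k; have [kJ|kJ] := boolP (k \in J).
  under eq_fun do rewrite emb_in.
  exact: measurable_coord.
under eq_fun do rewrite emb_notin//.
exact: measurable_cst.
Qed.

(** A measure on all of R^n concentrated on R^J: [mu J A] is the #|J|-dimensional volume of the
    section of [A] by R^J. *)
Definition mu J : set 'rV[R]_n -> \bar R := pushforward (@lebesgue_vol R #|J|) (@emb J).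

Let mu_measure J : exists m : {measure set 'rV[R]_n -> \bar R}, m = mu J :> (_ -> _).
Proof.
by exists (pushforward (@lebesgue_vol R #|J|) (@emb J)).
Unshelve.
exact: measurable_emb.
Qed.

Let mu0 J : mu J set0 = 0.
Proof. by have [m <-] := mu_measure J. Qed.

Let mu_ge0 J A : 0 <= mu J A.
Proof. by have [m <-] := mu_measure J. Qed.

Let mu_sigma_additive J : semi_sigma_additive (mu J).
Proof. by have [m <-] := mu_measure J; exact: measure_semi_sigma_additive. Qed.

HB.instance Definition _ J := isMeasure.Build _ _ _ (mu J)
  (mu0 J) (@mu_ge0 J) (@mu_sigma_additive J).

Definition fac J (S : 'I_n -> set R) k : \bar R :=
  if k \in J then lebesgue_measure (S k) else dirac (0 : R)%R (S k).

Lemma mu_mbox J (S : 'I_n -> set R) : (forall k, measurable (S k)) ->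
  mu J (mbox S) = \prod_k fac J S k.
Proof.
move=> mS; rewrite (bigID (mem J))/=.
have -> : \prod_(k in J) fac J S k = \prod_(l < #|J|) lebesgue_measure (S (enum_val l)).
  rewrite big_enum_val/=; apply: eq_bigr => l _.
  by rewrite /fac enum_valP.
rewrite -(lebesgue_vol_mbox (fun l => mS (enum_val l))).
have [S0|/existsNP[k /not_implyP[kJ S0]]] := pselect (forall k, k \notin J -> S k 0%R).
  rewrite big1 ?mule1; last first.
    move=> k kJ; rewrite /fac (negbTE kJ) diracE mem_set//; exact: S0.
  congr lebesgue_vol; apply/seteqP; split => v /= H.
    by move=> l; rewrite -emb_val.
  move=> k; have [kJ|kJ] := boolP (k \in J); last by rewrite emb_notin//; exact: S0.
  by rewrite emb_in -{1}(enum_rankK_in kJ kJ).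
rewrite [X in _ * X](bigD1 k)//= {1}/fac (negbTE kJ) diracE memNset// mul0e mule0.
rewrite /mu /pushforward (_ : _ @^-1` _ = set0) ?measure0//.
by apply/seteqP; split => // v /= /(_ k); rewrite emb_notin.
Qed.

Lemma mu_cube_fin J i : mu J (@cube R n i) < +oo.
Proof.
rewrite mu_mbox; last by move=> k; exact: measurable_itv.
rewrite ltey_eq fin_num_prod// => k; rewrite /fac; case: ifP => _.
  exact: cube_side_fin_num.
by rewrite diracE.
Qed.

HB.instance Definition _ J := Measure_isSigmaFinite.Build _ _ _ (mu J)
  (sigma_finite_rv (mu_cube_fin J)).

(** Reduces each change of variables below (scaling, reflection, joining coordinates) to a
    coordinatewise computation on boxes. *)
Lemma mu_unique J (m : {measure set 'rV[R]_n -> \bar R}) :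
  (forall S : 'I_n -> set R, (forall k, measurable (S k)) ->
    m (mbox S) = \prod_k fac J S k) ->
  forall A, measurable A -> mu J A = m A.
Proof.
move=> mE; apply: measure_rv_unique; last exact: mu_cube_fin.
by move=> S mS; rewrite mE//; exact: mu_mbox.
Qed.

Lemma mu_setT (A : set 'rV[R]_n) : measurable A -> lebesgue_vol A = mu [set: 'I_n]%SET A.
Proof.
move=> mA; apply/esym; apply: (@mu_unique [set: 'I_n]%SET (@lebesgue_vol R n)) => // S mS.
transitivity (\prod_k lebesgue_measure (S k)); first exact: lebesgue_vol_mbox.
by apply: eq_bigr => k _; rewrite /fac inE.
Qed.

Lemma coord_volumeE J (L : set 'rV[R]_n) :
  (forall x, L x -> x \in coord_vspace R J) -> coord_volume J L = fine (mu J L).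
Proof.
move=> LJ; rewrite /coord_volume /volume /mu /pushforward; congr (fine (lebesgue_vol _)).
apply/seteqP; split => v /=.
  move=> [x Lx <-]; rewrite (_ : emb _ = x)//; apply/rowP => k.
  have [kJ|kJ] := boolP (k \in J).
    by rewrite emb_in mxE enum_rankK_in.
  by rewrite emb_notin//; have /mem_coord_vspace -> := LJ _ Lx.
by move=> Lv; exists (emb v) => //; apply/rowP => l; rewrite mxE emb_val.
Qed.

End coord_measure.

Section pushforward.
Local Open Scope ereal_scope.

Lemma pushforward_ex d d' (T1 : measurableType d) (T2 : measurableType d')
    (R : realType) (m : {measure set T1 -> \bar R}) (f : T1 -> T2) :
  measurable_fun setT f ->
  exists m' : {measure set T2 -> \bar R}, forall A, m' A = m (f @^-1` A).
Proof.
move=> mf; exists (pushforward m f); first by [].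
Unshelve.
exact: mf.
Qed.

Lemma lebesgue_measure_scale (R : realType) (c : R) (S : set R) :
  (0 < c)%R -> measurable S ->
  lebesgue_measure ((fun x => c^-1 * x)%R @^-1` S) = c%:E * lebesgue_measure S.
Proof.
move=> c0 mS.
have mf : measurable_fun setT (fun x : measurableTypeR R => (c^-1 * x)%R : measurableTypeR R).
  exact: measurable_funM.
have [m mE] := pushforward_ex lebesgue_measure mf.
have ci0 : (0 <= c^-1)%R by rewrite invr_ge0 ltW.
pose m' : {measure set (measurableTypeR R) -> \bar R} := mscale (NngNum ci0) m.
rewrite -mE -[in RHS](_ : m' S = lebesgue_measure S).
  by rewrite /m'/= /mscale/= muleA -EFinM divff ?mul1e// gt_eqF.
apply/esym/lebesgue_measure_unique => // _ [[a b] /= _ <-].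
rewrite /m'/= /mscale/= mE.
have -> : (fun x => c^-1 * x)%R @^-1` `]a, b] = `](c * a)%R, (c * b)%R]%classic :> set R.
  by apply/seteqP; split => x /=; rewrite !in_itv/= ltr_pdivlMl// ler_pdivrMl.
rewrite [LHS]lebesgue_measure_itv [X in _ * X]lebesgue_measure_itv/= !lte_fin.
rewrite ltr_pM2l//; case: ifP => _.
  by rewrite -!EFinD -mulrBr -EFinM mulKf ?gt_eqF.
by rewrite mule0.
Qed.

End pushforward.

Section coord_measure_transform.
Variables (R : realType) (n : nat).
Implicit Types J : {set 'I_n}.
Local Open Scope ereal_scope.

Lemma mu_scale J (c : R) (A : set 'rV[R]_n) : (0 < c)%R -> measurable A ->
  mu J [set x | A (c^-1 *: x)%R] = (c ^+ #|J|)%:E * mu J A.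
Proof.
move=> c0 mA.
have mf : measurable_fun setT (fun x : 'rV[R]_n => c^-1 *: x)%R.
  apply: measurable_rv => k; under eq_fun do rewrite mxE.
  by apply: measurable_funM => //; exact: measurable_coord.
have [m mE] := pushforward_ex (mu J) mf.
have ci0 : (0 <= c ^- #|J|)%R by rewrite invr_ge0 exprn_ge0// ltW.
pose m' : {measure set 'rV[R]_n -> \bar R} := mscale (NngNum ci0) m.
rewrite -[LHS](mE A) (_ : mu J A = m' A).
  by rewrite /m'/= /mscale/= muleA -EFinM divff ?mul1e// expf_neq0// gt_eqF.
apply: mu_unique => // S mS; rewrite /m'/= /mscale/= mE.
rewrite (_ : _ @^-1` _ = mbox (fun k => (fun x => c^-1 * x)%R @^-1` S k)); last first.
  by apply/seteqP; split => x /= H k; have := H k; rewrite mxE.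
have mS' k : measurable ((fun x => c^-1 * x)%R @^-1` S k).
  rewrite -[_ @^-1` _]setTI.
  by apply: (@measurable_funM _ R _ _ (cst c^-1%R) id).
rewrite /= mu_mbox//.
rewrite (eq_bigr (fun k => (if k \in J then c else 1)%R%:E * fac J S k)).
  rewrite big_split/= muleA (_ : \prod_k _%:E = (c ^+ #|J|)%:E).
    by rewrite -EFinM mulVf ?mul1e// expf_neq0// gt_eqF.
  rewrite -(big_morph EFin (@EFinM R) erefl) -big_mkcond/=.
  by rewrite prodr_const.
move=> k _; rewrite /fac; case: ifPn => kJ.
  exact: lebesgue_measure_scale.
by rewrite mul1e !diracE; congr ((_ : bool)%:R%:E); apply/idP/idP; rewrite !inE/= mulr0.
Qed.

Definition flip J (x : 'rV[R]_n) : 'rV[R]_n :=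
  (\row_k if k \in J then - x 0 k else x 0 k)%R.

Lemma measurable_flip J : measurable_fun setT (flip J).
Proof.
apply: measurable_rv => k; under eq_fun do rewrite mxE.
case: (k \in J); last exact: measurable_coord.
by apply: measurable_funN; exact: measurable_coord.
Qed.

Lemma mu_flip J G (A : set 'rV[R]_n) : measurable A ->
  mu J [set x | A (flip G x)] = mu J A.
Proof.
move=> mA; have [m mE] := pushforward_ex (mu J) (measurable_flip G).
rewrite -[LHS](mE A); apply/esym/mu_unique => // S mS; rewrite mE.
pose S' k := if k \in G then -%R @^-1` S k else S k.
have mS' k : measurable (S' k).
  rewrite /S'; case: ifP => // _.
  by rewrite -[_ @^-1` _]setTI; apply: (@measurable_funN _ R R).
rewrite (_ : _ @^-1` _ = mbox S'); last first.
  by apply/seteqP; split => x /= H k; have := H k; rewrite /S' mxE; case: ifP.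
rewrite /= mu_mbox//; apply: eq_bigr => k _; rewrite /fac /S'; case: ifP => kJ.
  by case: ifP => // kG; rewrite -[RHS]lebesgue_measureN.
case: ifP => // kG; rewrite !diracE.
by congr ((_ : bool)%:R%:E); apply/idP/idP; rewrite !inE/= oppr0.
Qed.

Lemma mu_hyperplane J k : k \in J -> mu J [set x : 'rV[R]_n | x 0%R k = 0%R] = 0.
Proof.
move=> kJ; pose S (j : 'I_n) : set R := if j == k then [set 0%R] else setT.
rewrite (_ : [set x | _] = mbox S).
  rewrite mu_mbox; last by move=> j; rewrite /S; case: ifP.
  by rewrite (bigD1 k)//= {1}/fac kJ /S eqxx lebesgue_measure_set1 mul0e.
apply/seteqP; split => x /=.
  by move=> xk j; rewrite /S; case: eqP => // ->.
by move=> /(_ k); rewrite /S eqxx.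
Qed.

Definition join J J' (p : 'rV[R]_n * 'rV[R]_n) : 'rV[R]_n :=
  (coord_proj J p.1 + coord_proj J' p.2)%R.

Lemma measurable_coord_proj J : measurable_fun setT (@coord_proj R n J).
Proof.
apply: measurable_rv => k; under eq_fun do rewrite mxE.
by case: (k \in J); [exact: measurable_coord|exact: measurable_cst].
Qed.

Lemma measurable_join J J' : measurable_fun setT (join J J').
Proof.
apply: measurable_rv => k; rewrite /join; under eq_fun do rewrite mxE.
apply: measurable_funD; apply: (measurableT_comp (measurable_coord k));
  apply: (measurableT_comp (measurable_coord_proj _)).
  exact: measurable_fst.
exact: measurable_snd.
Qed.

Lemma mu_join J J' (A : set 'rV[R]_n) : [disjoint J & J']%B -> measurable A ->
  mu (J :|: J') A = (mu J \x mu J') (join J J' @^-1` A).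
Proof.
move=> JJ' mA; have [m mE] := pushforward_ex (mu J \x mu J') (measurable_join J J').
rewrite -[RHS](mE A); apply: mu_unique => // S mS; rewrite mE.
(* Off both [J] and [J'] the joined point has coordinate 0, so membership in [S k] is a constant
   condition; it is charged to the first factor. *)
pose S1 k : set R := if k \in J then S k else
  if k \in J' then setT else [set _ | S k 0%R].
pose S2 k := if k \in J' then S k else setT.
have mS1 k : measurable (S1 k).
  rewrite /S1; case: ifP => // _; case: ifP => // _.
  have [Sk0|Sk0] := pselect (S k 0%R).
    by rewrite (_ : [set _ | _] = setT)//; apply/seteqP; split.
  by rewrite (_ : [set _ | _] = set0)//; apply/seteqP; split.
have mS2 k : measurable (S2 k) by rewrite /S2; case: ifP.
have JJ'F k : k \in J -> k \in J' = false by exact: disjointFr.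
transitivity ((mu J \x mu J') (mbox S1 `*` mbox S2)).
  congr (_ _); apply/seteqP; split => -[x y] /=.
    move=> H; split => k; have := H k; rewrite /S1 /S2 /join /coord_proj !mxE/=.
      case: ifPn => [kJ|_]; first by rewrite JJ'F//= addr0.
      by case: ifP => // _; rewrite add0r.
    by case: (boolP (k \in J')) => // kJ'; rewrite (disjointFl JJ' kJ')/= add0r.
  move=> [/= H1 H2] k; have := H1 k; have := H2 k; rewrite /S1 /S2 /join /coord_proj !mxE/=.
  have [kJ|kJ] := boolP (k \in J); first by rewrite JJ'F//= addr0.
  by case: (k \in J'); rewrite ?add0r.
rewrite product_measure1E; [|exact: measurable_mbox..].
rewrite /= !mu_mbox// -big_split/=; apply: eq_bigr => k _; rewrite /fac /S1 /S2 inE.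
have [kJ|kJ] := boolP (k \in J); have [kJ'|kJ'] := boolP (k \in J') => //=.
- by rewrite JJ'F in kJ'.
- by rewrite diracT mule1.
- by rewrite diracT mul1e.
- by rewrite diracT mule1 !diracE; congr ((_ : bool)%:R%:E); apply/idP/idP; rewrite !inE.
Qed.

End coord_measure_transform.

(** * Brunn-Minkowski inequality for down-sets *)

Section layer_cake.
Context d (T : measurableType d) (R : realType).
Local Open Scope ereal_scope.

Lemma lebesgue_measure_Ioc_ereal (y : \bar R) : 0 <= y ->
  lebesgue_measure [set u : R | (0 < u)%R /\ u%:E <= y] = y.
Proof.
case: y => [r||//] r0.
  rewrite (_ : [set u | _] = `]0%R, r]%classic).
    rewrite lebesgue_measure_itv/= lte_fin oppr0 adde0.
    by case: ltP => // r1; congr EFin; apply/le_anti; rewrite r1 -lee_fin r0.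
  by apply/seteqP; split => u /=; rewrite in_itv/= lee_fin; [move=> [-> ->]|case/andP].
rewrite (_ : [set u | _] = `]0%R, +oo[%classic); first by rewrite lebesgue_measure_itv/= ltry.
by apply/seteqP; split => u /=; rewrite in_itv/= andbT leey; [case|].
Qed.

Lemma layer_cake (m : {sigma_finite_measure set T -> \bar R}) (f : T -> \bar R) :
  measurable_fun setT f -> (forall x, 0 <= f x) ->
  \int[m]_x f x =
  \int[lebesgue_measure]_(u in `]0%R, +oo[) m [set x | u%:E <= f x].
Proof.
move=> mf f0.
pose D : set (T * R) := [set p | (0 < p.2)%R /\ p.2%:E <= f p.1].
have mD : measurable D.
  rewrite (_ : D = (@snd T R @^-1` `]0%R, +oo[) `&` [set p | (p.2%:E <= f p.1)]).
    apply: measurableI.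
      by rewrite -[_ @^-1` _]setTI; exact: measurable_snd.
    rewrite -[X in measurable X]setTI; apply: measurable_lee => //.
      by apply/measurable_EFinP; exact: measurable_snd.
    by apply: (measurableT_comp mf); exact: measurable_fst.
  by apply/seteqP; split => p; rewrite /D/= in_itv/= andbT.
have := indic_fubini_tonelli m lebesgue_measure mD.
rewrite indic_fubini_tonelli_FE// indic_fubini_tonelli_GE// => E.
rewrite [RHS]integral_mkcond; transitivity (\int[m]_x (lebesgue_measure \o xsection D) x).
  apply: eq_integral => x _ /=; rewrite -[LHS]lebesgue_measure_Ioc_ereal//.
  by congr lebesgue_measure; apply/seteqP; split => u; rewrite /xsection/= inE.
rewrite E; apply: eq_integral => u _ /=; rewrite patchE mem_setE in_itv/= andbT.
case: ltP => u0.
  congr (m _); apply/seteqP; split => x; rewrite /ysection/= inE /D/=; first by case.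
  by move=> ?; split.
rewrite (_ : ysection D u = set0) ?measure0//; apply/seteqP; split => // x.
by rewrite /ysection/= inE /D/= ltNge u0; case.
Qed.

Lemma measurable_layer (m : {sigma_finite_measure set T -> \bar R}) (f : T -> \bar R) :
  measurable_fun setT f -> measurable_fun setT (fun u : R => m [set x | u%:E <= f x]).
Proof.
move=> mf; pose D : set (T * R) := [set p | p.2%:E <= f p.1].
have mD : measurable D.
  rewrite -[D]setTI; apply: measurable_lee => //.
    by apply/measurable_EFinP; exact: measurable_snd.
  by apply: (measurableT_comp mf); exact: measurable_fst.
rewrite (_ : (fun u => _) = m \o ysection D); first exact: measurable_fun_ysection.
by apply/funext => u /=; congr (m _); apply/seteqP; split => x; rewrite /ysection/= inE.
Qed.

End layer_cake.

Section one_dim_brunn_minkowski.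
Variable R : realType.

(** Induction on [n]: the defect of the step is w v (x - y) (x^n - y^n), nonnegative because the two
    differences have the same sign. *)
Lemma power_mean_convex (n : nat) (w v x y : R) :
  0 <= w -> 0 <= v -> w + v = 1 -> 0 <= x -> 0 <= y ->
  (w * x + v * y) ^+ n <= w * x ^+ n + v * y ^+ n.
Proof.
move=> w0 v0 wv x0 y0; elim: n => [|n IH]; first by rewrite !expr0 !mulr1 wv.
have E : (w * x + v * y) * (w * x ^+ n + v * y ^+ n) =
    w * x ^+ n.+1 + v * y ^+ n.+1 - w * v * ((x - y) * (x ^+ n - y ^+ n)).
  have -> : v = 1 - w by rewrite -wv addrC addKr.
  by rewrite !exprS; ring.
rewrite exprS (le_trans (ler_wpM2l _ IH))//; first by rewrite addr_ge0 ?mulr_ge0.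
rewrite E lerBlDr lerDl; apply: mulr_ge0; first exact: mulr_ge0.
have [xy|yx] := leP x y.
  by rewrite mulr_le0 ?subr_le0// lerXn2r.
by rewrite mulr_ge0 ?subr_ge0// ?(ltW yx)// lerXn2r// ltW.
Qed.

Let down (X : set R) := forall x y, X x -> 0 <= y <= x -> X y.

(** [X] and [Y] are intervals starting at 0, up to their right end points, so their measures are at
    most their suprema. Any z below the combination c of the suprema is the same combination of the
    suprema scaled by z / c. *)
Lemma lebesgue_brunn_minkowski (X Y Z : set R) (l b : R) :
  0 <= l <= 1 -> down X -> down Y -> X 0 -> Y 0 ->
  X `<=` `[0, b]%classic -> Y `<=` `[0, b]%classic -> measurable Z ->
  measurable X -> measurable Y ->
  (forall x y, X x -> Y y -> Z ((1 - l) * x + l * y)) ->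
  ((1 - l)%:E * lebesgue_measure X + l%:E * lebesgue_measure Y <= lebesgue_measure Z)%E.
Proof.
move=> /andP[l0 l1] dX dY X0 Y0 Xb Yb mZ mX mY XYZ.
have ubX : has_ubound X by exists b => x /Xb; rewrite /= in_itv/= => /andP[].
have ubY : has_ubound Y by exists b => x /Yb; rewrite /= in_itv/= => /andP[].
have leb_sup (W : set R) : has_ubound W -> W 0 -> W `<=` `[0, b]%classic ->
    measurable W -> (lebesgue_measure W <= (sup W)%:E)%E.
  move=> ubW W0 Wb mW; apply: (@le_trans _ _ (lebesgue_measure `[0, sup W]%classic)).
    apply: le_measure; rewrite ?inE//.
    move=> x Wx; rewrite /= in_itv/=; apply/andP; split.
      by have := Wb _ Wx; rewrite /= in_itv/= => /andP[].
    exact: ub_le_sup.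
  rewrite lebesgue_measure_itv/= lte_fin oppr0 adde0; case: ifP => // _.
  by rewrite lee_fin ub_le_sup.
have downlt (W : set R) : has_ubound W -> W 0 -> down W ->
    forall x, 0 <= x -> x < sup W -> W x.
  move=> ubW W0 dW x x0 xW.
  have [|y Wy xy] := @sup_gt _ W x _ xW; first by exists 0.
  by apply: dW Wy _; rewrite x0 ltW.
set p := sup X; set q := sup Y.
have p0 : 0 <= p by exact: ub_le_sup.
have q0 : 0 <= q by exact: ub_le_sup.
pose c := (1 - l) * p + l * q.
have l1' : 0 <= 1 - l by rewrite subr_ge0.
have c0 : 0 <= c by rewrite addr_ge0// mulr_ge0.
apply: (@le_trans _ _ c%:E).
  rewrite (EFinD ((1 - l) * p)) !EFinM; apply: leeD; apply: lee_wpmul2l; rewrite ?lee_fin//;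
  exact: leb_sup.
apply: (@le_trans _ _ (lebesgue_measure `[0, c[%classic)).
  rewrite lebesgue_measure_itv/= lte_fin oppr0 adde0.
  by case: ltP.
apply: le_measure; rewrite ?inE//.
move=> z; rewrite /= in_itv/= => /andP[z0 zc].
have c1 : 0 < c by exact: le_lt_trans zc.
have part (W : set R) : has_ubound W -> W 0 -> down W -> 0 <= sup W -> W (sup W * (z / c)).
  move=> ubW W0 dW; rewrite le_eqVlt => /orP[/eqP <-|sW]; first by rewrite mul0r.
  apply: downlt => //; first by rewrite !mulr_ge0 ?invr_ge0// ltW.
  by rewrite gtr_pMr// ltr_pdivrMr// mul1r.
rewrite (_ : z = (1 - l) * (p * (z / c)) + l * (q * (z / c))); last first.
  by rewrite !mulrA -mulrDl -mulrDl -/c; field; rewrite gt_eqF.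
by apply: XYZ; apply: part.
Qed.

End one_dim_brunn_minkowski.

Section brunn_minkowski.
Variable R : realType.

(** The class on which the Brunn-Minkowski induction runs: it passes to slices, and slices shrink as
    the height grows, so the one at height 0 is the largest. *)
Definition downset n (D : set 'rV[R]_n) : Prop :=
  (forall x, D x -> forall k, 0 <= x 0 k) /\
  (forall x y : 'rV[R]_n, D x -> (forall k, 0 <= y 0 k <= x 0 k) -> D y).

Definition slice n (D : set 'rV[R]_n.+1) (t : R) : set 'rV[R]_n :=
  [set v | D (row_mx (t%:M : 'rV[R]_1) v)].

Lemma lebesgue_volS n (D : set 'rV[R]_n.+1) :
  lebesgue_vol D = (\int[lebesgue_measure]_t lebesgue_vol (slice D t))%E.
Proof. by []. Qed.

Lemma measurable_slice n (D : set 'rV[R]_n.+1) t : measurable D -> measurable (slice D t).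
Proof. exact: measurable_consE. Qed.

Lemma measurable_vol_slice n (D : set 'rV[R]_n.+1) : measurable D ->
  measurable_fun setT (fun t : R => lebesgue_vol (slice D t)).
Proof.
move=> mD; pose D' := (fun p : R * 'rV[R]_n =>
  (row_mx (p.1%:M : 'rV[R]_1) p.2 : 'rV[R]_n.+1)) @^-1` D.
have mD' : measurable D' by rewrite -[D']setTI; exact: measurable_row_mx.
rewrite (_ : (fun t => _) = (@lebesgue_vol R n) \o xsection D').
  exact: measurable_fun_xsection.
by apply/funext => t /=; congr lebesgue_vol; apply/seteqP; split => v; rewrite /xsection/= inE.
Qed.

Lemma rv_lin n (a b : R) (x y : 'rV[R]_n) k :
  (a *: x + b *: y) 0 k = a * x 0 k + b * y 0 k.
Proof. by rewrite !mxE. Qed.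

Section slices.
Variables (n : nat) (D : set 'rV[R]_n.+1).
Hypothesis dD : downset D.

Lemma slice_downset t : downset (slice D t).
Proof.
split=> [v Dv k|v w Dv vw].
  by have := dD.1 _ Dv (lift ord0 k); rewrite rv_consS.
apply: (dD.2 _ _ Dv) => k; case: (unliftP ord0 k) => [j|] ->.
  by rewrite !rv_consS.
by rewrite !rv_cons0 lexx andbT; have := dD.1 _ Dv ord0; rewrite rv_cons0.
Qed.

Lemma slice_ge0 t v : slice D t v -> 0 <= t.
Proof. by move=> /dD.1/(_ ord0); rewrite rv_cons0. Qed.

Lemma slice_mono t t' : 0 <= t' <= t -> slice D t `<=` slice D t'.
Proof.
move=> tt' v Dv; apply: (dD.2 _ _ Dv) => k; case: (unliftP ord0 k) => [j|] ->.
  rewrite !rv_consS lexx andbT.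
  by have := dD.1 _ Dv (lift ord0 j); rewrite rv_consS.
by rewrite !rv_cons0.
Qed.

Lemma slice_cube i t : D `<=` @cube R n.+1 i -> slice D t `<=` @cube R n i.
Proof. by move=> Di v /Di H k; have := H (lift ord0 k); rewrite rv_consS. Qed.

Lemma slice_le i t v : D `<=` @cube R n.+1 i -> slice D t v -> t <= i%:R.
Proof.
by move=> Di /Di /(_ ord0); rewrite rv_cons0 /= in_itv/= => /andP[].
Qed.

Lemma downset0 : D !=set0 -> slice D 0 0.
Proof.
move=> [x Dx]; apply: (dD.2 _ _ Dx) => k.
by case: (unliftP ord0 k) => [j|] ->; rewrite ?rv_consS ?rv_cons0 ?mxE lexx dD.1.
Qed.

Lemma downset_mem0 : D !=set0 -> D 0.
Proof. by move=> [x Dx]; apply: (dD.2 _ _ Dx) => k; rewrite mxE lexx dD.1. Qed.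

End slices.

Lemma vol_cube_fin n i (D : set 'rV[R]_n) : measurable D -> D `<=` @cube R n i ->
  lebesgue_vol D \is a fin_num.
Proof.
move=> mD Di; rewrite ge0_fin_numE; last exact: (measure_ge0 (@lebesgue_vol R n)).
apply: (@le_lt_trans _ _ (lebesgue_vol (@cube R n i))).
  by apply: (le_measure (@lebesgue_vol R n)); rewrite ?inE//; exact: measurable_cube.
rewrite mu_setT; last exact: measurable_cube.
exact: mu_cube_fin.
Qed.

Lemma vol_scale n (c : R) (D : set 'rV[R]_n) : 0 < c -> measurable D ->
  lebesgue_vol [set x | D (c^-1 *: x)] = ((c ^+ n)%:E * lebesgue_vol D)%E.
Proof.
move=> c0 mD; rewrite !mu_setT// ?mu_scale// ?cardsT ?card_ord//.
rewrite -[X in measurable X]setTI; apply: measurable_rv => // k.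
under eq_fun do rewrite mxE.
by apply: measurable_funM => //; exact: measurable_coord.
Qed.

Lemma exists_root (k : nat) (a : R) : (0 < k)%N -> 0 <= a ->
  exists2 r : R, 0 <= r & r ^+ k = a.
Proof.
move=> k0 a0; exists (a `^ k%:R^-1); first exact: powR_ge0.
by rewrite -powR_mulrn ?powR_ge0// -powRrM mulVf ?powRr1// pnatr_eq0 -lt0n.
Qed.

Lemma vol0_nonempty n (D : set 'rV[R]_n) : n = 0%N -> D !=set0 ->
  lebesgue_vol D = 1%E.
Proof.
move=> n0; subst n => -[x Dx] /=; rewrite mem_set// (_ : 0 = x)//.
by apply/rowP => -[].
Qed.

(** Serves the degenerate case of Brunn-Minkowski, in which one of the two bodies is null. *)
Lemma vol_scaled_le n (N U : set 'rV[R]_n) (l m : R) : (0 < n)%N ->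
  measurable N -> measurable U -> 0 <= l -> ((m ^+ n)%:E <= lebesgue_vol N)%E ->
  (forall y, N y -> U (l *: y)) -> (((l * m) ^+ n)%:E <= lebesgue_vol U)%E.
Proof.
move=> n0 mN mU; rewrite le_eqVlt => /orP[/eqP <-|l0] mN' NU.
  by rewrite mul0r expr0n eqn0Ngt n0; exact: (measure_ge0 (@lebesgue_vol R n)).
apply: (@le_trans _ _ (lebesgue_vol [set x | N (l^-1 *: x)])).
  rewrite vol_scale// exprMn EFinM; apply: lee_wpmul2l => //.
  by rewrite lee_fin exprn_ge0// ltW.
apply: (le_measure (@lebesgue_vol R n)); rewrite ?inE//.
  rewrite -[X in measurable X]setTI; apply: measurable_rv => // k.
  under eq_fun do rewrite mxE.
  by apply: measurable_funM => //; exact: measurable_coord.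
by move=> x /= /NU; rewrite scalerA divff ?scale1r// gt_eqF.
Qed.

(* One inductive step: [w] and [v] are the slices at height 0, normalised to have
   volume 1, so that all level sets with levels in [0, 1] are nonempty. *)
Section slicing_step.
Variables (n i : nat) (S N U : set 'rV[R]_n.+1) (l p1 p2 : R).
Hypotheses (mS : measurable S) (mN : measurable N) (mU : measurable U).
Hypotheses (dS : downset S) (dN : downset N).
Hypotheses (Si : S `<=` @cube R n.+1 i) (Ni : N `<=` @cube R n.+1 i).
Hypotheses (S0 : S !=set0) (N0 : N !=set0).
Hypothesis l01 : 0 <= l <= 1.
Hypotheses (p1_gt0 : 0 < p1) (p2_gt0 : 0 < p2).
Hypothesis SE : lebesgue_vol (slice S 0) = (p1 ^+ n)%:E.
Hypothesis NE : lebesgue_vol (slice N 0) = (p2 ^+ n)%:E.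
Let c := (1 - l) * p1 + l * p2.
(** Brunn-Minkowski one dimension lower, for radii in the ratio [p1] to [p2]; they combine to
    [r * c], which is why [c] normalises the slices of [U]. *)
Hypothesis slicesU : forall t t' (r : R), 0 <= r ->
  slice S t !=set0 -> slice N t' !=set0 ->
  (((r * p1) ^+ n)%:E <= lebesgue_vol (slice S t))%E ->
  (((r * p2) ^+ n)%:E <= lebesgue_vol (slice N t'))%E ->
  (((r * c) ^+ n)%:E <= lebesgue_vol (slice U ((1 - l) * t + l * t')))%E.

Let phi (p : R) (D : set 'rV[R]_n.+1) (t : R) : \bar R :=
  ((p ^- n)%:E * lebesgue_vol (slice D t))%E.

Let level p D (u : R) := [set t : R | (u%:E <= phi p D t)%E].

Let phi_ge0 p D t : 0 < p -> (0 <= phi p D t)%E.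
Proof.
move=> p0; apply: mule_ge0; first by rewrite lee_fin invr_ge0 exprn_ge0// ltW.
exact: (measure_ge0 (@lebesgue_vol R n)).
Qed.

Let measurable_phi p D : measurable D -> measurable_fun setT (phi p D).
Proof. by move=> mD; apply: measurable_funeM; exact: measurable_vol_slice. Qed.

Let measurable_level p D u : measurable D -> measurable (level p D u).
Proof.
move=> mD; rewrite -[level _ _ _]setTI.
by apply: emeasurable_fun_c_infty => //; exact: measurable_phi.
Qed.

Let level_vol p D u t : 0 < p -> level p D u t ->
  ((u * p ^+ n)%:E <= lebesgue_vol (slice D t))%E.
Proof.
move=> p0; rewrite /level/= /phi => H.
rewrite -[leRHS](_ : (p ^+ n)%:E * ((p ^- n)%:E * lebesgue_vol (slice D t)) = _)%E.
  by rewrite mulrC EFinM; apply: lee_wpmul2l => //; rewrite lee_fin exprn_ge0// ltW.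
by rewrite muleA -EFinM divff ?mul1e// expf_neq0// gt_eqF.
Qed.

Let level_nonempty p D u t : 0 < p -> 0 < u -> level p D u t -> slice D t !=set0.
Proof.
move=> p0 u0 /(level_vol p0) H; apply/set0P; apply: contraTneq H => ->.
by rewrite lebesgue_vol0 lee_fin -ltNge mulr_gt0// exprn_gt0.
Qed.

Let lower_level p D u : 0 < p -> 0 < u <= 1 -> measurable D -> downset D ->
  D `<=` @cube R n.+1 i -> lebesgue_vol (slice D 0) = (p ^+ n)%:E ->
  [/\ level p D u 0, level p D u `<=` `[0, i%:R]%classic &
    forall x y, level p D u x -> 0 <= y <= x -> level p D u y].
Proof.
move=> p0 /andP[u0 u1] mD dD Di DE; split.
- by rewrite /level/= /phi DE -EFinM mulVf ?lee_fin// expf_neq0// gt_eqF.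
- move=> t /(level_nonempty p0 u0)[v Dv]; rewrite /= in_itv/=.
  by rewrite (slice_ge0 dD Dv) (slice_le Di Dv).
- move=> x y ux xy; apply: (le_trans ux); apply: lee_wpmul2l.
    by rewrite lee_fin invr_ge0 exprn_ge0// ltW.
  by apply: (le_measure (@lebesgue_vol R n)); rewrite ?inE;
    [exact: measurable_slice|exact: measurable_slice|exact: slice_mono].
Qed.

Let upper_level p D u : 0 < p -> 1 < u -> measurable D -> downset D ->
  lebesgue_vol (slice D 0) = (p ^+ n)%:E -> level p D u = set0.
Proof.
move=> p0 u1 mD dD DE; apply/seteqP; split => // t ut.
have [v Dv] := level_nonempty p0 (lt_trans ltr01 u1) ut.
have := level_vol p0 ut; apply/negP; rewrite -ltNge.
apply: (@le_lt_trans _ _ (p ^+ n)%:E); last first.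
  by rewrite lte_fin ltr_pMl// exprn_gt0.
rewrite -DE; apply: (le_measure (@lebesgue_vol R n)); rewrite ?inE.
- exact: measurable_slice.
- exact: measurable_slice.
- by apply: slice_mono => //; rewrite lexx (slice_ge0 dD Dv).
Qed.

Let c_gt0 : 0 < c.
Proof.
have /andP[l0 l1] := l01; rewrite /c.
have [->|l1'] := eqVneq l 1; first by rewrite subrr mul0r add0r mul1r.
by rewrite ltr_pwDl// ?mulr_ge0 ?(ltW p2_gt0)// mulr_gt0// subr_gt0 lt_neqAle l1'.
Qed.

Let level_le u : 0 < u ->
  ((1 - l)%:E * lebesgue_measure (level p1 S u) +
   l%:E * lebesgue_measure (level p2 N u) <= lebesgue_measure (level c U u))%E.
Proof.
move=> u0; have [u1|u1] := leP u 1; last first.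
  by rewrite (upper_level p1_gt0 u1 mS dS SE) (upper_level p2_gt0 u1 mN dN NE) measure0
    !mule0 adde0 measure_ge0.
have u01 : 0 < u <= 1 by rewrite u0.
have [LS0 LSi LSd] := lower_level p1_gt0 u01 mS dS Si SE.
have [LN0 LNi LNd] := lower_level p2_gt0 u01 mN dN Ni NE.
apply: lebesgue_brunn_minkowski LSi LNi _ _ _ _ => //; try exact: measurable_level.
move=> x y ux uy.
have xS := level_nonempty p1_gt0 u0 ux; have yN := level_nonempty p2_gt0 u0 uy.
(* [r] is the [n]-th root of the level. For [n = 0] the value 1 works, since nonempty slices then
   have volume 1 and [u <= 1]. *)
have [r [r0 ur rS rN]] : exists r : R, [/\ 0 <= r, u <= r ^+ n,
    (((r * p1) ^+ n)%:E <= lebesgue_vol (slice S x))%E &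
    (((r * p2) ^+ n)%:E <= lebesgue_vol (slice N y))%E].
  have [n0|n0] := posnP n.
    exists 1; split => //; first by rewrite expr1n.
      by rewrite (vol0_nonempty n0 xS) n0.
    by rewrite (vol0_nonempty n0 yN) n0.
  have [r r0 ru] := exists_root n0 (ltW u0).
  by exists r; split; rewrite ?ru// exprMn ru; exact: level_vol.
rewrite /level/= /phi.
apply: (@le_trans _ _ ((c ^- n)%:E * ((r * c) ^+ n)%:E)%E).
  by rewrite -EFinM exprMn mulrC mulfK ?lee_fin// expf_neq0// gt_eqF.
apply: lee_wpmul2l; first by rewrite lee_fin invr_ge0 exprn_ge0// ltW.
exact: slicesU.
Qed.

Let integral_phi p D : 0 < p -> measurable D ->
  (\int[lebesgue_measure]_(u in `]0%R, +oo[) lebesgue_measure (level p D u) =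
   (p ^- n)%:E * lebesgue_vol D)%E.
Proof.
move=> p0 mD; rewrite -(layer_cake lebesgue_measure (measurable_phi p mD)) => [|t].
  rewrite ge0_integralZl//; first exact: measurable_vol_slice.
  by rewrite lee_fin invr_ge0 exprn_ge0// ltW.
exact: phi_ge0.
Qed.

(** The one-dimensional inequality holds for the level sets at each height [u > 0]; integrating it
    over [u] gives the three volumes by the layer-cake formula. *)
Lemma slicing_step :
  ((1 - l)%:E * ((p1 ^- n)%:E * lebesgue_vol S) +
   l%:E * ((p2 ^- n)%:E * lebesgue_vol N) <= (c ^- n)%:E * lebesgue_vol U)%E.
Proof.
have /andP[l0 l1] := l01; have l1' : 0 <= 1 - l by rewrite subr_ge0.
have mlev p D : measurable D ->
    measurable_fun (`]0, +oo[%classic : set R) (fun u => lebesgue_measure (level p D u)).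
  by move=> mD; apply: measurable_funTS; apply: measurable_layer; exact: measurable_phi.
rewrite -!integral_phi// -!ge0_integralZl//; try exact: mlev.
rewrite -ge0_integralD//; try by move=> u _; rewrite mule_ge0.
- apply: ge0_le_integral => //.
  + by move=> u _; rewrite adde_ge0// mule_ge0.
  + by apply: emeasurable_funD; apply: measurable_funeM; exact: mlev.
  + exact: mlev.
  + by move=> u; rewrite /= in_itv/= andbT => u0; exact: level_le.
- by apply: measurable_funeM; exact: mlev.
- by apply: measurable_funeM; exact: mlev.
Qed.

End slicing_step.

(** Lower bounds by [s ^+ n] and [m ^+ n] take the place of [n]-th roots of volumes, so that the
    induction can start in dimension 0. *)
Lemma brunn_minkowski n i (S N U : set 'rV[R]_n) (l s m : R) :
  measurable S -> measurable N -> measurable U -> downset S -> downset N ->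
  S `<=` @cube R n i -> N `<=` @cube R n i -> S !=set0 -> N !=set0 ->
  0 <= l <= 1 -> (forall x y, S x -> N y -> U ((1 - l) *: x + l *: y)) ->
  0 <= s -> 0 <= m ->
  ((s ^+ n)%:E <= lebesgue_vol S)%E -> ((m ^+ n)%:E <= lebesgue_vol N)%E ->
  ((((1 - l) * s + l * m) ^+ n)%:E <= lebesgue_vol U)%E.
Proof.
elim: n S N U l s m => [|n IH] S N U l s m mS mN mU dS dN Si Ni S0 N0 l01 SNU s0 m0 Ss Nm.
  rewrite vol0_nonempty ?expr0//; case: S0 N0 => x Sx [y Ny].
  by exists ((1 - l) *: x + l *: y); exact: SNU.
have /andP[l0 l1] := l01; have l1' : 0 <= 1 - l by rewrite subr_ge0.
(* [p] is the radius of the largest slice; if it vanishes, all slices are null and so is [D]. *)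
have root0 (D : set 'rV[R]_n.+1) : measurable D -> downset D -> D `<=` @cube R n.+1 i ->
    D !=set0 -> exists2 p : R, 0 <= p &
      lebesgue_vol (slice D 0) = (p ^+ n)%:E /\ (p = 0 -> lebesgue_vol D = 0%E).
  move=> mD dD Di D0; have mD0 := measurable_slice 0 mD.
  have Dfin := vol_cube_fin mD0 (slice_cube Di).
  have [n0|n0] := posnP n.
    exists 1 => //; split; last by move/eqP; rewrite oner_eq0.
    by rewrite expr1n vol0_nonempty//; exists 0; exact: downset0.
  have [p p0 pE] := exists_root n0 (fine_ge0 (measure_ge0 (@lebesgue_vol R n) (slice D 0))).
  exists p => //; split; first by rewrite pE fineK.
  move=> pp0; rewrite lebesgue_volS; apply: integral0_eq => t _; apply/eqP.
  rewrite eq_le; apply/andP; split; last exact: (measure_ge0 (@lebesgue_vol R n)).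
  have [/eqP ->|/set0P[v Dv]] := boolP (slice D t == set0); first by rewrite lebesgue_vol0.
  apply: (@le_trans _ _ (lebesgue_vol (slice D 0))).
    apply: (le_measure (@lebesgue_vol R n)); rewrite ?inE//; first exact: measurable_slice.
    by apply: slice_mono => //; rewrite lexx (slice_ge0 dD Dv).
  by rewrite -[lebesgue_vol _]fineK// -pE pp0 expr0n eqn0Ngt n0.
have sliceU t t' x y : slice S t x -> slice N t' y ->
    slice U ((1 - l) * t + l * t') ((1 - l) *: x + l *: y).
  move=> Sx Ny; have := SNU _ _ Sx Ny; rewrite /slice/=; congr U.
  apply/rowP => k; rewrite rv_lin; case: (unliftP ord0 k) => [j|] ->.
    by rewrite !rv_consS rv_lin.
  by rewrite !rv_cons0.
have [p1 p10 [p1E p1S]] := root0 _ mS dS Si S0.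
have [p2 p20 [p2E p2N]] := root0 _ mN dN Ni N0.
have eq0 (x : R) : 0 <= x -> ((x ^+ n.+1)%:E <= 0)%E -> x = 0.
  rewrite lee_fin => x0 xn0; have /eqP : x ^+ n.+1 = 0.
    by apply/le_anti; rewrite xn0 exprn_ge0.
  by rewrite expf_eq0/= => /eqP.
(* If [S] is null then [s = 0], and [U] contains the multiple [l] of [N] because 0 lies in [S]. *)
move: p10; rewrite le_eqVlt => /orP[/eqP p10|p1_gt0].
  rewrite (eq0 s)//; last by rewrite (le_trans Ss)// p1S.
  rewrite mulr0 add0r; apply: (vol_scaled_le _ mN) => // y Ny.
  by have := SNU _ _ (downset_mem0 dS S0) Ny; rewrite scaler0 add0r.
move: p20; rewrite le_eqVlt => /orP[/eqP p20|p2_gt0].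
  rewrite (eq0 m)//; last by rewrite (le_trans Nm)// p2N.
  rewrite mulr0 addr0; apply: (vol_scaled_le _ mS) => // x Sx.
  by have := SNU _ _ Sx (downset_mem0 dN N0); rewrite scaler0 addr0.
pose c := (1 - l) * p1 + l * p2.
have c_gt0 : 0 < c.
  rewrite /c; have [->|l1e] := eqVneq l 1; first by rewrite subrr mul0r add0r mul1r.
  by rewrite ltr_pwDl// ?mulr_ge0 ?(ltW p2_gt0)// mulr_gt0// subr_gt0 lt_neqAle l1e.
have step : ((1 - l)%:E * ((p1 ^- n)%:E * lebesgue_vol S) +
    l%:E * ((p2 ^- n)%:E * lebesgue_vol N) <= (c ^- n)%:E * lebesgue_vol U)%E.
  apply: (@slicing_step n i) => // t t' r r0 St Nt' rS rN.
  rewrite (_ : r * _ = (1 - l) * (r * p1) + l * (r * p2)); last by ring.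
  apply: (IH (slice S t) (slice N t')) rS rN => //; try exact: measurable_slice;
    try exact: slice_downset; try exact: slice_cube; try by rewrite mulr_ge0// ltW.
  by move=> x y; exact: sliceU.
have -> : lebesgue_vol U = ((c ^+ n)%:E * ((c ^- n)%:E * lebesgue_vol U))%E.
  by rewrite muleA -EFinM divff ?mul1e// expf_neq0// gt_eqF.
have -> : ((1 - l) * s + l * m) ^+ n.+1 =
    c ^+ n * (c ^- n * ((1 - l) * s + l * m) ^+ n.+1).
  by rewrite mulrA divff ?mul1r// expf_neq0// gt_eqF.
rewrite [X in (X <= _)%E]EFinM; apply: lee_wpmul2l.
  by rewrite lee_fin exprn_ge0// ltW.
apply: le_trans step.
apply: (@le_trans _ _ ((1 - l)%:E * ((p1 ^- n)%:E * (s ^+ n.+1)%:E) +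
    l%:E * ((p2 ^- n)%:E * (m ^+ n.+1)%:E))%E); last first.
  by apply: leeD; apply: lee_wpmul2l; rewrite ?lee_fin//; apply: lee_wpmul2l => //;
    rewrite lee_fin invr_ge0 exprn_ge0// ltW.
rewrite -!EFinM -EFinD lee_fin.
(* The weights have sum 1 and the corresponding mean of [s / p1] and [m / p2] is ((1 - l) s + l m) /
   c, so convexity of the power closes the step. *)
have := @power_mean_convex R n.+1 ((1 - l) * p1 / c) (l * p2 / c) (s / p1) (m / p2).
have p1n : p1 != 0 by rewrite gt_eqF.
have p2n : p2 != 0 by rewrite gt_eqF.
have cn : c != 0 by rewrite gt_eqF.
have nn (x y : R) : 0 <= x -> 0 < y -> 0 <= x / y.
  by move=> x0 y0; rewrite divr_ge0// ltW.
move=> /(_ (nn _ _ (mulr_ge0 l1' (ltW p1_gt0)) c_gt0) (nn _ _ (mulr_ge0 l0 (ltW p2_gt0)) c_gt0)).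
rewrite -mulrDl divff// => /(_ erefl (nn _ _ s0 p1_gt0) (nn _ _ m0 p2_gt0)).
have -> : (1 - l) * p1 / c * (s / p1) + l * p2 / c * (m / p2) = ((1 - l) * s + l * m) / c.
  by field; rewrite p1n p2n cn.
rewrite !expr_div_n ler_pdivrMr ?exprn_gt0// => H; rewrite mulrC ler_pdivrMr ?exprn_gt0//.
apply: (le_trans H); rewrite le_eqVlt; apply/orP; left; apply/eqP.
rewrite !exprS.
have := expf_neq0 n p1n; have := expf_neq0 n p2n; have := expf_neq0 n cn.
move: (p1 ^+ n) (p2 ^+ n) (c ^+ n) (s ^+ n) (m ^+ n) => P1 P2 C S' M' C0 P20 P10.
by field; rewrite P10 P20 p1n p2n cn.
Qed.

End brunn_minkowski.

(** * Volume of L_p-sums *)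

Section power_sum.
Variable R : realType.

(* [p] and [q] enter the [L_p]-sum only through [s = 1/q]. *)
Definition power_sum n (s : R) (K L : set 'rV[R]_n) : set 'rV[R]_n :=
  [set z | exists x y t, [/\ K x, L y, 0 <= t <= 1 &
    z = ((1 - t) `^ s) *: x + (t `^ s) *: y]].

Let coefs (s : R) : set (R * R) :=
  (fun t => ((1 - t) `^ s, t `^ s)) @` `[0, 1]%classic.

Let compact_coefs (s : R) : 0 <= s -> compact (coefs s).
Proof.
rewrite le_eqVlt => /orP[/eqP <-|s0].
  (* Powers with exponent 0 are 1 even at base 0, so the curve of coefficients degenerates to a
     point. *)
  rewrite (_ : coefs 0 = [set (1, 1)]); first exact: compact_set1.
  apply/seteqP; split => x /=.
    by move=> [t _ <-]; rewrite !powRr0.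
  by move=> ->; exists 0; [rewrite /= in_itv/= lexx ler01|rewrite !powRr0].
have sn0 : s != 0 by rewrite gt_eqF.
have powK (y : R) : 0 <= y -> (y `^ s^-1) `^ s = y.
  by move=> y0; rewrite -powRrM mulVf// powRr1.
have pow_le1 (y r : R) : 0 <= r -> 0 <= y <= 1 -> 0 <= y `^ r <= 1.
  move=> r0 /andP[y0 y1]; rewrite powR_ge0/=.
  rewrite -[leRHS](_ : 1 `^ r = 1); last by rewrite powR1.
  by rewrite ge0_ler_powR// nnegrE.
have powM (a b : R) : 0 <= a -> 0 <= b -> (a `^ s <= b `^ s) = (a <= b).
  move=> a0 b0; apply/idP/idP => [|ab]; last by rewrite ge0_ler_powR ?nnegrE// ltW.
  move=> H; rewrite leNgt; apply/negP => ba; move: H; apply/negP.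
  by rewrite -ltNge gt0_ltr_powR ?nnegrE.
apply: continuous_compact; last exact: segment_compact.
(* Continuity up to the end points, where the base of the power may vanish, comes from being
   strictly monotone and onto the interval between the end values. *)
have c1 : {within `[0, 1], continuous (fun t : R => (1 - t) `^ s)}.
  apply: (@segment_dec_surj_continuous R 0 1 (fun t => (1 - t) `^ s)).
    move=> a b; rewrite !in_itv/= => /andP[a0 a1] /andP[b0 b1].
    by rewrite powM ?subr_ge0// lerD2l lerN2.
  move=> y; rewrite /= subrr subr0 powR1 powR0// in_itv/= => y01.
  have y0 : 0 <= y by case/andP: y01.
  have sy := pow_le1 y s^-1; have := sy; rewrite invr_ge0 (ltW s0) => /(_ isT y01)/andP[u0 u1].
  exists (1 - y `^ s^-1); last by rewrite subKr powK.
  by rewrite /= in_itv/= subr_ge0 u1 lerBlDr lerDl.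
have c2 : {within `[0, 1], continuous (fun t : R => t `^ s)}.
  apply: (@segment_inc_surj_continuous R 0 1 (fun t => t `^ s)).
    move=> a b; rewrite !in_itv/= => /andP[a0 a1] /andP[b0 b1].
    by rewrite powM.
  move=> y; rewrite /= powR1 powR0// in_itv/= => y01.
  have y0 : 0 <= y by case/andP: y01.
  by exists (y `^ s^-1); [rewrite /= in_itv/=; apply: pow_le1 => //; rewrite invr_ge0 ltW|exact: powK].
by move=> x; exact: (cvg_pair (c1 x) (c2 x)).
Qed.

Lemma compact_power_sum n (s : R) (K L : set 'rV[R]_n) : 0 <= s ->
  compact K -> compact L -> compact (power_sum s K L).
Proof.
move=> s0 cK cL.
rewrite (_ : power_sum s K L =
  (fun p : (R * R) * ('rV[R]_n * 'rV[R]_n) => p.1.1 *: p.2.1 + p.1.2 *: p.2.2) @`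
  (coefs s `*` (K `*` L))).
  apply: continuous_compact; last first.
    by apply: compact_setX; [exact: compact_coefs|exact: compact_setX].
  apply: continuous_subspaceT => p.
  apply: cvgD; apply: cvgZ.
  - by apply: (cvg_comp _ _ cvg_fst); exact: cvg_fst.
  - by apply: (cvg_comp _ _ cvg_snd); exact: cvg_fst.
  - by apply: (cvg_comp _ _ cvg_fst); exact: cvg_snd.
  - by apply: (cvg_comp _ _ cvg_snd); exact: cvg_snd.
apply/seteqP; split => z /=.
  move=> [x [y [t [Kx Ly t01 ->]]]].
  exists (((1 - t) `^ s, t `^ s), (x, y)) => //=; split => //.
  by exists t.
move=> [[[a b] [x y]]] /= [[t t01 [<- <-]] [Kx Ly] <-].
by exists x, y, t; split.
Qed.

Lemma compact_coord_proj n (J : {set 'I_n}) (K : set 'rV[R]_n) :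
  compact K -> compact (coord_proj J @` K).
Proof.
move=> cK; apply: continuous_compact => //; apply: continuous_subspaceT => x.
move=> A /= /(nbhs_ballP (coord_proj J x))[e /= e0 xA].
apply/nbhs_ballP; exists e => //= y [_ xy]; apply: xA; split => // a k; rewrite !mxE.
by case: ifP => kJ; [exact: xy|exact: ballxx].
Qed.

Lemma compact_measurable_rv n (K : set 'rV[R]_n) : compact K -> measurable K.
Proof.
by move=> cK; apply: closed_measurable_rv; apply: compact_closed cK; exact: norm_hausdorff.
Qed.

Lemma compact_cube n (K : set 'rV[R]_n) : compact K -> exists i, K `<=` @cube R n i.
Proof.
move=> /compact_bounded[M [_ MK]].
pose i := (Num.truncn (M + 1)).+1.
exists i => x Kx k /=; rewrite in_itv/= -ler_norml.
have := MK (M + 1); rewrite ltrDl => /(_ ltr01 _ Kx) xM.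
apply: (@le_trans _ _ (M + 1)); last exact/ltW/truncnS_gt.
apply: le_trans xM.
rewrite [leRHS]/Num.norm/= mx_normrE; apply/bigmax_geP; right => /=.
by exists (ord0, k).
Qed.

End power_sum.

Section tonelli_on.
Local Open Scope ereal_scope.
Context d1 d2 (T1 : measurableType d1) (T2 : measurableType d2) (R : realType).
Variable m1 : {sigma_finite_measure set T1 -> \bar R}.
Variable m2 : {sigma_finite_measure set T2 -> \bar R}.
Variables (D : set (T1 * T2)) (g : T1 * T2 -> \bar R).
Hypotheses (mD : measurable D) (mg : measurable_fun setT g).
Hypothesis g0 : forall p, 0 <= g p.

Let gD := g \_ D.

Let mgD : measurable_fun setT gD.
Proof. by apply/measurable_restrict => //; exact: measurable_funTS. Qed.

Let gD0 p : 0 <= gD p.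
Proof. by apply: erestrict_ge0 => q _; exact: g0. Qed.

Let xE x : \int[m2]_(y in xsection D x) g (x, y) = \int[m2]_y gD (x, y).
Proof.
rewrite integral_mkcond; apply: eq_integral => y _; rewrite /gD !patchE.
by congr (if _ then _ else _); apply/idP/idP; rewrite !inE /xsection/= inE.
Qed.

Lemma tonelli_on :
  \int[m1]_x \int[m2]_(y in xsection D x) g (x, y) =
  \int[m2]_y \int[m1]_(x in ysection D y) g (x, y).
Proof.
transitivity (\int[m1]_x \int[m2]_y gD (x, y)); first by apply: eq_integral => x _.
rewrite [LHS](fubini_tonelli gD mgD gD0); apply: eq_integral => y _.
rewrite [RHS]integral_mkcond; apply: eq_integral => x _; rewrite /gD !patchE.
by congr (if _ then _ else _); apply/idP/idP; rewrite !inE /ysection/= inE.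
Qed.

Lemma measurable_tonelli_on :
  measurable_fun setT (fun x => \int[m2]_(y in xsection D x) g (x, y)).
Proof.
under eq_fun do rewrite xE.
exact: (@measurable_fun_fubini_tonelli_F _ _ _ _ _ m2 gD).
Qed.

End tonelli_on.

(** * The Gamma integral *)

Section gamma_integral.
Variable R : realType.
Local Open Scope ereal_scope.

Lemma integral_expR_ray (m : R) :
  \int[lebesgue_measure]_(t in `[m, +oo[) (expR (- t))%:E = (expR (- m))%:E.
Proof.
have cexp : continuous (fun z : R => expR (- z)%R).
  move=> z; apply: continuous_comp; last exact: continuous_expR.
  exact: opp_continuous.
rewrite (@ge0_continuous_FTC2y _ _ (fun x => - expR (- x))%R _ 0%R).
- by rewrite -EFinB sub0r opprK.
- by move=> x _; exact: expR_ge0.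
- exact: continuous_subspaceT.
- by rewrite -oppr0; apply: cvgN; exact: cvgr_expR.
- by move=> x _; exact: ex_derive.
- by apply: cvgN; apply/cvg_at_right_filter; exact: cexp.
- move=> x _; rewrite derive1_comp// derive1N// derive1_id mulN1r derive1_comp// derive1E.
  have /funeqP -> := @derive_expR R.
  by rewrite derive1N// derive1_id mulrN1 opprK.
Qed.

Lemma integral_exprn (m : nat) (t : R) : (0 < t)%R ->
  \int[lebesgue_measure]_(s in `[0%R, t]) (m.+1%:R * s ^+ m)%:E = (t ^+ m.+1)%:E.
Proof.
move=> t0; rewrite (@continuous_FTC2 _ _ (fun s => s ^+ m.+1)%R)//.
- by rewrite expr0n/= sube0.
- apply: continuous_subspaceT => x; apply: cvgM; first exact: cvg_cst.
  exact: exprn_continuous.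
- split; first by move=> x _; exact: exprn_derivable.
  + by apply/cvg_at_right_filter; exact: exprn_continuous.
  + by apply/cvg_at_left_filter; exact: exprn_continuous.
- move=> x _; by rewrite exp_derive1.
Qed.

(** This is Gamma (1 + a), as an extended real so that Tonelli applies before finiteness is
    known. *)
Definition Gam (a : R) : \bar R :=
  \int[lebesgue_measure]_(t in `]0%R, +oo[) (t `^ a * expR (- t))%:E.

Let measurable_expRN : measurable_fun setT (fun t : R => expR (- t)%R).
Proof. by apply: (measurableT_comp (@measurable_expR R)). Qed.

Let ray_oc (m : R) (f : R -> R) : measurable_fun setT f ->
  \int[lebesgue_measure]_(t in `]m, +oo[) (f t)%:E =
  \int[lebesgue_measure]_(t in `[m, +oo[) (f t)%:E.
Proof.
move=> mf; apply: integral_itv_obnd_cbnd.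
by apply/measurable_EFinP; exact: measurable_funTS.
Qed.

Lemma measurable_gamma_integrand (a : R) :
  measurable_fun setT (fun t : R => (t `^ a * expR (- t))%R).
Proof. by apply: measurable_funM => //; exact: measurable_powR. Qed.

(** Writes t^(m+1) as the integral of (m+1) s^m over 0 < s <= t and exchanges the order: integrating
    exp (- t) over t >= s leaves the integral for [m]. *)
Lemma Gam_nat (m : nat) : Gam m%:R = (m`!%:R)%:E.
Proof.
rewrite /Gam; elim: m => [|m IH].
  under eq_integral do rewrite powRr0 mul1r.
  by rewrite ray_oc// integral_expR_ray oppr0 expR0.
pose D : set (R * R) := [set p | (0 < p.2)%R /\ (p.2 <= p.1)%R].
have mD : measurable D.
  rewrite (_ : D = (@snd R R @^-1` `]0%R, +oo[) `&` [set p | (p.2 <= p.1)%R]).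
    apply: measurableI.
      by rewrite -[_ @^-1` _]setTI; exact: measurable_snd.
    rewrite -[X in measurable X]setTI; apply: measurable_fun_le => //.
  by apply/seteqP; split => p; rewrite /D/= in_itv/= andbT.
have mg : measurable_fun setT
    (fun p : R * R => (m.+1%:R * `|p.2| ^+ m * expR (- p.1))%:E).
  apply/measurable_EFinP; apply: measurable_funM.
    apply: measurable_funM; first exact: measurable_cst.
    apply: measurable_funX; apply: (measurableT_comp (@normr_measurable R setT)).
    exact: measurable_snd.
  by apply: (measurableT_comp measurable_expRN); exact: measurable_fst.
have g0 (p : R * R) : 0 <= (m.+1%:R * `|p.2| ^+ m * expR (- p.1))%:E.
  by rewrite lee_fin !mulr_ge0// ?exprn_ge0// expR_ge0.
transitivity (\int[lebesgue_measure]_x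
    \int[lebesgue_measure]_(y in xsection D x) (m.+1%:R * `|y| ^+ m * expR (- x))%:E).
  rewrite integral_mkcond; apply: eq_integral => t _; rewrite patchE mem_setE in_itv/= andbT.
  case: ltP => t0; last first.
    have -> : xsection D t = set0.
      apply/seteqP; split => // s; rewrite /xsection/= inE /D/= => -[s0 st].
      by have := lt_le_trans s0 st; rewrite ltNge t0.
    by rewrite integral_set0.
  rewrite (_ : xsection D t = `]0%R, t]%classic); last first.
    by apply/seteqP; split => s; rewrite /xsection/= inE /D/= in_itv/=; [case=> -> ->|case/andP].
  under eq_integral => s.
    rewrite inE/= in_itv/= => /andP[s0 _].
    rewrite ger0_norm ?(ltW s0)// mulrC EFinM.
    over.
  have mh : measurable_fun setT (fun s : R => (m.+1%:R * s ^+ m)%R).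
    by apply: measurable_funM; [exact: measurable_cst|exact: exprn_measurable].
  rewrite ge0_integralZl ?lee_fin ?expR_ge0//.
  - rewrite integral_itv_obnd_cbnd; last by apply/measurable_EFinP; exact: measurable_funTS.
    by rewrite integral_exprn// -EFinM mulrC powR_mulrn// ltW.
  - by apply/measurable_EFinP; exact: measurable_funTS.
  - by move=> s; rewrite /= in_itv/= => /andP[s0 _]; rewrite lee_fin mulr_ge0 ?exprn_ge0 ?ltW.
rewrite (tonelli_on lebesgue_measure lebesgue_measure mD mg g0).
transitivity (\int[lebesgue_measure]_(s in `]0%R, +oo[) ((m.+1%:R : R)%:E * (s `^ m%:R * expR (- s))%:E)).
  rewrite [RHS]integral_mkcond; apply: eq_integral => s _; rewrite patchE mem_setE in_itv/= andbT.
  case: ltP => s0; last first.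
    have -> : ysection D s = set0.
      apply/seteqP; split => // t; rewrite /ysection/= inE /D/= => -[].
      by rewrite ltNge s0.
    by rewrite integral_set0.
  rewrite (_ : ysection D s = `[s, +oo[%classic); last first.
    by apply/seteqP; split => t; rewrite /ysection/= inE /D/= in_itv/= andbT; [case|].
  under eq_integral do rewrite EFinM.
  rewrite ge0_integralZl//.
  - by rewrite integral_expR_ray -!EFinM mulrA ger0_norm ?(ltW s0)// powR_mulrn// ltW.
  - by apply/measurable_EFinP; exact: measurable_funTS.
rewrite ge0_integralZl ?lee_fin//.
- by rewrite IH -EFinM -natrM factS.
- by apply/measurable_EFinP/measurable_funTS; exact: measurable_gamma_integrand.
- by move=> s _; rewrite lee_fin mulr_ge0 ?powR_ge0 ?expR_ge0.
Qed.

(** For an integer m >= a one has t^a <= 1 + t^m, so two factorials bound the integral. *)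
Lemma Gam_fin_num (a : R) : (0 <= a)%R -> Gam a \is a fin_num.
Proof.
move=> a0; have g0 b (t : R) : 0 <= (t `^ b * expR (- t))%:E.
  by rewrite lee_fin mulr_ge0 ?powR_ge0 ?expR_ge0.
have mg b : measurable_fun (`]0%R, +oo[%classic : set R) (fun t => (t `^ b * expR (- t))%:E).
  by apply/measurable_EFinP/measurable_funTS; exact: measurable_gamma_integrand.
rewrite ge0_fin_numE; last by apply: integral_ge0 => t _.
pose m := (Num.truncn a).+1.
apply: (@le_lt_trans _ _ (Gam 0%:R + Gam m%:R)); last first.
  by rewrite !Gam_nat -EFinD ltry.
rewrite /Gam -ge0_integralD//; [|exact: mg..].
apply: ge0_le_integral => //.
  exact: mg.
  by apply: emeasurable_funD; exact: mg.
move=> t; rewrite /= in_itv/= andbT => t0.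
rewrite -EFinD lee_fin -mulrDl ler_wpM2r ?expR_ge0// powRr0.
have [t1|t1] := leP 1%R t.
  apply: (@le_trans _ _ (t `^ m%:R)%R); last by rewrite lerDr.
  by apply: ler_powR => //; apply/ltW/truncnS_gt.
apply: (@le_trans _ _ 1%R); last by rewrite lerDl powR_ge0.
have [->|an0] := eqVneq a 0%R; first by rewrite powRr0.
rewrite -[leRHS](_ : 1 `^ a = 1)%R; last by rewrite powR1.
by rewrite ge0_ler_powR// ?nnegrE// ltW.
Qed.

Lemma Gam_gt0 (a : R) : (0 <= a)%R -> 0 < Gam a.
Proof.
move=> a0; apply: (@lt_le_trans _ _ (expR (- 1))%:E); first by rewrite lte_fin expR_gt0.
rewrite -integral_expR_ray.
apply: (@le_trans _ _ (\int[lebesgue_measure]_(t in `[1%R, +oo[) (t `^ a * expR (- t))%:E)).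
  apply: ge0_le_integral => //.
    by apply/measurable_EFinP; exact: measurable_funTS.
    by apply/measurable_EFinP/measurable_funTS; exact: measurable_gamma_integrand.
  move=> t; rewrite /= in_itv/= andbT => t1; rewrite lee_fin ler_peMl ?expR_ge0//.
  by rewrite -[leLHS](powRr0 t) ler_powR.
apply: ge0_subset_integral => //.
  by apply/measurable_EFinP/measurable_funTS; exact: measurable_gamma_integrand.
  by move=> t _; rewrite lee_fin mulr_ge0 ?powR_ge0 ?expR_ge0.
by move=> t; rewrite /= !in_itv/= !andbT => t1; exact: lt_le_trans ltr01 t1.
Qed.

Lemma gamma_fun1D (a : R) : gamma_fun (1 + a)%R = fine (Gam a).
Proof.
rewrite /gamma_fun /Rintegral /Gam; congr fine; apply: eq_integral => t _.
by rewrite addrAC subrr add0r.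
Qed.

Lemma gamma_fun_gt0 (a : R) : (0 <= a)%R -> (0 < gamma_fun (1 + a))%R.
Proof.
move=> a0; rewrite gamma_fun1D fine_gt0// Gam_gt0//=.
by rewrite ltey_eq Gam_fin_num.
Qed.

Lemma gamma_funE (a : R) : (0 <= a)%R -> Gam a = (gamma_fun (1 + a))%:E.
Proof. by move=> a0; rewrite gamma_fun1D fineK// Gam_fin_num. Qed.

(** Such a set is the ray from its infimum, up to the end point. *)
Lemma integral_expR_upset (T : set R) : measurable T -> T `<=` `[0%R, +oo[%classic ->
  (forall x y, T x -> (x <= y)%R -> T y) -> T !=set0 ->
  \int[lebesgue_measure]_(t in T) (expR (- t))%:E = (expR (- inf T))%:E.
Proof.
move=> mT T0 Tup Tn0.
have lbT : has_lbound T by exists 0%R => t /T0; rewrite /= in_itv/= andbT.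
apply/eqP; rewrite eq_le; apply/andP; split.
  rewrite -integral_expR_ray; apply: ge0_subset_integral => //.
  - by apply/measurable_EFinP; exact: measurable_funTS.
  - by move=> t Tt; rewrite /= in_itv/= andbT; exact: ge_inf.
rewrite -integral_expR_ray -ray_oc//; apply: ge0_subset_integral => //.
- by apply/measurable_EFinP; exact: measurable_funTS.
- move=> t; rewrite /= in_itv/= andbT => mt; have [x Tx xt] := inf_lt Tn0 mt.
  exact: Tup Tx (ltW xt).
Qed.

End gamma_integral.

Section integral_join.
Variables (R : realType) (n : nat).
Implicit Types J : {set 'I_n}.
Local Open Scope ereal_scope.

Lemma integral_join J J' (f : 'rV[R]_n -> \bar R) : [disjoint J & J']%B ->
  measurable_fun setT f -> (forall z, 0 <= f z) ->
  \int[mu (J :|: J')]_z f z = \int[mu J]_x \int[mu J']_y f (join J J' (x, y)).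
Proof.
move=> JJ' mf f0.
have mfj : measurable_fun setT (f \o join J J').
  by apply: (measurableT_comp mf); exact: measurable_join.
transitivity (\int[mu J \x mu J']_p (f \o join J J') p); last first.
  by apply: fubini_tonelli1 => // p; exact: f0.
have := @ge0_integral_pushforward _ _ _ _ R (join J J') (measurable_join J J')
  (mu J \x mu J') setT f measurableT mf (fun y _ => f0 y).
rewrite preimage_setT => <-.
apply: eq_measure_integral; first exact: measurable_join.
by move=> mj A mA _; exact: mu_join.
Qed.

Lemma coord_projK J (x : 'rV[R]_n) : coord_proj J (coord_proj J x) = coord_proj J x.
Proof. by apply/rowP => k; rewrite !mxE; case: (k \in J). Qed.

Lemma coord_projD J (x y : 'rV[R]_n) :
  coord_proj J (x + y)%R = (coord_proj J x + coord_proj J y)%R.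
Proof. by apply/rowP => k; rewrite !mxE; case: (k \in J); rewrite ?addr0. Qed.

Lemma coord_projZ J c (x : 'rV[R]_n) : coord_proj J (c *: x)%R = (c *: coord_proj J x)%R.
Proof. by apply/rowP => k; rewrite !mxE; case: (k \in J); rewrite ?mulr0. Qed.

Lemma coord_proj_disjoint J J' (x : 'rV[R]_n) : [disjoint J & J']%B ->
  coord_proj J (coord_proj J' x) = 0%R.
Proof.
move=> JJ'; apply/rowP => k; rewrite !mxE; case: ifP => // kJ.
by rewrite (disjointFr JJ' kJ).
Qed.

Lemma mu_coord_proj J (A : set 'rV[R]_n) : mu J [set x | A (coord_proj J x)] = mu J A.
Proof.
rewrite /mu /pushforward; congr lebesgue_vol; apply/seteqP; split => v /=;
  rewrite (_ : coord_proj J (emb v) = emb v)//; apply/rowP => k;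
  by rewrite mxE; case: ifPn => // kJ; rewrite emb_notin.
Qed.

End integral_join.

(** * The gauge of a sum over complementary subspaces *)

Section power_sum_volume.
Variables (R : realType) (n : nat) (s : R).
Hypothesis s0 : 0 <= s.
Implicit Types (J : {set 'I_n}) (K L : set 'rV[R]_n).
Local Open Scope ereal_scope.

Definition scales K (u : 'rV[R]_n) : set R :=
  [set t | (0 < t)%R /\ K (t `^ (- s) *: u)%R].

(* [exp (- N u)] for the functional [N u = inf {t | u \in t^s K}]. *)
Definition gauge_exp K (u : 'rV[R]_n) : \bar R :=
  \int[lebesgue_measure]_(t in scales K u) (expR (- t))%:E.

Let graph K : set ('rV[R]_n * R) :=
  [set p | (0 < p.2)%R /\ K (p.2 `^ (- s) *: p.1)%R].

Let measurable_graph K : measurable K -> measurable (graph K).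
Proof.
move=> mK.
rewrite (_ : graph K = (@snd 'rV[R]_n R @^-1` `]0%R, +oo[) `&`
    (fun p : 'rV[R]_n * R => p.2 `^ (- s) *: p.1)%R @^-1` K).
  apply: measurableI.
    by rewrite -[_ @^-1` _]setTI; exact: measurable_snd.
  rewrite -[_ @^-1` _]setTI; apply: measurable_rv => // k.
  under eq_fun do rewrite mxE.
  apply: measurable_funM.
    apply: (measurableT_comp (@measurable_powR R (- s))); exact: measurable_snd.
  by apply: (measurableT_comp (measurable_coord k)); exact: measurable_fst.
by apply/seteqP; split => p; rewrite /graph/= in_itv/= andbT.
Qed.

Let measurable_expRN : measurable_fun setT (fun p : 'rV[R]_n * R => (expR (- p.2))%:E).
Proof.
apply/measurable_EFinP; apply: (measurableT_comp (@measurable_expR R)).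
by apply: measurable_funN; exact: measurable_snd.
Qed.

Let expRN_ge0 (p : 'rV[R]_n * R) : 0 <= (expR (- p.2))%:E.
Proof. by rewrite lee_fin expR_ge0. Qed.

Let scalesE K u : scales K u = xsection (graph K) u.
Proof. by apply/seteqP; split => t; rewrite /xsection/= inE. Qed.

Lemma measurable_scales K u : measurable K -> measurable (scales K u).
Proof. by move=> mK; rewrite scalesE; apply: measurable_xsection; exact: measurable_graph. Qed.

Lemma gauge_exp_ge0 K u : 0 <= gauge_exp K u.
Proof. by apply: integral_ge0 => t _; rewrite lee_fin expR_ge0. Qed.

Lemma measurable_gauge_exp K : measurable K -> measurable_fun setT (gauge_exp K).
Proof.
move=> mK; rewrite /gauge_exp; under eq_fun do rewrite scalesE.
exact: (measurable_tonelli_on lebesgue_measure (measurable_graph mK) measurable_expRN).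
Qed.

(** At fixed [t] the set of [u] in t^s K has measure t^(#|J| s) times that of [K]; Tonelli then
    leaves the Gamma integral. *)
Lemma integral_gauge_exp J K : measurable K ->
  \int[mu J]_u gauge_exp K u = mu J K * Gam (#|J|%:R * s)%R.
Proof.
move=> mK; rewrite /gauge_exp; under eq_integral do rewrite scalesE.
rewrite (tonelli_on (mu J) lebesgue_measure (measurable_graph mK) measurable_expRN expRN_ge0).
rewrite /Gam -ge0_integralZl//; first last.
- by move=> t _; rewrite lee_fin mulr_ge0 ?powR_ge0 ?expR_ge0.
- by apply/measurable_EFinP/measurable_funTS; exact: measurable_gamma_integrand.
rewrite [RHS]integral_mkcond; apply: eq_integral => t _; rewrite patchE mem_setE in_itv/= andbT.
rewrite integral_cst; last first.
  by apply: measurable_ysection; exact: measurable_graph.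
case: ltP => t0; last first.
  rewrite (_ : ysection _ _ = set0) ?measure0 ?mule0//; apply/seteqP; split => // u.
  by rewrite /ysection/= inE /graph/= => -[]; rewrite ltNge t0.
rewrite (_ : ysection _ _ = [set u | K ((t `^ s)^-1 *: u)%R]); last first.
  by apply/seteqP; split => u; rewrite /ysection/= inE /graph/= powRN; [case|].
rewrite [X in _ * X](mu_scale J (powR_gt0 s t0) mK).
rewrite muleA -EFinM [RHS]muleC; congr (_%:E * _).
by rewrite mulrC; congr (_ * _)%R; rewrite -powR_mulrn ?powR_ge0// -powRrM mulrC.
Qed.

Definition starlike K : Prop :=
  K 0%R /\ forall x (r : R), K x -> (0 <= r <= 1)%R -> K (r *: x)%R.

Let powR_invl (t : R) : (0 < t)%R -> (t^-1 `^ s = t `^ (- s))%R.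
Proof. by move=> t0; rewrite powRN -powR_inv1 ?(ltW t0)// powRAC powR_inv1 ?powR_ge0. Qed.

(** The inequality [c < t] is strict because [c] may be 0, a value that [scales] excludes. *)
Let scales_of K (u : 'rV[R]_n) (c : R) x (t : R) : starlike K -> (0 <= c)%R -> K x -> u = (c `^ s *: x)%R ->
  (c < t)%R -> scales K u t.
Proof.
move=> [_ Kr] c0 Kx -> ct; have t0 := le_lt_trans c0 ct.
split => //; rewrite scalerA; apply: Kr => //.
have -> : (t `^ (- s) * c `^ s = (c / t) `^ s)%R.
  by rewrite powRM ?invr_ge0 ?(ltW t0)// powR_invl// mulrC.
rewrite powR_ge0/= -[leRHS](_ : 1 `^ s = 1)%R; last by rewrite powR1.
have ct0 : (0 <= c / t)%R by rewrite divr_ge0// ltW.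
by rewrite ge0_ler_powR// ?nnegrE// ler_pdivrMr// mul1r ltW.
Qed.

Let scales_up K u t t' : starlike K -> scales K u t -> (t <= t')%R -> scales K u t'.
Proof.
move=> sK [t0 Kt]; rewrite le_eqVlt => /orP[/eqP <-//|].
apply: (scales_of sK (ltW t0) Kt).
by rewrite scalerA powRN divff ?scale1r// gt_eqF// powR_gt0.
Qed.

Let gauge_exp_inf K u : measurable K -> starlike K -> scales K u !=set0 ->
  gauge_exp K u = (expR (- inf (scales K u)))%:E.
Proof.
move=> mK sK K0; apply: integral_expR_upset => //.
- exact: measurable_scales.
- by move=> t [/ltW t0 _]; rewrite /= in_itv/= andbT.
- by move=> x y /(scales_up sK); apply.
Qed.

Section orthogonal_sum.
Variables (J J' : {set 'I_n}) (A B : set 'rV[R]_n).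
Hypothesis JJ' : [disjoint J & J']%B.
Hypotheses (sA : starlike A) (sB : starlike B).
Hypotheses (cA : compact A) (cB : compact B).
Hypotheses (AJ : forall x, A x -> coord_proj J x = x).
Hypotheses (BJ' : forall x, B x -> coord_proj J' x = x).

Let W := power_sum s A B.

Let J'J : [disjoint J' & J]%B. Proof. by rewrite disjoint_sym. Qed.

Let mA : measurable A. Proof. exact: compact_measurable_rv. Qed.
Let mB : measurable B. Proof. exact: compact_measurable_rv. Qed.
Let mW : measurable W.
Proof. by apply: compact_measurable_rv; exact: compact_power_sum. Qed.

Let starlike_power_sum : starlike W.
Proof.
split.
  by exists 0%R, 0%R, 0%R; split; [exact: sA.1|exact: sB.1|rewrite lexx ler01|rewrite !scaler0 addr0].
move=> z r [x [y [t [Ax By t01 ->]]]] r01.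
exists (r *: x)%R, (r *: y)%R, t; split => //; [exact: sA.2|exact: sB.2|].
by rewrite scalerDr !scalerA mulrC [in X in (_ + X)%R]mulrC.
Qed.

Variables (a b : 'rV[R]_n).
Hypotheses (aJ : coord_proj J a = a) (bJ' : coord_proj J' b = b).

Let scales_add t1 t2 : scales A a t1 -> scales B b t2 -> scales W (a + b)%R (t1 + t2)%R.
Proof.
move=> [t10 At1] [t20 Bt2]; have t0 : (0 < t1 + t2)%R by rewrite addr_gt0.
(* The parameter t2 / (t1 + t2) gives both summands the common factor (t1 + t2)^(-s). *)
split => //; exists (t1 `^ (- s) *: a)%R, (t2 `^ (- s) *: b)%R, (t2 / (t1 + t2))%R.
have E : (1 - t2 / (t1 + t2) = t1 / (t1 + t2))%R by field; rewrite gt_eqF.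
have P t : (0 < t)%R -> ((t / (t1 + t2)) `^ s * t `^ (- s) = (t1 + t2) `^ (- s))%R.
  move=> tt; rewrite powRM ?invr_ge0 ?ltW// mulrAC powRN mulfV ?mul1r; last first.
    by rewrite gt_eqF// powR_gt0.
  exact: powR_invl.
split => //.
  by rewrite (divr_ge0 (ltW t20) (ltW t0))/= ler_pdivrMr// mul1r lerDr ltW.
by rewrite E !scalerA !P// scalerDr.
Qed.

(** Projecting to R^J and R^J' separates the two summands; the parameter r of the sum divides the
    scale t into t (1 - r) for [A] and t r for [B]. *)
Let scales_split t : scales W (a + b)%R t -> exists2 c, (0 <= c <= t)%R &
  (forall t1, (t - c < t1)%R -> scales A a t1) /\ (forall t2, (c < t2)%R -> scales B b t2).
Proof.
move=> [t0 [x [y [r [Ax By /andP[r0 r1] E]]]]].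
have Ea : (t `^ (- s) *: a = (1 - r) `^ s *: x)%R.
  have := congr1 (coord_proj J) E.
  rewrite coord_projZ !coord_projD !coord_projZ aJ (AJ Ax) -bJ' -(BJ' By).
  by rewrite !coord_proj_disjoint// scaler0 !addr0.
have Eb : (t `^ (- s) *: b = r `^ s *: y)%R.
  have := congr1 (coord_proj J') E.
  rewrite coord_projZ !coord_projD !coord_projZ bJ' (BJ' By) -aJ -(AJ Ax).
  by rewrite !coord_proj_disjoint// scaler0 !add0r.
have tsn : (t `^ s != 0)%R by rewrite gt_eqF// powR_gt0.
have F (c : R) (u x' : 'rV[R]_n) : (0 <= c)%R -> (t `^ (- s) *: u = c `^ s *: x')%R -> u = ((t * c) `^ s *: x')%R.
  move=> c0 H; rewrite powRM ?(ltW t0)// -scalerA -H scalerA powRN.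
  by rewrite divff// scale1r.
have r1' : (0 <= 1 - r)%R by rewrite subr_ge0.
have c1 : (0 <= t * (1 - r))%R by rewrite mulr_ge0// ltW.
have c2 : (0 <= t * r)%R by rewrite mulr_ge0// ltW.
exists (t * r)%R; first by rewrite c2 ler_piMr// ltW.
split=> [t1 tt1|t2 tt2].
  by apply: (@scales_of A a _ x t1 sA c1 Ax (F _ _ _ r1' Ea)); rewrite mulrBr mulr1.
exact: (@scales_of B b _ y t2 sB c2 By (F _ _ _ r0 Eb)).
Qed.

(** By [scales_add] and [scales_split] the infimum of the scales of [a + b] is the sum of the
    infima; without scales both sides are 0. *)
Lemma gauge_exp_power_sum : gauge_exp W (a + b)%R = gauge_exp A a * gauge_exp B b.
Proof.
have lbS K u : has_lbound (scales K u) by exists 0%R => t [/ltW].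
have [WE|W0] := eqVneq (scales W (a + b)%R) set0.
  rewrite /gauge_exp WE integral_set0.
  have [->|/set0P[t1 At1]] := eqVneq (scales A a) set0; first by rewrite integral_set0 mul0e.
  have [->|/set0P[t2 Bt2]] := eqVneq (scales B b) set0; first by rewrite integral_set0 mule0.
  by have := scales_add At1 Bt2; rewrite WE.
move/set0P : W0 => W0; have [t Wt] := W0; have [c cP [cA' cB']] := scales_split Wt.
have A0 : scales A a !=set0 by exists (t - c + 1)%R; apply: cA'; rewrite ltrDl.
have B0 : scales B b !=set0 by exists (c + 1)%R; apply: cB'; rewrite ltrDl.
rewrite !gauge_exp_inf// -EFinM -expRD; congr (expR _)%:E.
rewrite -opprD; congr (- _)%R; apply/le_anti/andP; split.
  have H1 t1 : scales A a t1 -> (inf (scales W (a + b)%R) - t1 <= inf (scales B b))%R.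
    move=> At1; apply: lb_le_inf => // t2 Bt2.
    by rewrite lerBlDl; apply: ge_inf => //; exact: scales_add.
  rewrite -lerBlDr; apply: lb_le_inf => // t1 At1.
  by rewrite lerBlDr -lerBlDl; exact: H1.
apply: lb_le_inf => // t' Wt'; have [c' _ [cA'' cB'']] := scales_split Wt'.
have iA : (inf (scales A a) <= t' - c')%R.
  by apply/ler_addgt0Pr => e e0; apply: ge_inf => //; apply: cA''; rewrite ltrDl.
have iB : (inf (scales B b) <= c')%R.
  by apply/ler_addgt0Pr => e e0; apply: ge_inf => //; apply: cB''; rewrite ltrDl.
by have := lerD iA iB; rewrite subrK.
Qed.

End orthogonal_sum.

(** Integrate the product formula for [gauge_exp] over R^J and R^J': each of the three integrals
    brings its own Gamma factor. *)
Lemma mu_power_sum J J' A B : [disjoint J & J']%B -> starlike A -> starlike B ->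
  compact A -> compact B -> (forall x, A x -> coord_proj J x = x) ->
  (forall x, B x -> coord_proj J' x = x) ->
  mu (J :|: J') (power_sum s A B) * Gam (#|J :|: J'|%:R * s)%R =
  (mu J A * Gam (#|J|%:R * s)%R) * (mu J' B * Gam (#|J'|%:R * s)%R).
Proof.
move=> JJ' sA sB cA cB AJ BJ'.
have mA : measurable A by exact: compact_measurable_rv.
have mB : measurable B by exact: compact_measurable_rv.
have mW : measurable (power_sum s A B).
  by apply: compact_measurable_rv; exact: compact_power_sum.
have cyl G K : measurable K -> measurable [set x | K (coord_proj G x)].
  move=> mK; rewrite -[X in measurable X]setTI.
  exact: (measurable_coord_proj G).
have gauge_proj G K u : gauge_exp K (coord_proj G u) = gauge_exp [set x | K (coord_proj G x)] u.
  rewrite /gauge_exp; congr (\int[_]_(t in _) _); apply/seteqP; split => t [t0 H];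
  by split => //; move: H; rewrite /= coord_projZ.
rewrite -integral_gauge_exp// integral_join//; last 2 first.
- exact: measurable_gauge_exp.
- exact: gauge_exp_ge0.
have mA' := cyl J A mA; have mB' := cyl J' B mB.
have m1 := measurable_gauge_exp mA'; have m2 := measurable_gauge_exp mB'.
pose A' := [set x | A (coord_proj J x)]; pose B' := [set x | B (coord_proj J' x)].
transitivity (\int[mu J]_u (gauge_exp A' u * \int[mu J']_v gauge_exp B' v)).
  apply: eq_integral => u _.
  rewrite -ge0_integralZl//; last 2 first.
  - by move=> v _; exact: gauge_exp_ge0.
  - exact: gauge_exp_ge0.
  apply: eq_integral => v _; rewrite -!gauge_proj.
  by apply: (gauge_exp_power_sum JJ') => //; exact: coord_projK.
rewrite ge0_integralZr//; last 2 first.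
- by move=> v _; exact: gauge_exp_ge0.
- by apply: integral_ge0 => v _; exact: gauge_exp_ge0.
by rewrite !integral_gauge_exp ?mu_coord_proj//; exact: cyl.
Qed.

End power_sum_volume.

(** * Berwald-type inequality *)

Section sections.
Variables (R : realType) (n : nat).
Implicit Types (J P Q : {set 'I_n}) (A : set 'rV[R]_n).
Local Open Scope ereal_scope.

Definition sect J P A (x : 'rV[R]_n) : set 'rV[R]_n := [set y | A (join J P (x, y))].

Definition sect_vol J P A (x : 'rV[R]_n) : \bar R := mu P (sect J P A x).

Let sectE J P A x : sect J P A x = xsection (join J P @^-1` A) x.
Proof. by apply/seteqP; split => y; rewrite /xsection/= inE. Qed.

Let measurable_join_pre J P A : measurable A -> measurable (join J P @^-1` A).
Proof. by move=> mA; rewrite -[_ @^-1` _]setTI; exact: measurable_join. Qed.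

Lemma measurable_sect J P A x : measurable A -> measurable (sect J P A x).
Proof. by move=> mA; rewrite sectE; apply: measurable_xsection; exact: measurable_join_pre. Qed.

Lemma measurable_sect_vol J P A : measurable A -> measurable_fun setT (sect_vol J P A).
Proof.
move=> mA; rewrite (_ : sect_vol J P A = mu P \o xsection (join J P @^-1` A)).
  by apply: measurable_fun_xsection; exact: measurable_join_pre.
by apply/funext => x; rewrite /sect_vol sectE.
Qed.

Lemma sect_vol_ge0 J P A x : 0 <= sect_vol J P A x.
Proof. exact: measure_ge0. Qed.

Lemma integral_sect_vol J P A : [disjoint J & P]%B -> measurable A ->
  \int[mu J]_x sect_vol J P A x = mu (J :|: P) A.
Proof.
move=> JP mA; rewrite mu_join// /product_measure1; apply: eq_integral => x _ /=.
by rewrite /sect_vol sectE.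
Qed.

Lemma joinE J P (x y : 'rV[R]_n) k :
  join J P (x, y) 0%R k = ((if k \in J then x 0 k else 0) + (if k \in P then y 0 k else 0))%R.
Proof. by rewrite !mxE. Qed.

Lemma sect_vol_fin J P A i x : [disjoint J & P]%B -> measurable A -> A `<=` @cube R n i ->
  sect_vol J P A x <= mu P (@cube R n i).
Proof.
move=> JP mA Ai; rewrite -[leRHS]mu_coord_proj /sect_vol.
apply: le_measure; rewrite ?inE.
- exact: measurable_sect.
- by rewrite -[X in measurable X]setTI; apply: (measurable_coord_proj P) => //; exact: measurable_cube.
move=> y /Ai yi k /=; have := yi k; rewrite joinE !mxE/=.
case: ifPn => [kJ|_].
  by move=> _; rewrite (disjointFr JP kJ)/= in_itv/= oppr_le0 ler0n.
by rewrite add0r.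
Qed.

Lemma mu_fin J A i : measurable A -> A `<=` @cube R n i -> mu J A \is a fin_num.
Proof.
move=> mA Ai; rewrite ge0_fin_numE//; apply: (@le_lt_trans _ _ (mu J (@cube R n i))); last exact: mu_cube_fin.
by apply: le_measure; rewrite ?inE//; exact: measurable_cube.
Qed.

Section triple.
Variables (J P Q : {set 'I_n}) (A : set 'rV[R]_n).
Hypotheses (JP : [disjoint J & P]%B) (JQ : [disjoint J & Q]%B) (PQ : [disjoint P & Q]%B).
Hypothesis mA : measurable A.

Let JPQ : [disjoint J & P :|: Q]%B.
Proof.
apply/pred0P => k /=; rewrite !inE; case: (boolP (k \in J)) => //= kJ.
by rewrite (disjointFr JP kJ) (disjointFr JQ kJ).
Qed.

Let join3 (x y z : 'rV[R]_n) : join J (P :|: Q) (x, join P Q (y, z)) =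
  (\row_k (if k \in J then x 0 k else if k \in P then y 0 k else
          if k \in Q then z 0 k else 0))%R.
Proof.
apply/rowP => k; rewrite [RHS]mxE joinE joinE !inE.
have [kJ|kJ] := boolP (k \in J).
  by rewrite (disjointFr JP kJ) (disjointFr JQ kJ)/= addr0.
have [kP|kP] := boolP (k \in P); first by rewrite (disjointFr PQ kP)/= add0r addr0.
by case: (k \in Q); rewrite /= ?add0r ?addr0.
Qed.

Let sect_vol_triple x : sect_vol J (P :|: Q) A x =
  (mu P \x mu Q) [set p | A (join J (P :|: Q) (x, join P Q p))].
Proof. by rewrite /sect_vol mu_join//; exact: measurable_sect. Qed.

Let measurable_triple x : measurable [set p | A (join J (P :|: Q) (x, join P Q p))].
Proof.
rewrite (_ : [set p | _] = join P Q @^-1` sect J (P :|: Q) A x)//.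
rewrite -[_ @^-1` _]setTI; apply: measurable_join => //; exact: measurable_sect.
Qed.

Let triple_sub x : downset A ->
  [set p | A (join J (P :|: Q) (x, join P Q p))] `<=` sect J P A x `*` sect J Q A x.
Proof.
move=> dA [y z] /= H; have H0 := dA.1 _ H; split; apply: (dA.2 _ _ H) => k;
  have := H0 k; rewrite join3 mxE joinE.
- have [kJ|kJ] := boolP (k \in J).
    by rewrite (disjointFr JP kJ)/= addr0 lexx andbT.
  have [kP|kP] := boolP (k \in P); rewrite add0r ?lexx ?andbT//.
- have [kJ|kJ] := boolP (k \in J).
    by rewrite (disjointFr JQ kJ)/= addr0 lexx andbT.
  have [kP|kP] := boolP (k \in P); first by rewrite (disjointFr PQ kP) addr0 lexx.
  have [kQ|kQ] := boolP (k \in Q); rewrite add0r ?lexx ?andbT//.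
Qed.

(** In a down-set, replacing the coordinates in [Q] or in [P] by 0 stays inside, so the section
    along [P :|: Q] lies in the product of the sections along [P] and along [Q]. *)
Lemma mu_triple_le : downset A ->
  mu (J :|: (P :|: Q)) A <= \int[mu J]_x (sect_vol J P A x * sect_vol J Q A x).
Proof.
move=> dA; rewrite -integral_sect_vol//; apply: ge0_le_integral => //.
- exact: measurable_sect_vol.
- by apply: emeasurable_funM; exact: measurable_sect_vol.
move=> x _; rewrite sect_vol_triple {1 2}/sect_vol -product_measure1E; [|exact: measurable_sect..].
apply: le_measure; rewrite ?inE//.
  by apply: measurableX; exact: measurable_sect.
exact: triple_sub.
Qed.

(** The case of equality, in which the sections over [x] are products; the model cone is of this
    kind. *)
Lemma mu_tripleE : downset A ->
  (forall x y z, A (join J P (x, y)) -> A (join J Q (x, z)) ->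
     A (join J (P :|: Q) (x, join P Q (y, z)))) ->
  mu (J :|: (P :|: Q)) A = \int[mu J]_x (sect_vol J P A x * sect_vol J Q A x).
Proof.
move=> dA HA; rewrite -integral_sect_vol//; apply: eq_integral => x _.
rewrite sect_vol_triple {1 2}/sect_vol -product_measure1E; [|exact: measurable_sect..].
congr (_ _); apply/seteqP; split; first exact: triple_sub.
by move=> [y z] [/= Ay Az]; exact: HA.
Qed.

End triple.

End sections.

Section layer_cake_product.
Context d (T : measurableType d) (R : realType).
Local Open Scope ereal_scope.

(** Layer cake for [f] first, then for [g] restricted to each level set of [f]. *)
Lemma layer_cakeM (m : {sigma_finite_measure set T -> \bar R}) (f g : T -> \bar R) :
  measurable_fun setT f -> measurable_fun setT g ->
  (forall x, 0 <= f x) -> (forall x, 0 <= g x) ->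
  \int[m]_x (f x * g x) =
  \int[lebesgue_measure]_(u in `]0%R, +oo[) \int[lebesgue_measure]_(t in `]0%R, +oo[)
    m [set x | u%:E <= f x /\ t%:E <= g x].
Proof.
move=> mf mg f0 g0.
pose D : set (T * R) := [set p | (0 < p.2)%R /\ p.2%:E <= f p.1].
have mD : measurable D.
  rewrite (_ : D = (@snd T R @^-1` `]0%R, +oo[) `&` [set p | (p.2%:E <= f p.1)]).
    apply: measurableI.
      by rewrite -[_ @^-1` _]setTI; exact: measurable_snd.
    rewrite -[X in measurable X]setTI; apply: measurable_lee => //.
      by apply/measurable_EFinP; exact: measurable_snd.
    by apply: (measurableT_comp mf); exact: measurable_fst.
  by apply/seteqP; split => p; rewrite /D/= in_itv/= andbT.
have mg1 : measurable_fun setT (fun p : T * R => g p.1).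
  by apply: (measurableT_comp mg); exact: measurable_fst.
transitivity (\int[m]_x \int[lebesgue_measure]_(u in xsection D x) g x).
  apply: eq_integral => x _.
  under eq_integral do rewrite -[g x]mule1.
  have mDx : measurable (xsection D x) by exact: measurable_xsection.
  rewrite ge0_integralZl// integral_cst// mul1e muleC; congr (_ * _).
  rewrite -[LHS]lebesgue_measure_Ioc_ereal//.
  by congr lebesgue_measure; apply/seteqP; split => u; rewrite /xsection/= inE.
rewrite (tonelli_on m lebesgue_measure mD mg1 (fun p => g0 p.1)).
rewrite [RHS]integral_mkcond; apply: eq_integral => u _.
rewrite patchE mem_setE in_itv/= andbT; case: ltP => u0; last first.
  have -> : ysection D u = set0.
    by apply/seteqP; split => // x; rewrite /ysection/= inE /D/= => -[]; rewrite ltNge u0.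
  by rewrite integral_set0.
have DE : ysection D u = [set x | u%:E <= f x].
  by apply/seteqP; split => x; rewrite /ysection/= inE /D/=; [case|].
have mDu : measurable (ysection D u) by exact: measurable_ysection.
rewrite integral_mkcond layer_cake.
- apply: eq_integral => t; rewrite inE/= in_itv/= andbT => t0.
  congr (m _); apply/seteqP; split => x /=; rewrite patchE.
    case: ifPn => [|_]; first by rewrite DE inE/= => ? ?; split.
    by rewrite leNgt lte_fin t0.
  by move=> [uf tg]; rewrite ifT// DE inE.
- by apply/measurable_restrict => //; exact: measurable_funTS.
- by move=> x; apply: erestrict_ge0 => y _; exact: g0.
Qed.

End layer_cake_product.

(** * Truncated integrals of single-crossing functions *)

Section min_comparison.
Variable R : realType.
Local Open Scope ereal_scope.

Lemma lee_addr_cancel (a r a' r' : \bar R) : 0 <= a -> 0 <= r -> 0 <= a' -> 0 <= r' ->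
  a + r = a' + r' -> a + r \is a fin_num -> r' <= r -> a <= a'.
Proof.
case: a => [a||//]; case: r => [r||//]; case: a' => [a'||//]; case: r' => [r'||//] //=.
move=> _ _ _ _; rewrite -!EFinD => -[E] _; rewrite !lee_fin; lra.
Qed.

Variables phi psi : R -> R.
Hypotheses (mphi : measurable_fun setT phi) (mpsi : measurable_fun setT psi).
Hypotheses (phi0 : forall u, (0 <= phi u)%R) (psi0 : forall u, (0 <= psi u)%R).
Hypothesis psi_noninc : forall u v : R, (0 < u)%R -> (u <= v)%R -> (psi v <= psi u)%R.
Hypothesis crossing : forall u v : R, (0 < u)%R -> (u < v)%R -> (phi u < psi u)%R ->
  (phi v <= psi v)%R.
Hypothesis phi_psi : \int[lebesgue_measure]_(u in `]0%R, +oo[) (phi u)%:E =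
  \int[lebesgue_measure]_(u in `]0%R, +oo[) (psi u)%:E.
Hypothesis phi_fin : \int[lebesgue_measure]_(u in `]0%R, +oo[) (phi u)%:E \is a fin_num.

(* [phi] crosses [psi] at most once, from above to below: truncation at any height
   removes more mass from [phi]. *)
Lemma min_integral_le (c : R) : (0 <= c)%R ->
  \int[lebesgue_measure]_(u in `]0%R, +oo[) (Num.min (phi u) c)%:E <=
  \int[lebesgue_measure]_(u in `]0%R, +oo[) (Num.min (psi u) c)%:E.
Proof.
move=> c0.
have mmin (h : R -> R) : measurable_fun setT h ->
    measurable_fun (`]0%R, +oo[%classic : set R) (fun u => (Num.min (h u) c)%:E).
  move=> mh; apply/measurable_EFinP/measurable_funTS.
  by apply: measurable_minr => //; exact: measurable_cst.
have min0 (h : R -> R) u : (forall u, (0 <= h u)%R) -> 0 <= (Num.min (h u) c)%:E.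
  by move=> h0; rewrite lee_fin le_min h0.
(* In the first case [psi] is above [c] up to [v] and at least [phi] beyond it, so the truncations
   compare pointwise. Otherwise [psi] exceeds [phi] only where it is at most [c], so the excess over
   [c] is pointwise larger for [phi], and equality of the integrals concludes. *)
have [[v [v0 pv vc]]|H] := pselect (exists v, [/\ (0 < v)%R, (phi v < psi v)%R & (c < psi v)%R]).
  apply: ge0_le_integral => //.
  - by move=> u _; exact: min0.
  - exact: mmin.
  - exact: mmin.
  move=> u; rewrite /= in_itv/= andbT => u0; rewrite lee_fin.
  have [uv|vu] := leP u v.
    rewrite [leRHS]min_r; last by rewrite ltW// (lt_le_trans vc)// psi_noninc.
    by rewrite ge_min lexx orbT.
  by rewrite le_min !ge_min lexx orbT (crossing v0 vu pv).
pose rest (h : R -> R) u := (Num.max (h u - c) 0)%R.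
have mrest (h : R -> R) : measurable_fun setT h ->
    measurable_fun (`]0%R, +oo[%classic : set R) (fun u => (rest h u)%:E).
  move=> mh; apply/measurable_EFinP/measurable_funTS.
  apply: measurable_maxr; last exact: measurable_cst.
  by apply: measurable_funB => //; exact: measurable_cst.
have rest0 (h : R -> R) u : 0 <= (rest h u)%:E by rewrite lee_fin /rest le_max lexx orbT.
have split_min (h : R -> R) : measurable_fun setT h -> (forall u, (0 <= h u)%R) ->
    \int[lebesgue_measure]_(u in `]0%R, +oo[) (h u)%:E =
    \int[lebesgue_measure]_(u in `]0%R, +oo[) (Num.min (h u) c)%:E +
    \int[lebesgue_measure]_(u in `]0%R, +oo[) (rest h u)%:E.
  move=> mh h0; rewrite -ge0_integralD//; first last.
  - exact: mrest.
  - exact: mmin.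
  - by move=> u _; exact: min0.
  apply: eq_integral => u _; rewrite -EFinD; congr _%:E.
  rewrite /rest; case: (leP (h u) c) => hc; last by rewrite max_l ?subr_ge0 ?ltW// subrKC.
  by rewrite max_r ?subr_le0// addr0.
have := phi_psi; rewrite (split_min phi)// (split_min psi)// => E.
have rest_le : \int[lebesgue_measure]_(u in `]0%R, +oo[) (rest psi u)%:E <=
    \int[lebesgue_measure]_(u in `]0%R, +oo[) (rest phi u)%:E.
  apply: ge0_le_integral => //; [exact: mrest|exact: mrest|].
  move=> u; rewrite /= in_itv/= andbT => u0; rewrite lee_fin /rest.
  have [pu|pu] := leP (psi u) (phi u).
    by rewrite ge_max !le_max lexx orbT lerD2r pu.
  rewrite [leLHS]max_r ?le_max ?lexx ?orbT//.
  by rewrite subr_le0 leNgt; apply/negP => cu; apply: H; exists u.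
have sum_fin := phi_fin; rewrite (split_min phi)// in sum_fin.
apply: lee_addr_cancel E sum_fin rest_le.
- by apply: integral_ge0 => u _; exact: min0.
- by apply: integral_ge0.
- by apply: integral_ge0 => u _; exact: min0.
- by apply: integral_ge0.
Qed.

End min_comparison.

Section level_sets.
Variables (R : realType) (n i : nat) (J P : {set 'I_n}) (A : set 'rV[R]_n).
Hypothesis JP : [disjoint J & P]%B.
Hypotheses (mA : measurable A) (dA : downset A) (Ai : A `<=` @cube R n i).
Hypothesis cvA : forall x y (t : R), A x -> A y -> 0 <= t <= 1 ->
  A ((1 - t) *: x + t *: y).
Hypotheses (J0 : (0 < #|J|)%N) (P0 : (0 < #|P|)%N).
Hypothesis A0 : A !=set0.

(** At positive heights a level set lies over the section of [A] by R^J; at height 0 it is the whole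
    space, hence the conditions [0 < u] below. *)
Definition level (u : R) : set 'rV[R]_n := [set x | (u%:E <= sect_vol J P A x)%E].

Definition level_vol (u : R) : R := fine (mu J (level u)).

Lemma measurable_level u : measurable (level u).
Proof.
rewrite -[level u]setTI; apply: emeasurable_fun_c_infty => //.
exact: measurable_sect_vol.
Qed.

Lemma sect_nonempty u x : 0 < u -> level u x -> sect J P A x !=set0.
Proof.
move=> u0 ux; apply/set0P; apply: contraTneq ux => sx0.
by rewrite /level/= /sect_vol sx0 measure0 lee_fin -ltNge.
Qed.

Lemma level_cube u x : 0 < u -> level u x -> A (coord_proj J x).
Proof.
move=> u0 /(sect_nonempty u0)[y Ay]; apply: (dA.2 _ _ Ay) => k.
have := dA.1 _ Ay k; rewrite joinE mxE.
have [kJ|kJ] := boolP (k \in J); first by rewrite (disjointFr JP kJ)/= addr0 lexx andbT.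
by rewrite lexx.
Qed.

Lemma level_vol_ge0 u : 0 <= level_vol u.
Proof. exact: fine_ge0. Qed.

Lemma level_fin_num u : 0 < u -> mu J (level u) \is a fin_num.
Proof.
move=> u0; rewrite ge0_fin_numE//.
apply: (@le_lt_trans _ _ (mu J [set x | A (coord_proj J x)])).
  apply: le_measure; rewrite ?inE.
  - exact: measurable_level.
  - by rewrite -[X in measurable X]setTI; exact: (measurable_coord_proj J).
  - by move=> x; exact: level_cube.
by rewrite mu_coord_proj ltey_eq (mu_fin J mA Ai).
Qed.

Lemma measurable_level_vol : measurable_fun setT level_vol.
Proof.
rewrite (_ : level_vol = fine \o (fun u => mu J (level u)))//.
apply: measurableT_comp => //.
by apply: measurable_layer; exact: measurable_sect_vol.
Qed.

Lemma integral_level_vol :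
  (\int[lebesgue_measure]_(u in `]0%R, +oo[) (level_vol u)%:E = mu (J :|: P) A)%E.
Proof.
rewrite -integral_sect_vol// layer_cake; last by move=> x; exact: sect_vol_ge0.
  2: exact: measurable_sect_vol.
apply: eq_integral => u; rewrite inE/= in_itv/= andbT => u0.
by rewrite /level_vol fineK// level_fin_num.
Qed.

(** Contracting the section over [x] by the ratio 1 - t towards the point [y] of the base stays in
    [A] by convexity and multiplies the volume by (1 - t)^#|P|. *)
Lemma sect_vol_convex (u t : R) x y : 0 <= t < 1 -> A (coord_proj J y) ->
  level u x -> level ((1 - t) ^+ #|P| * u) ((1 - t) *: x + t *: y).
Proof.
move=> /andP[t0 t1] Ay ux; have t1' : 0 < 1 - t by rewrite subr_gt0.
rewrite /level/= EFinM.
apply: (@le_trans _ _ (((1 - t) ^+ #|P|)%:E * sect_vol J P A x)%E).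
  by apply: lee_wpmul2l => //; rewrite lee_fin exprn_ge0// ltW.
have msx : measurable (sect J P A x) by exact: measurable_sect.
rewrite /sect_vol -mu_scale//; apply: le_measure; rewrite ?inE.
- rewrite -[X in measurable X]setTI; apply: measurable_rv => // k.
  under eq_fun do rewrite mxE.
  by apply: measurable_funM => //; exact: measurable_coord.
- exact: measurable_sect.
move=> z /= Az; have := cvA Az Ay (t := t); rewrite t0 (ltW t1) => /(_ isT).
rewrite /sect/=; congr A; rewrite /join/= coord_projD !coord_projZ scalerDr scalerA.
by rewrite divff ?gt_eqF// scale1r addrAC.
Qed.

Let downset_level u : 0 < u -> downset (@emb R n J @^-1` level u).
Proof.
move=> u0; split=> [v /(level_cube u0) /dA.1 H l|v w vu vw].
  by have := H (enum_val l); rewrite mxE enum_valP emb_val.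
apply: (le_trans vu); apply: le_measure; rewrite ?inE; try exact: measurable_sect.
move=> y Ay; apply: (dA.2 _ _ Ay) => k; have := dA.1 _ Ay k; rewrite !joinE.
have [kJ|kJ] := boolP (k \in J); last by rewrite lexx => ->.
rewrite (disjointFr JP kJ)/= !addr0 !emb_in => _; exact: vw.
Qed.

Let downset_base : downset (@emb R n J @^-1` A).
Proof.
split=> [v /dA.1 H l|v w Av vw].
  by have := H (enum_val l); rewrite emb_val.
apply: (dA.2 _ _ Av) => k; have [kJ|kJ] := boolP (k \in J).
  by rewrite !emb_in.
by rewrite !emb_notin// lexx.
Qed.

Let measurable_emb_pre (D : set 'rV[R]_n) : measurable D -> measurable (@emb R n J @^-1` D).
Proof. by move=> mD; rewrite -[_ @^-1` _]setTI; exact: measurable_emb. Qed.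

Let base_vol := fine (mu J A).

Let emb_proj v : coord_proj J (@emb R n J v) = emb v.
Proof.
by apply/rowP => k; rewrite mxE; case: ifPn => // kJ; rewrite emb_notin.
Qed.

Let emb_lin (c e : R) (v w : 'rV[R]_#|J|) : emb (c *: v + e *: w) = c *: emb v + e *: emb w.
Proof.
apply/rowP => k; rewrite rv_lin; have [kJ|kJ] := boolP (k \in J).
  by rewrite !emb_in rv_lin.
by rewrite !emb_notin// !mulr0 addr0.
Qed.

(** By [sect_vol_convex] the lower level set contains the combination of [level u] with the base of
    [A]; Brunn-Minkowski is applied to these two in R^#|J|. *)
Lemma level_brunn_minkowski (u t al nu : R) : 0 < u -> 0 <= t < 1 -> 0 <= al -> 0 <= nu ->
  level u !=set0 -> al ^+ #|J| <= level_vol u -> nu ^+ #|J| <= base_vol ->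
  ((1 - t) * al + t * nu) ^+ #|J| <= level_vol ((1 - t) ^+ #|P| * u).
Proof.
move=> u0 t01 al0 nu0 [x ux] alu nub; have /andP[t0 t1] := t01.
have ut0 : 0 < (1 - t) ^+ #|P| * u by rewrite mulr_gt0// exprn_gt0// subr_gt0.
rewrite -lee_fin /level_vol fineK ?level_fin_num//.
have cubeJ D : (forall v, D v -> A (coord_proj J (@emb R n J v))) -> D `<=` @cube R #|J| i.
  move=> DA v /DA; rewrite emb_proj => /Ai H l.
  by have := H (enum_val l); rewrite emb_val.
apply: (@brunn_minkowski R #|J| i (@emb R n J @^-1` level u) (@emb R n J @^-1` A)
  (@emb R n J @^-1` level ((1 - t) ^+ #|P| * u)) t al nu) => //.
- by apply: measurable_emb_pre; exact: measurable_level.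
- exact: measurable_emb_pre.
- by apply: measurable_emb_pre; exact: measurable_level.
- exact: downset_level.
- by apply: cubeJ => v; exact: level_cube.
- by apply: cubeJ => v; rewrite emb_proj.
- exists (\row_l x 0 (enum_val l)); apply: (le_trans ux).
  rewrite /sect_vol /sect; apply: le_measure; rewrite ?inE; try exact: measurable_sect.
  move=> y; congr A; rewrite /join/=; congr (_ + _); rewrite emb_proj.
  apply/rowP => k; have [kJ|kJ] := boolP (k \in J).
    by rewrite emb_in !mxE kJ enum_rankK_in.
  by rewrite emb_notin// mxE (negbTE kJ).
- have [y Ay] := A0; exists 0; apply: (dA.2 _ _ Ay) => k.
  have [kJ|kJ] := boolP (k \in J); last by rewrite emb_notin// lexx (dA.1 _ Ay).
  by rewrite emb_in mxE lexx (dA.1 _ Ay).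
- by rewrite t0 ltW.
- move=> v w /= vu Aw; rewrite emb_lin; apply: sect_vol_convex => //.
  by rewrite emb_proj.
- by rewrite -[leRHS]fineK ?lee_fin//; exact: level_fin_num.
- by rewrite -[leRHS]fineK ?lee_fin//; exact: (mu_fin J mA Ai).
Qed.

(** Measure of the level set at height [u] of [c] times the section volume of the model cone, a cube
    of side 1 - (u / c)^(1 / #|P|); see [mu_level_model_cone]. *)
Definition cone_profile (c u : R) : R :=
  Num.max (1 - (u / c) `^ (#|P|%:R^-1)) 0 ^+ #|J|.

(** By contradiction: a level set above the profile at [v], interpolated with the base, forces the
    one at the lower height [u] to be at least the profile there, since the root of the profile is
    affine along the interpolation. *)
Lemma level_vol_crossing (c u v : R) : 0 < c -> 0 < u -> u < v ->
  level_vol u < base_vol * cone_profile c u -> level_vol v <= base_vol * cone_profile c v.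
Proof.
move=> c0 u0 uv uc; rewrite leNgt; apply/negP => vc.
have v0 := lt_trans u0 uv.
have bv0 : 0 <= base_vol by exact: fine_ge0.
pose g (w : R) := 1 - (w / c) `^ (#|P|%:R^-1).
have profE w : cone_profile c w = Num.max (g w) 0 ^+ #|J| by [].
have max0 w : 0 <= Num.max (g w) 0 by rewrite le_max lexx orbT.
have [nu nu0 nuE] := exists_root J0 bv0.
have [al al0 alE] := exists_root J0 (level_vol_ge0 v).
have lv : level v !=set0.
  apply/set0P; apply: contraTneq vc => lv0.
  by rewrite /level_vol lv0 measure0/= -leNgt mulr_ge0// profE exprn_ge0.
(* The contraction ratio that lowers the height from [v] to [u], as u = r^#|P| v. *)
pose r := (u / v) `^ (#|P|%:R^-1).
have r0 : 0 < r by rewrite powR_gt0// divr_gt0.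
have r1 : r < 1.
  rewrite -[ltRHS](_ : 1 `^ (#|P|%:R^-1) = 1); last by rewrite powR1.
  by rewrite gt0_ltr_powR ?nnegrE ?divr_ge0 ?(ltW u0) ?(ltW v0)// ?invr_gt0 ?ltr0n// ltr_pdivrMr// mul1r.
have rE : r ^+ #|P| * v = u.
  rewrite -powR_mulrn ?(ltW r0)// -powRrM mulVf ?pnatr_eq0 -?lt0n// powRr1; last first.
    by rewrite divr_ge0// ltW.
  by rewrite divfK// gt_eqF.
have t01 : 0 <= 1 - r < 1 by rewrite subr_ge0 (ltW r1)/= ltrBlDr ltrDl.
have := level_brunn_minkowski v0 t01 al0 nu0 lv; rewrite alE nuE lexx => /(_ isT (lexx _)).
rewrite subKr rE => H.
move: uc; rewrite ltNge => /negP; apply; apply: (le_trans _ H).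
have nual : nu * Num.max (g v) 0 <= al.
  rewrite -(ler_pXn2r J0) ?nnegrE ?mulr_ge0// exprMn nuE alE -profE.
  exact: ltW.
rewrite -nuE profE -exprMn; apply: lerXn2r; rewrite ?nnegrE.
- by rewrite mulr_ge0.
- by rewrite addr_ge0 ?mulr_ge0// ?(ltW r0)// subr_ge0 ltW.
have -> : g u = r * g v + (1 - r).
  rewrite /g mulrBr mulr1 /r -powRM ?divr_ge0 ?(ltW u0) ?(ltW v0) ?(ltW c0)//.
  rewrite (_ : u / v * (v / c) = u / c); last by field; rewrite !gt_eqF.
  by ring.
rewrite maxr_pMr// mulr0 ge_max; apply/andP; split; last first.
  by rewrite addr_ge0// mulr_ge0// ?(ltW r0)// subr_ge0 ltW.
rewrite mulrDr [nu * (1 - r)]mulrC lerD2r mulrCA ler_wpM2l// ?(ltW r0)//.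
by apply: le_trans nual; rewrite ler_wpM2l// le_max lexx.
Qed.

End level_sets.

(** * The extremal body *)

Section model_cone.
Variables (R : realType) (n : nat).
Implicit Types (J P Q : {set 'I_n}).

Definition unit_cube J : set 'rV[R]_n :=
  [set x | forall k, if k \in J then 0 <= x 0 k <= 1 else x 0 k == 0].

(* The extremal body: [{(x, y) : 0 <= x, y <= 1 and |x|_oo + |y|_oo <= 1}], with
   [x] the coordinates in [J] and [y] the others. *)
Definition model_cone J : set 'rV[R]_n :=
  [set x | (forall k, 0 <= x 0 k <= 1) /\
    forall j l, j \in J -> l \notin J -> x 0 j + x 0 l <= 1].

Let unit_cube_box J : unit_cube J =
  mbox (fun k => if k \in J then `[0, 1]%classic else [set 0]).
Proof.
by apply/seteqP; split => x Jx k; have := Jx k => /=; case: ifP => _ /=;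
  rewrite ?in_itv//= => /eqP.
Qed.

Lemma compact_unit_cube J : compact (unit_cube J).
Proof.
rewrite unit_cube_box.
have := @rV_compact R n (fun k => if k \in J then `[0, 1]%classic else [set 0]).
by apply => k; case: ifP => _; [exact: segment_compact|exact: compact_set1].
Qed.

Lemma mu_unit_cube J : mu J (unit_cube J) = 1%E.
Proof.
rewrite unit_cube_box mu_mbox; last by move=> k; case: ifP.
rewrite big1// => k _; rewrite /fac /=; case: ifP => kJ.
  by rewrite kJ lebesgue_measure_itv/= lte_fin ltr01 oppr0 adde0.
by rewrite kJ diracE mem_set.
Qed.

Lemma starlike_unit_cube J : starlike (unit_cube J).
Proof.
split=> [k|x r Jx /andP[r0 r1] k]; first by rewrite mxE lexx ler01; case: ifP.
have := Jx k; rewrite mxE; case: ifP => _ => [/andP[x0 x1]|/eqP ->]; last by rewrite mulr0.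
by rewrite mulr_ge0//= mulr_ile1.
Qed.

Lemma unit_cube_proj J x : unit_cube J x -> coord_proj J x = x.
Proof.
by move=> Jx; apply/rowP => k; rewrite mxE; have := Jx k; case: ifP => // _ /eqP.
Qed.

Lemma downset_model_cone J : downset (model_cone J).
Proof.
split=> [x [x01 _] k|x y [x01 xJ] yx]; first by case/andP: (x01 k).
split=> [k|j l jJ lJ].
  have /andP[y0 yk] := yx k; have /andP[_ xk] := x01 k.
  by rewrite y0 (le_trans yk).
have /andP[_ yj] := yx j; have /andP[_ yl] := yx l.
exact: le_trans (lerD yj yl) (xJ _ _ jJ lJ).
Qed.

Lemma convex_model_cone J x y (t : R) : model_cone J x -> model_cone J y ->
  0 <= t <= 1 -> model_cone J ((1 - t) *: x + t *: y).
Proof.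
move=> [x01 xJ] [y01 yJ] /andP[t0 t1]; have t1' : 0 <= 1 - t by rewrite subr_ge0.
split=> [k|j l jJ lJ]; rewrite !rv_lin.
  have /andP[x0 x1] := x01 k; have /andP[y0 y1] := y01 k.
  rewrite addr_ge0 ?mulr_ge0//=; have := ler_wpM2l t1' x1; have := ler_wpM2l t0 y1; lra.
have := ler_wpM2l t1' (xJ _ _ jJ lJ); have := ler_wpM2l t0 (yJ _ _ jJ lJ); lra.
Qed.

(** Exhibits the cone as a power sum of two cubes with [s = 1], so that [mu_power_sum], where the
    Gamma values are factorials, gives its volume. *)
Lemma model_coneE J P : [disjoint J & P]%B ->
  [set z | model_cone J z /\ forall k, k \notin J :|: P -> z 0 k = 0] =
  power_sum 1 (unit_cube J) (unit_cube P).
Proof.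
move=> JP; have PJ : [disjoint P & J]%B by rewrite disjoint_sym.
apply/seteqP; split => [z [[z01 zJ] z0]|z [x [y [t [Jx Py /andP[t0 t1] ->]]]]]; last first.
  have t1' : 0 <= 1 - t by rewrite subr_ge0.
  have coord k : ((1 - t) `^ 1 *: x + t `^ 1 *: y) 0 k =
      if k \in J then (1 - t) * x 0 k else if k \in P then t * y 0 k else 0.
    rewrite rv_lin !powRr1//; have := Jx k; have := Py k.
    have [kJ|kJ] := boolP (k \in J).
      by rewrite (disjointFr JP kJ) => /eqP -> _; rewrite mulr0 addr0.
    by have [kP|kP] := boolP (k \in P) => [_|/eqP ->] /eqP ->; rewrite !mulr0 add0r.
  split; last by move=> k; rewrite coord !inE negb_or => /andP[/negbTE-> /negbTE->].
  split=> [k|j l jJ lJ]; rewrite !coord.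
    have := Jx k; have := Py k.
    have [kJ|kJ] := boolP (k \in J).
      by move=> _ /andP[x0 x1]; rewrite mulr_ge0//= mulr_ile1// lerBlDr lerDl.
    have [kP|kP] := boolP (k \in P); last by rewrite lexx ler01.
    by move=> /andP[y0 y1] _; rewrite mulr_ge0//= mulr_ile1.
  rewrite jJ (negbTE lJ); have := Jx j; rewrite jJ => /andP[xj0 xj1].
  have xj : (1 - t) * x 0 j <= 1 - t by rewrite ler_piMr.
  have [lP|lP] := boolP (l \in P); last by rewrite addr0 (le_trans xj)// lerBlDr lerDl.
  have := Py l; rewrite lP => /andP[yl0 yl1].
  have yl : t * y 0 l <= t by rewrite ler_piMr.
  by rewrite (le_trans (lerD xj yl))// subrK.
(* The room left to the coordinates outside [J] is taken as parameter of the sum; when [J] is empty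
   the default 1 is the right value. *)
pose m := \big[Num.min/1]_(j in J) (1 - z 0 j).
have m1 : m <= 1 by exact: bigmin_le_id.
have m0 : 0 <= m.
  by apply/bigmin_geP; split => // j _; rewrite subr_ge0; case/andP: (z01 j).
have mJ j : j \in J -> z 0 j <= 1 - m.
  by move=> jJ; rewrite lerBrDr addrC -lerBrDr; exact: bigmin_le_cond.
have mP l : l \notin J -> z 0 l <= m.
  move=> lJ; apply/bigmin_geP; split; first by case/andP: (z01 l).
  by move=> j jJ; rewrite lerBrDr addrC; exact: zJ.
exists (\row_k (if k \in J then z 0 k / (1 - m) else 0)),
  (\row_k (if k \in P then z 0 k / m else 0)), m.
have m1' : 0 <= 1 - m by rewrite subr_ge0.
(* If the coefficient [c] vanishes then so does [e], and the convention for division by 0 gives the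
   correct point. *)
have frac (c e : R) : 0 <= c -> 0 <= e -> e <= c -> 0 <= e / c <= 1 /\ c * (e / c) = e.
  move=> c0 e0 ec; have [c00|cn0] := eqVneq c 0.
    have -> : e = 0 by apply/le_anti; rewrite e0 -c00 ec.
    by rewrite mul0r mulr0 lexx ler01.
  have cp : 0 < c by rewrite lt_neqAle eq_sym cn0.
  by rewrite divr_ge0//= ler_pdivrMr// mul1r ec mulrC divfK.
split.
- move=> k; rewrite mxE; have [kJ|//] := boolP (k \in J).
  have /andP[zk _] := z01 k; exact: (frac _ _ m1' zk (mJ _ kJ)).1.
- move=> k; rewrite mxE; have [kP|//] := boolP (k \in P).
  have /andP[zk _] := z01 k; apply: (frac _ _ m0 zk (mP _ _)).1.
  by rewrite (disjointFr PJ kP).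
- by rewrite m0.
apply/rowP => k; rewrite rv_lin !mxE !powRr1//; have /andP[zk _] := z01 k.
have [kJ|kJ] := boolP (k \in J).
  by rewrite (disjointFr JP kJ) mulr0 addr0 (frac _ _ m1' zk (mJ _ kJ)).2.
have [kP|kP] := boolP (k \in P); first by rewrite mulr0 add0r (frac _ _ m0 zk (mP _ kJ)).2.
by rewrite !mulr0 addr0 z0// !inE negb_or kJ.
Qed.

Lemma compact_model_cone J : compact (model_cone J).
Proof.
have JJ : [disjoint J & ~: J]%B.
  by apply/pred0P => k /=; rewrite !inE andbN.
rewrite (_ : model_cone J = power_sum 1 (unit_cube J) (unit_cube (~: J))).
  by apply: compact_power_sum => //; exact: compact_unit_cube.
rewrite -model_coneE//; apply/seteqP; split => [z Mz|z []//]; split => // k.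
by rewrite !inE orbN.
Qed.

Lemma mu_supp J (A : set 'rV[R]_n) :
  mu J A = mu J [set z | A z /\ forall k, k \notin J -> z 0 k = 0].
Proof.
rewrite /mu /pushforward; congr lebesgue_vol; apply/seteqP; split => v /=; last by case.
by move=> Av; split => // k kJ; rewrite emb_notin.
Qed.

Lemma mu_model_cone J P : [disjoint J & P]%B ->
  mu (J :|: P) (model_cone J) = (((#|J|)`! * (#|P|)`!)%:R / (#|J| + #|P|)`!%:R)%:E.
Proof.
move=> JP; rewrite mu_supp model_coneE//.
have JPc : #|J :|: P| = (#|J| + #|P|)%N.
  rewrite cardsU (_ : J :&: P = finset.set0) ?cards0 ?subn0//.
  by apply/eqP; rewrite setI_eq0.
have := mu_power_sum (@ler01 R) JP (@starlike_unit_cube J) (@starlike_unit_cube P)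
  (@compact_unit_cube J) (@compact_unit_cube P) (@unit_cube_proj J) (@unit_cube_proj P).
rewrite !mulr1 !mu_unit_cube !mul1e !Gam_nat JPc => E.
have F0 : (#|J| + #|P|)`!%:R != 0 :> R by rewrite pnatr_eq0 -lt0n fact_gt0.
rewrite natrM EFinM EFinM -E -muleA -EFinM divff// mule1//.
Qed.

End model_cone.

Section model_cone_levels.
Variables (R : realType) (n : nat).
Implicit Types (J P Q : {set 'I_n}).

Lemma mu_rect J (b : 'I_n -> R) : (forall k, k \in J -> 0 <= b k) ->
  mu J [set x : 'rV[R]_n | forall k, k \in J -> 0 <= x 0 k <= b k] =
  (\prod_(k in J) b k)%:E.
Proof.
move=> b0; rewrite (_ : [set x | _] =
  mbox (fun k => if k \in J then `[0, b k]%classic else setT)); last first.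
  apply/seteqP; split => x Jx k; have := Jx k => /=.
    by have [kJ|//] := boolP (k \in J); rewrite /= in_itv; apply.
  by have [kJ|//] := boolP (k \in J); rewrite /= in_itv.
rewrite mu_mbox; last by move=> k; case: ifP.
rewrite (bigID (mem J))/= [X in (_ * X)%E]big1 ?mule1; last first.
  by move=> k /negbTE kJ; rewrite /fac kJ diracT.
rewrite (big_morph EFin (@EFinM R) erefl); apply: eq_bigr => k kJ.
rewrite /fac kJ lebesgue_measure_itv/= lte_fin oppr0 adde0.
by case: ltP => // bk; congr EFin; apply/le_anti; rewrite b0.
Qed.

Let ball_le J (r : R) : set 'rV[R]_n := [set x | forall k, k \in J -> 0 <= x 0 k <= r].

Let mu_ball_le J r : (0 < #|J|)%N -> mu J (ball_le J r) = (Num.max r 0 ^+ #|J|)%:E.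
Proof.
move=> J0; have [r0|r0] := leP 0 r; first by rewrite mu_rect// prodr_const.
rewrite expr0n eqn0Ngt J0/= (_ : ball_le J r = set0) ?measure0//.
apply/seteqP; split => // x /=; have [k kJ] := card_gt0P J0.
by move=> /(_ _ kJ)/andP[x0 /(le_trans x0)]; rewrite leNgt r0.
Qed.

(* The largest value that [x] leaves to the coordinates outside [J]. *)
Definition room J (x : 'rV[R]_n) : R := \big[Num.min/1]_(j in J) (1 - x 0 j).

Lemma sect_vol_model_cone J P x : [disjoint J & P]%B -> (0 < #|P|)%N ->
  sect_vol J P (model_cone J) x =
  if [forall k in J, 0 <= x 0 k <= 1] then (room J x ^+ #|P|)%:E else 0%E.
Proof.
move=> JP P0; have PJ : [disjoint P & J]%B by rewrite disjoint_sym.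
case: ifPn => [/forall_inP x01|]; last first.
  rewrite negb_forall_in => /exists_inP[k kJ /negP xk].
  rewrite /sect_vol (_ : sect _ _ _ _ = set0) ?measure0//.
  apply/seteqP; split => // y [/(_ k)]; rewrite joinE kJ (disjointFr JP kJ) addr0.
  by move/xk.
have m0 : 0 <= room J x.
    by apply/bigmin_geP; split => // j jJ; rewrite subr_ge0; case/andP: (x01 _ jJ).
have m1 : room J x <= 1 by exact: bigmin_le_id.
rewrite /sect_vol -prodr_const -mu_rect//; congr (mu P _).
apply/seteqP; split => y.
  move=> [y01 yJ] k kP /=; have := y01 k; rewrite joinE kP (disjointFr PJ kP) add0r.
  move=> /andP[y0 y1]; rewrite y0/=; apply/bigmin_geP; split => // j jJ.
  have := yJ j k jJ; rewrite (disjointFr PJ kP) => /(_ isT).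
  by rewrite !joinE jJ kP (disjointFr JP jJ) (disjointFr PJ kP) addr0 add0r; lra.
move=> yP; split => [k|j l jJ lJ]; rewrite !joinE.
  have [kJ|kJ] := boolP (k \in J); first by rewrite (disjointFr JP kJ) addr0 x01.
  rewrite add0r; case: ifPn => [kP|_]; last by rewrite lexx ler01.
  by have /andP[-> /le_trans->] := yP _ kP.
rewrite jJ (negbTE lJ) (disjointFr JP jJ) addr0 add0r.
case: ifPn => [lP|_]; last by rewrite addr0; case/andP: (x01 _ jJ).
have /andP[_ yl] := yP _ lP; rewrite addrC -lerBrDr (le_trans yl)//.
exact: bigmin_le_cond.
Qed.

(** A lower bound on [room J x] bounds all coordinates of [x] in [J] by one number, so the level
    sets are cubes with a corner at 0, nested whatever [P] and [c] are. *)
Let level_model_cone J P (c u : R) : [disjoint J & P]%B -> (0 < #|J|)%N ->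
  (0 < #|P|)%N -> 0 < c -> 0 < u ->
  [set x | (u%:E <= c%:E * sect_vol J P (model_cone J) x)%E] =
  ball_le J (1 - (u / c) `^ (#|P|%:R^-1)).
Proof.
move=> JP J0 P0 c0 u0; set h := _ `^ _.
have uc0 : 0 < u / c by rewrite divr_gt0.
have h0 : 0 < h by rewrite powR_gt0.
have hE : h ^+ #|P| = u / c.
  by rewrite -powR_mulrn ?powR_ge0// -powRrM mulVf ?powRr1 ?ltW// pnatr_eq0 -lt0n.
have roomE (x : 'rV[R]_n) : [forall k in J, 0 <= x 0 k <= 1] ->
    (u <= c * room J x ^+ #|P|) = (h <= room J x).
  move=> /forall_inP x01; rewrite -ler_pdivrMl// mulrC -hE ler_pXn2r// nnegrE ?(ltW h0)//.
    by apply/bigmin_geP; split => // j jJ; rewrite subr_ge0; case/andP: (x01 _ jJ).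
apply/seteqP; split => x /=; rewrite sect_vol_model_cone//.
  case: ifPn => [x01|_]; last by rewrite mule0 lee_fin leNgt u0.
  rewrite -EFinM lee_fin roomE// => hx k kJ; move/forall_inP : x01 => /(_ _ kJ)/andP[-> _]/=.
  by rewrite lerBrDl -lerBrDr (le_trans hx)//; exact: bigmin_le_cond.
move=> xJ; have x01 : [forall k in J, 0 <= x 0 k <= 1].
  apply/forall_inP => k kJ; have /andP[-> xk]/= := xJ _ kJ.
  by rewrite (le_trans xk)// lerBlDr lerDl ltW.
rewrite x01 -EFinM lee_fin roomE//; apply/bigmin_geP; split.
  have [k kJ] := card_gt0P J0; have /andP[x0 xk] := xJ _ kJ; lra.
by move=> j jJ; have /andP[_ xj] := xJ _ jJ; lra.
Qed.

Lemma mu_level_model_cone J P (c u : R) : [disjoint J & P]%B -> (0 < #|J|)%N ->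
  (0 < #|P|)%N -> 0 < c -> 0 < u ->
  mu J [set x | (u%:E <= c%:E * sect_vol J P (model_cone J) x)%E] =
  (cone_profile J P c u)%:E.
Proof. by move=> JP J0 P0 c0 u0; rewrite level_model_cone// mu_ball_le. Qed.

(** Since the level sets are nested, an intersection is the smaller of the two: the bound by the
    minimum is attained. *)
Lemma mu_level2_model_cone J P Q (c d u t : R) : [disjoint J & P]%B ->
  [disjoint J & Q]%B -> (0 < #|J|)%N -> (0 < #|P|)%N -> (0 < #|Q|)%N ->
  0 < c -> 0 < d -> 0 < u -> 0 < t ->
  mu J [set x | (u%:E <= c%:E * sect_vol J P (model_cone J) x)%E /\
                (t%:E <= d%:E * sect_vol J Q (model_cone J) x)%E] =
  (Num.min (cone_profile J P c u) (cone_profile J Q d t))%:E.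
Proof.
move=> JP JQ J0 P0 Q0 c0 d0 u0 t0.
rewrite (_ : [set x | _] = [set x | (u%:E <= c%:E * sect_vol J P (model_cone J) x)%E] `&`
  [set x | (t%:E <= d%:E * sect_vol J Q (model_cone J) x)%E])//.
rewrite !level_model_cone//; set r := 1 - _; set r' := 1 - _.
rewrite (_ : _ `&` _ = ball_le J (Num.min r r')); last first.
  apply/seteqP; split => x /=.
    by move=> [x1 x2] k kJ; have /andP[xk xr] := x1 _ kJ; have /andP[_ xr'] := x2 _ kJ; rewrite xk le_min xr.
  by move=> xr; split => k /xr; rewrite le_min => /and3P[-> xr1 xr2].
rewrite mu_ball_le// /cone_profile -/r -/r'; congr EFin.
have mono (v w : R) : v <= w -> Num.max v 0 ^+ #|J| <= Num.max w 0 ^+ #|J|.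
  move=> vw; have max0 (e : R) : 0 <= Num.max e 0 by rewrite le_max lexx orbT.
  by apply: lerXn2r; rewrite ?nnegrE// ge_max !le_max vw lexx orbT.
by case: (leP r r') => rr; rewrite ?(min_idPl (mono _ _ rr)) ?(min_idPr (mono _ _ (ltW rr))).
Qed.

(** Each joint constraint of the cone involves one coordinate in [J] and one outside, so it never
    couples [P] with [Q]. *)
Lemma model_cone_join J P Q (x y z : 'rV[R]_n) : [disjoint J & P]%B -> [disjoint J & Q]%B ->
  [disjoint P & Q]%B -> model_cone J (join J P (x, y)) -> model_cone J (join J Q (x, z)) ->
  model_cone J (join J (P :|: Q) (x, join P Q (y, z))).
Proof.
move=> JP JQ PQ [y01 yJ] [z01 zJ]; pose w := join J (P :|: Q) (x, join P Q (y, z)).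
have wy k : k \in J :|: P -> w 0 k = join J P (x, y) 0 k.
  rewrite inE /w !joinE !inE.
  have [kJ|kJ] := boolP (k \in J); first by rewrite (disjointFr JP kJ) (disjointFr JQ kJ).
  by move=> /= kP; rewrite kP (disjointFr PQ kP)/= addr0.
have wz k : k \notin P -> w 0 k = join J Q (x, z) 0 k.
  rewrite /w !joinE !inE => /negbTE ->.
  have [kJ|kJ] := boolP (k \in J); first by rewrite (disjointFr JQ kJ).
  by case: (k \in Q); rewrite /= !add0r.
split=> [k|j l jJ lJ].
  by have [kP|/wz->//] := boolP (k \in P); rewrite wy ?y01// inE kP orbT.
have [lP|lP] := boolP (l \in P).
  by rewrite !wy ?yJ// inE ?jJ ?lP ?orbT.
by rewrite !wz ?zJ// (disjointFr JP jJ).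
Qed.

End model_cone_levels.

Section double_min.
Variable R : realType.
Local Open Scope ereal_scope.

Definition single_crossing (phi psi : R -> R) : Prop :=
  [/\ measurable_fun setT phi /\ measurable_fun setT psi,
      (forall u, (0 <= phi u)%R) /\ (forall u, (0 <= psi u)%R),
      (forall u v : R, (0 < u)%R -> (u <= v)%R -> (psi v <= psi u)%R) /\
      (forall u v : R, (0 < u)%R -> (u < v)%R -> (phi u < psi u)%R -> (phi v <= psi v)%R) &
      \int[lebesgue_measure]_(u in `]0%R, +oo[) (phi u)%:E =
      \int[lebesgue_measure]_(u in `]0%R, +oo[) (psi u)%:E /\
      \int[lebesgue_measure]_(u in `]0%R, +oo[) (phi u)%:E \is a fin_num].

Let min_le (phi psi : R -> R) c : single_crossing phi psi -> (0 <= c)%R ->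
  \int[lebesgue_measure]_(u in `]0%R, +oo[) (Num.min (phi u) c)%:E <=
  \int[lebesgue_measure]_(u in `]0%R, +oo[) (Num.min (psi u) c)%:E.
Proof.
move=> [[m1 m2] [p1 p2] [h1 h2] [e1 e2]] c0.
exact: (min_integral_le m1 m2 p1 p2 h1 h2 e1 e2 c0).
Qed.

Let quadrant : set (R * R) := `]0%R, +oo[ `*` `]0%R, +oo[.

Let measurable_quadrant : measurable quadrant.
Proof. by apply: measurableX; exact: measurable_itv. Qed.

Let mmin (f g : R -> R) : measurable_fun setT f -> measurable_fun setT g ->
  measurable_fun setT (fun p : R * R => (Num.min (f p.1) (g p.2))%:E).
Proof.
move=> mf mg; apply/measurable_EFinP; apply: measurable_minr.
  by apply: (measurableT_comp mf); exact: measurable_fst.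
by apply: (measurableT_comp mg); exact: measurable_snd.
Qed.

Let ray : set R := `]0%R, +oo[%classic.

Let xsec u : ray u -> xsection quadrant u = ray.
Proof.
by move=> u0; apply/seteqP; split => t; rewrite /xsection/= inE; [case|split].
Qed.

Let ysec u : ray u -> ysection quadrant u = ray.
Proof.
by move=> u0; apply/seteqP; split => t; rewrite /ysection/= inE; [case|split].
Qed.

Lemma measurable_min_integral (f g : R -> R) : measurable_fun setT f -> measurable_fun setT g ->
  (forall u, (0 <= f u)%R) -> (forall u, (0 <= g u)%R) -> measurable_fun ray
    (fun u => \int[lebesgue_measure]_(t in ray) (Num.min (f u) (g t))%:E).
Proof.
move=> mf mg f0 g0; apply: (eq_measurable_fun (fun u =>
    \int[lebesgue_measure]_(t in xsection quadrant u) (Num.min (f u) (g t))%:E)).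
  by move=> u; rewrite inE => u0; rewrite xsec.
apply: measurable_funTS.
apply: (measurable_tonelli_on lebesgue_measure measurable_quadrant (mmin mf mg)).
by move=> p; rewrite lee_fin le_min f0 g0.
Qed.

Let swap (f g : R -> R) : measurable_fun setT f -> measurable_fun setT g ->
  (forall u, (0 <= f u)%R) -> (forall u, (0 <= g u)%R) ->
  \int[lebesgue_measure]_(u in ray)
    \int[lebesgue_measure]_(t in ray) (Num.min (f u) (g t))%:E =
  \int[lebesgue_measure]_(t in ray)
    \int[lebesgue_measure]_(u in ray) (Num.min (f u) (g t))%:E.
Proof.
move=> mf mg f0 g0.
have h0 (p : R * R) : 0 <= (Num.min (f p.1) (g p.2))%:E by rewrite lee_fin le_min f0 g0.
rewrite [LHS]integral_mkcond [RHS]integral_mkcond.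
transitivity (\int[lebesgue_measure]_x
    \int[lebesgue_measure]_(y in xsection quadrant x) (Num.min (f x) (g y))%:E).
  apply: eq_integral => u _; rewrite patchE; case: ifPn => [|u0]; first by rewrite inE => /xsec ->.
  rewrite (_ : xsection _ _ = set0) ?integral_set0//.
  by apply/seteqP; split => // t; rewrite /xsection/= inE => -[] /mem_set ut; case/negP: u0.
rewrite (tonelli_on lebesgue_measure lebesgue_measure measurable_quadrant (mmin mf mg) h0).
apply: eq_integral => u _; rewrite patchE; case: ifPn => [|u0]; first by rewrite inE => /ysec ->.
rewrite (_ : ysection _ _ = set0) ?integral_set0//.
by apply/seteqP; split => // t; rewrite /ysection/= inE => -[_] /mem_set ut; case/negP: u0.
Qed.

(** The functions are replaced one at a time: with one variable fixed, the other function is merely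
    truncated at a constant height. *)
Lemma double_min_le (f f' g g' : R -> R) : single_crossing f f' -> single_crossing g g' ->
  \int[lebesgue_measure]_(u in `]0%R, +oo[)
    \int[lebesgue_measure]_(t in `]0%R, +oo[) (Num.min (f u) (g t))%:E <=
  \int[lebesgue_measure]_(u in `]0%R, +oo[)
    \int[lebesgue_measure]_(t in `]0%R, +oo[) (Num.min (f' u) (g' t))%:E.
Proof.
move=> ff gg; have [[mf mf'] [f0 f0'] _ _] := ff; have [[mg mg'] [g0 g0'] _ _] := gg.
have inner0 (a b : R -> R) u : (forall u, (0 <= a u)%R) -> (forall u, (0 <= b u)%R) ->
    0 <= \int[lebesgue_measure]_(t in ray) (Num.min (a u) (b t))%:E.
  by move=> a0 b0; apply: integral_ge0 => t _; rewrite lee_fin le_min a0 b0.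
apply: (@le_trans _ _ (\int[lebesgue_measure]_(u in ray)
    \int[lebesgue_measure]_(t in ray) (Num.min (f u) (g' t))%:E)).
  apply: ge0_le_integral => //.
  - by move=> u _; exact: inner0.
  - exact: measurable_min_integral.
  - exact: measurable_min_integral.
  move=> u _; under eq_integral do rewrite minC.
  by under [leRHS]eq_integral do rewrite minC; exact: min_le.
rewrite (swap mf mg' f0 g0') (swap mf' mg' f0' g0').
have inner (a b : R -> R) : measurable_fun setT a -> measurable_fun setT b ->
    (forall u, (0 <= a u)%R) -> (forall u, (0 <= b u)%R) -> measurable_fun ray
    (fun t => \int[lebesgue_measure]_(u in ray) (Num.min (a u) (b t))%:E).
  move=> ma mb a0 b0; under eq_fun do under eq_integral do rewrite minC.
  exact: measurable_min_integral.
apply: ge0_le_integral.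
- exact: measurable_itv.
- by move=> t _; apply: integral_ge0 => u _; rewrite lee_fin le_min f0 g0'.
- exact: inner.
- exact: inner.
by move=> t _; exact: min_le.
Qed.

End double_min.

(** Follows from the definition by suprema over simple functions, and so applies directly to
    iterated integrals. *)
Lemma le_integral_nonneg d (T : measurableType d) (R : realType)
    (m : {measure set T -> \bar R}) (D : set T) (f g : T -> \bar R) :
  (forall x, D x -> 0 <= f x)%E -> (forall x, D x -> f x <= g x)%E ->
  (\int[m]_(x in D) f x <= \int[m]_(x in D) g x)%E.
Proof.
move=> f0 fg; have g0 x : D x -> (0 <= g x)%E by move=> Dx; rewrite (le_trans (f0 _ Dx))// fg.
rewrite integral_mkcond [leRHS]integral_mkcond !ge0_integralTE; last 2 first.
- by move=> x; exact: erestrict_ge0.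
- by move=> x; exact: erestrict_ge0.
apply: ereal_sup_le => // _ /= [h hf <-]; exists h => // x.
by rewrite (le_trans (hf x))// !patchE; case: ifPn => // /set_mem; exact: fg.
Qed.

Lemma disjoint_setUr (T : finType) (A B C : {set T}) : [disjoint A & B]%B ->
  [disjoint A & C]%B -> [disjoint A & B :|: C]%B.
Proof.
move=> AB AC; apply/pred0P => k /=; rewrite !inE; case: (boolP (k \in A)) => //= kA.
by rewrite (disjointFr AB kA) (disjointFr AC kA).
Qed.

Lemma card_disjointU (T : finType) (A B : {set T}) : [disjoint A & B]%B ->
  #|A :|: B| = (#|A| + #|B|)%N.
Proof.
move=> AB; rewrite cardsU (_ : A :&: B = finset.set0) ?cards0 ?subn0//.
by apply/eqP; rewrite setI_eq0.
Qed.

Section comparison.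
Variables (R : realType) (n : nat).
Implicit Types (J P Q : {set 'I_n}).

(** The reciprocal of a binomial coefficient; the volume of the model cone with [k] coordinates in
    [J] and [a] others. *)
Definition cone_vol (k a : nat) : R := (k`! * a`!)%:R / (k + a)`!%:R.

Lemma cone_vol_gt0 k a : 0 < cone_vol k a.
Proof. by rewrite divr_gt0// ltr0n ?muln_gt0 ?fact_gt0. Qed.

Let cone_fin J P : [disjoint J & P]%B -> mu (J :|: P) (@model_cone R n J) = (cone_vol #|J| #|P|)%:E.
Proof. exact: mu_model_cone. Qed.

Let mcone J : measurable (@model_cone R n J).
Proof. by apply: compact_measurable_rv; exact: compact_model_cone. Qed.

Let msect_cone J P (c : R) :
  measurable_fun setT (fun x => (c%:E * sect_vol J P (@model_cone R n J) x)%E).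
Proof. by apply: measurable_funeM; apply: measurable_sect_vol. Qed.

Let sect_cone_ge0 J P (c : R) x : 0 < c -> (0 <= c%:E * sect_vol J P (@model_cone R n J) x)%E.
Proof. by move=> c0; rewrite mule_ge0 ?sect_vol_ge0// lee_fin ltW. Qed.

Lemma integral_cone_profile J P c : [disjoint J & P]%B -> (0 < #|J|)%N -> (0 < #|P|)%N ->
  0 < c -> (\int[lebesgue_measure]_(u in `]0%R, +oo[) (@cone_profile R n J P c u)%:E =
    (c * cone_vol #|J| #|P|)%:E)%E.
Proof.
move=> JP J0 P0 c0; rewrite EFinM -cone_fin// -integral_sect_vol// -ge0_integralZl//; last 2 first.
- exact: measurable_sect_vol.
- by rewrite lee_fin ltW.
rewrite (layer_cake (mu J) (msect_cone J P c)); last by move=> x; exact: sect_cone_ge0.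
apply: eq_integral => u; rewrite inE/= in_itv/= andbT => u0.
by rewrite [RHS](mu_level_model_cone JP J0 P0 c0 u0).
Qed.

Lemma cone_profile_ge0 J P (c u : R) : 0 <= cone_profile J P c u.
Proof. by rewrite exprn_ge0// le_max lexx orbT. Qed.

Lemma measurable_cone_profile J P (c : R) : measurable_fun setT (cone_profile J P c).
Proof.
rewrite /cone_profile; apply: measurable_funX; apply: measurable_maxr; last exact: measurable_cst.
apply: measurable_funB; first exact: measurable_cst.
apply: (measurableT_comp (@measurable_powR R _)).
by apply: measurable_funM => //; exact: measurable_cst.
Qed.

Lemma cone_profile_noninc J P (c u v : R) : 0 < c -> 0 < u -> u <= v ->
  cone_profile J P c v <= cone_profile J P c u.
Proof.
move=> c0 u0 uv; have max0 (e : R) : 0 <= Num.max e 0 by rewrite le_max lexx orbT.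
apply: lerXn2r; rewrite ?nnegrE// ge_max !le_max lexx orbT andbT lerD2l lerN2.
apply/orP; left; apply: ge0_ler_powR; rewrite ?invr_ge0 ?ler0n// ?nnegrE.
- by rewrite divr_ge0// ltW.
- by rewrite divr_ge0// ?ltW// (lt_le_trans u0).
- by rewrite ler_pM2r ?invr_gt0.
Qed.

Variables (A : set 'rV[R]_n) (i : nat).
Hypotheses (mA : measurable A) (dA : downset A) (Ai : A `<=` @cube R n i).
Hypothesis cvA : forall x y (t : R), A x -> A y -> 0 <= t <= 1 ->
  A ((1 - t) *: x + t *: y).

Let a J : R := fine (mu J A).
Let aE J : mu J A = (a J)%:E.
Proof. by rewrite fineK// (mu_fin J mA Ai). Qed.
Let a_ge0 J : 0 <= a J. Proof. exact: fine_ge0. Qed.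

Let nonempty J : 0 < a J -> A !=set0.
Proof.
move=> aJ; apply/set0P; apply: contraTneq aJ => A0.
by rewrite /a A0 measure0 ltxx.
Qed.

(** The factor [a J] matches the bases, and the height of the profile is chosen so that both
    functions have integral [a (J :|: P)]. *)
Let level_single_crossing J P : [disjoint J & P]%B -> (0 < #|J|)%N -> (0 < #|P|)%N ->
  0 < a J -> 0 < a (J :|: P) ->
  single_crossing (level_vol J P A)
    (fun u => a J * cone_profile J P (a (J :|: P) / (a J * cone_vol #|J| #|P|)) u).
Proof.
move=> JP J0 P0 aJ aJP; set c := _ / _.
have c0 : 0 < c by rewrite divr_gt0// mulr_gt0// cone_vol_gt0.
have E := integral_level_vol JP mA dA Ai.
split; split.
- exact: measurable_level_vol.
- by apply: measurable_funM; [exact: measurable_cst|exact: measurable_cone_profile].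
- by move=> u; exact: level_vol_ge0.
- by move=> u; rewrite mulr_ge0// cone_profile_ge0.
- by move=> u v u0 uv; rewrite ler_pM2l// cone_profile_noninc.
- move=> u v u0 uv; exact: (level_vol_crossing JP mA dA Ai cvA J0 P0 (nonempty aJ) c0 u0 uv).
- rewrite E aE; under eq_integral do rewrite EFinM.
  rewrite ge0_integralZl//; first last.
  + by rewrite lee_fin.
  + by move=> u _; rewrite lee_fin cone_profile_ge0.
  + by apply/measurable_EFinP/measurable_funTS; exact: measurable_cone_profile.
  rewrite integral_cone_profile// -EFinM; congr EFin.
  by rewrite /c; field; rewrite !gt_eqF// cone_vol_gt0.
- by rewrite E aE.
Qed.

(** The section volumes along [Q] are bounded, so [mu_triple_le] bounds the whole volume by a
    multiple of [a (J :|: P)]. *)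
Let triple_eq0 J P Q : [disjoint J & P]%B -> [disjoint J & Q]%B ->
  [disjoint P & Q]%B -> a (J :|: P) = 0 -> a (J :|: (P :|: Q)) = 0.
Proof.
move=> JP JQ PQ aJP; apply/le_anti; rewrite a_ge0 andbT.
pose d := fine (mu Q (@cube R n i)).
have dE : mu Q (@cube R n i) = d%:E by rewrite fineK// ge0_fin_numE// mu_cube_fin.
have d0 : 0 <= d by exact: fine_ge0.
rewrite -lee_fin -aE; apply: (le_trans (mu_triple_le JP JQ PQ mA dA)).
apply: (@le_trans _ _ (\int[mu J]_x (d%:E * sect_vol J P A x))%E); last first.
  rewrite ge0_integralZl//; last exact: measurable_sect_vol.
  by rewrite integral_sect_vol// aE aJP mule0.
apply: le_integral_nonneg => x _; first by rewrite mule_ge0 ?sect_vol_ge0.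
by rewrite muleC lee_wpmul2r ?sect_vol_ge0// -dE; exact: sect_vol_fin.
Qed.

Let cone_triple J P Q : [disjoint J & P]%B -> [disjoint J & Q]%B ->
  [disjoint P & Q]%B ->
  (\int[mu J]_x (sect_vol J P (@model_cone R n J) x * sect_vol J Q (@model_cone R n J) x))%E =
  (cone_vol #|J| (#|P| + #|Q|))%:E.
Proof.
move=> JP JQ PQ; rewrite -mu_tripleE//; last 2 first.
- exact: downset_model_cone.
- by move=> x y z; exact: model_cone_join.
have JPQ : [disjoint J & P :|: Q]%B by exact: disjoint_setUr.
by rewrite cone_fin// card_disjointU.
Qed.

(** Cleared of denominators, so that vanishing volumes are covered. *)
Lemma berwald J P Q : [disjoint J & P]%B -> [disjoint J & Q]%B -> [disjoint P & Q]%B ->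
  (0 < #|J|)%N -> (0 < #|P|)%N -> (0 < #|Q|)%N ->
  a (J :|: (P :|: Q)) * a J * (cone_vol #|J| #|P| * cone_vol #|J| #|Q|) <=
  cone_vol #|J| (#|P| + #|Q|) * (a (J :|: P) * a (J :|: Q)).
Proof.
move=> JP JQ PQ J0 P0 Q0.
have rhs0 : 0 <= cone_vol #|J| (#|P| + #|Q|) * (a (J :|: P) * a (J :|: Q)).
  by rewrite mulr_ge0 ?mulr_ge0// ltW// cone_vol_gt0.
have [aJ|aJ] := eqVneq (a J) 0; first by rewrite aJ mulr0 mul0r.
have [aP|aP] := eqVneq (a (J :|: P)) 0; first by rewrite (triple_eq0 JP JQ PQ aP) !mul0r.
have [aQ|aQ] := eqVneq (a (J :|: Q)) 0.
  by rewrite (finset.setUC P) (triple_eq0 JQ JP _ aQ) ?mul0r// disjoint_sym.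
have {}aJ : 0 < a J by rewrite lt_neqAle eq_sym aJ a_ge0.
have {}aP : 0 < a (J :|: P) by rewrite lt_neqAle eq_sym aP a_ge0.
have {}aQ : 0 < a (J :|: Q) by rewrite lt_neqAle eq_sym aQ a_ge0.
pose c := a (J :|: P) / (a J * cone_vol #|J| #|P|).
pose d := a (J :|: Q) / (a J * cone_vol #|J| #|Q|).
have c0 : 0 < c by rewrite divr_gt0// mulr_gt0// cone_vol_gt0.
have d0 : 0 < d by rewrite divr_gt0// mulr_gt0// cone_vol_gt0.
suff H : a (J :|: (P :|: Q)) <= a J * (c * d * cone_vol #|J| (#|P| + #|Q|)).
  have vP := cone_vol_gt0 #|J| #|P|; have vQ := cone_vol_gt0 #|J| #|Q|.
  have K : 0 <= a J * (cone_vol #|J| #|P| * cone_vol #|J| #|Q|).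
    by rewrite mulr_ge0// mulr_ge0// ltW.
  rewrite -mulrA; apply: le_trans (ler_wpM2r K H) _.
  rewrite le_eqVlt; apply/orP; left; apply/eqP; rewrite /c /d; field.
  by rewrite !gt_eqF.
have inner0 (f g : R -> R) u : (forall u, 0 <= f u) -> (forall u, 0 <= g u) ->
    (0 <= \int[lebesgue_measure]_(t in `]0%R, +oo[) (Num.min (f u) (g t))%:E)%E.
  by move=> f0 g0; apply: integral_ge0 => t _; rewrite lee_fin le_min f0 g0.
rewrite -lee_fin -aE; apply: (le_trans (mu_triple_le JP JQ PQ mA dA)).
(* The intersection of two level sets measures at most the smaller of them. *)
apply: (@le_trans _ _ (\int[lebesgue_measure]_(u in `]0%R, +oo[)
    \int[lebesgue_measure]_(t in `]0%R, +oo[)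
      (Num.min (level_vol J P A u) (level_vol J Q A t))%:E)%E).
  rewrite layer_cakeM; last 4 first.
  - exact: measurable_sect_vol.
  - exact: measurable_sect_vol.
  - by move=> x; exact: sect_vol_ge0.
  - by move=> x; exact: sect_vol_ge0.
  apply: le_integral_nonneg => u; rewrite /= in_itv/= andbT => u0.
    by apply: integral_ge0 => t _; exact: measure_ge0.
  apply: le_integral_nonneg => t; rewrite /= in_itv/= andbT => t0.
    exact: measure_ge0.
  have mP : measurable (level J P A u) by exact: measurable_level.
  have mQ : measurable (level J Q A t) by exact: measurable_level.
  have mPQ : measurable [set x | (u%:E <= sect_vol J P A x)%E /\ (t%:E <= sect_vol J Q A x)%E].
    exact: measurableI mP mQ.
  rewrite /level_vol EFin_min !fineK ?(level_fin_num _ mA dA Ai)// le_min.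
  by apply/andP; split; apply: (le_measure (mu J)); rewrite ?inE// => x [].
apply: le_trans (double_min_le (level_single_crossing JP J0 P0 aJ aP)
  (level_single_crossing JQ J0 Q0 aJ aQ)) _.
(* For the model the same chain is read backwards, with equalities: the double integral of minima is
   the integral of a product of section volumes, that is, the volume of a cone. *)
rewrite -/c -/d (EFinM (a J)) (EFinM (c * d)) -(cone_triple JP JQ PQ).
have E u t : Num.min (a J * cone_profile J P c u) (a J * cone_profile J Q d t) =
    a J * Num.min (cone_profile J P c u) (cone_profile J Q d t) by rewrite minr_pMr// ltW.
have min0 u t : (0 <= (Num.min (cone_profile J P c u) (cone_profile J Q d t))%:E)%E.
  by rewrite lee_fin le_min !cone_profile_ge0.
have mf1 := measurable_cone_profile J P c; have mf2 := measurable_cone_profile J Q d.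
have mmin u : measurable_fun (`]0%R, +oo[%classic : set R)
    (fun t => (Num.min (cone_profile J P c u) (cone_profile J Q d t))%:E).
  apply/measurable_EFinP/measurable_funTS; apply: measurable_minr.
    exact: measurable_cst.
  exact: mf2.
rewrite le_eqVlt; apply/orP; left; apply/eqP.
transitivity ((a J)%:E * \int[lebesgue_measure]_(u in `]0%R, +oo[)
    \int[lebesgue_measure]_(t in `]0%R, +oo[)
      (Num.min (cone_profile J P c u) (cone_profile J Q d t))%:E)%E.
  rewrite -ge0_integralZl//; last 3 first.
  - by apply: measurable_min_integral => // u; exact: cone_profile_ge0.
  - by move=> u _; apply: integral_ge0 => t _; exact: min0.
  - by rewrite lee_fin ltW.
  apply: eq_integral => u _; rewrite -ge0_integralZl//; first last.
  - by rewrite lee_fin ltW.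
  - exact: mmin.
  by apply: eq_integral => t _; rewrite E EFinM.
congr (_ * _)%E; rewrite -ge0_integralZl//; last 3 first.
- by apply: emeasurable_funM; exact: measurable_sect_vol.
- by move=> x _; rewrite mule_ge0 ?sect_vol_ge0.
- by rewrite lee_fin ltW// mulr_gt0.
under [RHS]eq_integral do rewrite EFinM muleACA.
rewrite (layer_cakeM (mu J) (msect_cone J P c) (msect_cone J Q d)); last 2 first.
- by move=> x; exact: sect_cone_ge0.
- by move=> x; exact: sect_cone_ge0.
apply: eq_integral => u; rewrite inE/= in_itv/= andbT => u0.
apply: eq_integral => t; rewrite inE/= in_itv/= andbT => t0.
by rewrite [RHS](mu_level2_model_cone JP JQ J0 P0 Q0 c0 d0 u0 t0).
Qed.

End comparison.

(** * Decomposition into orthants *)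

Section orthants.
Variables (R : realType) (n : nat) (s : R).
Hypothesis s0 : 0 <= s.
Implicit Types (E J G : {set 'I_n}) (A B : set 'rV[R]_n).

Lemma measure_finite_partition d (T : measurableType d) (m : {measure set T -> \bar R})
    (I : finType) (P : {set I}) (F : I -> set T) (W : set T) :
  (forall i, measurable (F i)) -> trivIset [set` enum P] F ->
  W = \bigcup_(i in [set` enum P]) F i -> m W = (\sum_(i in P) m (F i))%E.
Proof.
move=> mF tF; rewrite bigcup_seq => ->.
have mD : measurable (\big[setU/set0]_(i <- enum P) F i) by exact: bigsetU_measurable.
rewrite -[LHS]mul1e -integral_cst// ge0_integral_bigsetU//; last exact: enum_uniq.
by rewrite big_enum; apply: eq_bigr => i _; rewrite integral_cst// mul1e.
Qed.

(** Zero is counted as nonnegative, so that for fixed [E] the orthants form a partition. *)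
Definition orthant E J : set 'rV[R]_n :=
  [set z | forall k, k \in E -> if k \in J then 0 <= z 0 k else z 0 k < 0].

Lemma measurable_orthant E J : measurable (orthant E J).
Proof.
rewrite (_ : orthant E J = mbox (fun k => if k \in E then
  if k \in J then `[0, +oo[%classic else `]-oo, 0[%classic else setT)).
  by apply: measurable_mbox => k; case: ifP => // _; case: ifP => _; exact: measurable_itv.
apply/seteqP; split => z zE k; have := zE k => /=.
  have [kE /(_ isT)|//] := boolP (k \in E).
  by have [kJ|kJ] := boolP (k \in J); rewrite /= in_itv/= ?andbT.
move=> /[swap] ->.
by have [kJ|kJ] := boolP (k \in J); rewrite /= in_itv/= ?andbT.
Qed.

Lemma starlike_coord_proj J A : downset A -> A 0 -> starlike (coord_proj J @` A).
Proof.
move=> dA A0; split; first by exists 0 => //; apply/rowP => k; rewrite !mxE if_same.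
move=> _ r [x Ax <-] /andP[r0 r1]; exists (r *: x); last by rewrite coord_projZ.
apply: (dA.2 _ _ Ax) => k; have := dA.1 _ Ax k; rewrite mxE => x0.
by rewrite mulr_ge0//= ler_piMl.
Qed.

Lemma coord_proj_downset J A : downset A -> coord_proj J @` A `<=` A.
Proof.
move=> dA _ [x Ax <-]; apply: (dA.2 _ _ Ax) => k; rewrite mxE.
by have := dA.1 _ Ax k; case: ifP => // _ x0; rewrite ?x0 lexx.
Qed.

(** In a difference al a_k - be b_k of prescribed sign, the term of the other sign only reduces the
    absolute value; dropping it and shrinking the remaining term inside the down-set reaches [x]. *)
Lemma power_sum_orthant A B J G (x : 'rV[R]_n) : downset A -> downset B -> [disjoint J & G]%B ->
  (forall k, 0 <= x 0 k) -> coord_proj (J :|: G) x = x ->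
  power_sum s A (-%R @` B) (flip G x) <->
  power_sum s (coord_proj J @` A) (coord_proj G @` B) x.
Proof.
move=> dA dB JG x0 xJG; have x00 k : k \notin J -> k \notin G -> x 0 k = 0.
  by move=> kJ kG; rewrite -xJG mxE inE (negbTE kJ) (negbTE kG).
have JG' k : k \in G -> (k \in J) = false by rewrite disjoint_sym in JG; exact: (disjointFr JG).
split; last first.
  move=> [_ [_ [t [[a Aa <-] [b Bb <-] t01 xE]]]].
  exists (coord_proj J a), (- coord_proj G b), t; split => //.
  - by apply: coord_proj_downset => //; exists a.
  - exists (coord_proj G b) => //; apply: coord_proj_downset => //; by exists b.
  apply/rowP => k; rewrite rv_lin 4!mxE xE rv_lin !mxE.
  have [kG|kG] := boolP (k \in G); first by rewrite JG'// mulr0 !add0r mulrN.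
  by rewrite oppr0 !mulr0.
move=> [a [_ [t [Aa [b Bb <-] /andP[t0 t1] xE]]]].
set al := (1 - t) `^ s in xE; set be := t `^ s in xE.
have al0 : 0 <= al by exact: powR_ge0.
have be0 : 0 <= be by exact: powR_ge0.
have coord k : flip G x 0 k = al * a 0 k - be * b 0 k by rewrite xE rv_lin mxE mulrN.
have xJ k : k \in J -> x 0 k <= al * a 0 k.
  move=> kJ; have := coord k; rewrite mxE (disjointFr JG kJ) => ->.
  by rewrite gerBl mulr_ge0// (dB.1 _ Bb).
have xG k : k \in G -> x 0 k <= be * b 0 k.
  move=> kG; have := coord k; rewrite mxE kG => /eqP; rewrite eqr_oppLR => /eqP ->.
  by rewrite opprB gerBl mulr_ge0// (dA.1 _ Aa).
have frac (c d e : R) : 0 <= c -> 0 <= d -> 0 <= e -> e <= c * d ->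
    0 <= e / c <= d /\ c * (e / c) = e.
  move=> c0 d0 e0 ed; have [c00|cn0] := eqVneq c 0.
    have -> : e = 0 by apply/le_anti; rewrite e0 -(mul0r d) -c00 ed.
    by rewrite mul0r mulr0 lexx d0.
  have cp : 0 < c by rewrite lt_neqAle eq_sym cn0.
  by rewrite divr_ge0//= ler_pdivrMr// mulrC ed mulrC divfK.
exists (\row_k (if k \in J then x 0 k / al else 0)),
  (\row_k (if k \in G then x 0 k / be else 0)), t; split.
- exists (\row_k (if k \in J then x 0 k / al else 0)).
    apply: (dA.2 _ _ Aa) => k; rewrite mxE; case: ifPn => kJ.
      by case: (frac al (a 0 k) (x 0 k) al0 (dA.1 _ Aa k) (x0 k) (xJ _ kJ)).
    by rewrite lexx (dA.1 _ Aa).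
  by apply/rowP => k; rewrite !mxE; case: (k \in J).
- exists (\row_k (if k \in G then x 0 k / be else 0)).
    apply: (dB.2 _ _ Bb) => k; rewrite mxE; case: ifPn => kG.
      by case: (frac be (b 0 k) (x 0 k) be0 (dB.1 _ Bb k) (x0 k) (xG _ kG)).
    by rewrite lexx (dB.1 _ Bb).
  by apply/rowP => k; rewrite !mxE; case: (k \in G).
- by rewrite t0.
apply/rowP => k; rewrite rv_lin !mxE.
have [kJ|kJ] := boolP (k \in J).
  rewrite (disjointFr JG kJ) mulr0 addr0.
  by case: (frac al (a 0 k) (x 0 k) al0 (dA.1 _ Aa k) (x0 k) (xJ _ kJ)).
have [kG|kG] := boolP (k \in G).
  rewrite mulr0 add0r.
  by case: (frac be (b 0 k) (x 0 k) be0 (dB.1 _ Bb k) (x0 k) (xG _ kG)).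
by rewrite !mulr0 addr0 x00.
Qed.

Let mu_hyperplanes E (l : seq 'I_n) : {subset l <= E} ->
  measurable (\big[setU/set0]_(k <- l) [set x : 'rV[R]_n | x 0 k = 0]) /\
  mu E (\big[setU/set0]_(k <- l) [set x : 'rV[R]_n | x 0 k = 0]) = 0%E.
Proof.
have mH k : measurable [set x : 'rV[R]_n | x 0 k = 0].
  rewrite (_ : [set x | _] = (fun x : 'rV[R]_n => x 0 k) @^-1` [set 0])//.
  by rewrite -[X in measurable X]setTI; exact: measurable_coord.
elim: l => [|k l IH] lE; first by rewrite big_nil measure0.
have {}/IH[ml l0] : {subset l <= E} by move=> j jl; apply: lE; rewrite in_cons jl orbT.
rewrite big_cons; split; first exact: measurableU.
by rewrite measureU0//= mu_hyperplane// lE// mem_head.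
Qed.

Variables (A B : set 'rV[R]_n).
Hypotheses (cA : compact A) (cB : compact B) (dA : downset A) (dB : downset B).
Hypotheses (A0 : A 0) (B0 : B 0).

Let W := power_sum s A (-%R @` B).

Lemma compact_oppr_image : compact (-%R @` B).
Proof.
apply: continuous_compact => //; apply: continuous_subspaceT => x.
exact: opp_continuous.
Qed.

Let mW : measurable W.
Proof.
by apply: compact_measurable_rv; apply: compact_power_sum => //; exact: compact_oppr_image.
Qed.

(** After reflection of the coordinates in [E :\: J] the two sets differ only where one of these
    coordinates is 0, a null set. *)
Let piece E J : J \subset E -> mu E (W `&` orthant E J) =
  mu E (power_sum s (coord_proj J @` A) (coord_proj (E :\: J) @` B)).
Proof.
move=> JE; pose G := E :\: J; pose S := power_sum s (coord_proj J @` A) (coord_proj G @` B).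
have JG : [disjoint J & G]%B.
  by apply/pred0P => k /=; rewrite !inE; case: (k \in J).
have JGE : J :|: G = E.
  apply/setP => k; rewrite !inE; have [kJ|//] := boolP (k \in J).
  by rewrite (fintype.subsetP JE).
have mS : measurable S.
  by apply: compact_measurable_rv; apply: compact_power_sum => //; exact: compact_coord_proj.
have mWO : measurable (W `&` orthant E J).
  by apply: measurableI => //; exact: measurable_orthant.
rewrite -(mu_flip E G mWO) -mu_coord_proj -[RHS]mu_coord_proj.
set S1 := [set x | _]; set S2 := [set x | _].
have mS1 : measurable S1.
  have mf : measurable [set x | (W `&` orthant E J) (flip G x)].
    by rewrite -[X in measurable X]setTI; exact: (measurable_flip G).
  by rewrite -[X in measurable X]setTI; exact: (measurable_coord_proj E).
have mS2 : measurable S2.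
  by rewrite -[X in measurable X]setTI; exact: (measurable_coord_proj E).
have S12 : S1 `<=` S2.
  move=> x [Wx Ox] /=; apply/(power_sum_orthant dA dB JG) => //.
    move=> k; rewrite mxE; case: ifPn => // kE; have := Ox _ kE; rewrite !mxE kE !inE.
    rewrite kE andbT; have [//|kJ] := boolP (k \in J).
    by rewrite oppr_lt0 => /ltW.
  by rewrite JGE coord_projK.
have GE : {subset enum G <= E} by move=> k; rewrite mem_enum inE => /andP[].
have [mN N0] := mu_hyperplanes GE.
apply/eqP; rewrite eq_le; apply/andP; split; first by apply: le_measure; rewrite ?inE.
apply: (@le_trans _ _ (mu E (S1 `|` \big[setU/set0]_(k <- enum G) [set x : 'rV[R]_n | x 0 k = 0]))).
  apply: le_measure; rewrite ?inE//; first exact: measurableU.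
  move=> x Sx; have [[k kG xk]|H] := pselect (exists2 k, k \in G & x 0 k = 0).
    by right; rewrite -bigcup_seq; exists k => //=; rewrite mem_enum.
  have Px : power_sum s (coord_proj J @` A) (coord_proj G @` B) (coord_proj E x) by [].
  have x0 k : k \in E -> 0 <= x 0 k.
    move=> kE; have [_ [_ [t [[a Aa <-] [b Bb <-] _ xE]]]] := Px.
    have := congr1 (fun z : 'rV[R]_n => z 0 k) xE; rewrite rv_lin !mxE kE => ->.
    have a0 := dA.1 _ Aa k; have b0 := dB.1 _ Bb k.
    by rewrite addr_ge0// mulr_ge0 ?powR_ge0//; case: ifP.
  left; split.
    apply/(power_sum_orthant dA dB JG); rewrite ?JGE ?coord_projK// => k.
    by rewrite mxE; case: ifP => // /x0.
  move=> k kE; rewrite !mxE kE !inE kE andbT; have [kJ|kJ] := boolP (k \in J); first exact: x0.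
  rewrite oppr_lt0 lt_neqAle x0// andbT eq_sym; apply/eqP => xk.
  by apply: H; exists k => //; rewrite inE kJ.
by rewrite measureU0.
Qed.

Let gm (m : nat) : R := gamma_fun (1 + m%:R * s).

Lemma mu_power_sum_opp E : fine (mu E W) =
  \sum_(J in powerset E) gm #|J| * gm #|E :\: J| / gm #|E| *
    (fine (mu J A) * fine (mu (E :\: J) B)).
Proof.
have [iA Ai] := compact_cube cA; have [iB Bi] := compact_cube cB.
have mA := compact_measurable_rv cA; have mB := compact_measurable_rv cB.
rewrite (@measure_finite_partition _ _ (mu E) _ (powerset E) (fun J => W `&` orthant E J)).
- have gm0 m : 0 < gm m by rewrite gamma_fun_gt0// mulr_ge0.
  rewrite [X in fine X](_ : _ = (\sum_(J in powerset E) gm #|J| * gm #|E :\: J| / gm #|E| *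
    (fine (mu J A) * fine (mu (E :\: J) B)))%:E)//.
  rewrite -sumEFin; apply: eq_bigr => J; rewrite powersetE => JE.
  rewrite [LHS](piece JE).
  have JG : [disjoint J & E :\: J]%B.
    by apply/pred0P => k /=; rewrite !inE; case: (k \in J).
  have JGE : J :|: E :\: J = E.
    apply/setP => k; rewrite !inE; have [kJ|//] := boolP (k \in J).
    by rewrite (fintype.subsetP JE).
  have projK G (D : set 'rV[R]_n) x : (coord_proj G @` D) x -> coord_proj G x = x.
    by move=> [y _ <-]; rewrite coord_projK.
  have mu_proj G D i : compact D -> downset D -> D `<=` @cube R n i ->
      mu G (coord_proj G @` D) = (fine (mu G D))%:E.
    move=> cD dD Di; rewrite fineK; last exact: (mu_fin G (compact_measurable_rv cD) Di).
    rewrite -mu_coord_proj -[RHS]mu_coord_proj; congr (mu G _); apply/seteqP; split => x /=.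
      by move=> /(coord_proj_downset dD).
    by move=> Dx; exists (coord_proj G x) => //; rewrite coord_projK.
  have := mu_power_sum s0 JG (starlike_coord_proj J dA A0) (starlike_coord_proj (E :\: J) dB B0)
    (@compact_coord_proj _ _ J _ cA) (@compact_coord_proj _ _ (E :\: J) _ cB)
    (projK J A) (projK (E :\: J) B).
  rewrite JGE !gamma_funE ?mulr_ge0// (mu_proj _ _ iA)// (mu_proj _ _ iB)// -/(gm _) -/(gm _).
  have cS := compact_power_sum s0 (@compact_coord_proj _ _ J _ cA) (@compact_coord_proj _ _ (E :\: J) _ cB).
  have [iS Si] := compact_cube cS.
  rewrite -(fineK (mu_fin E (compact_measurable_rv cS) Si)) -!EFinM => -[H].
  congr EFin; apply: (@mulIf _ (gm #|E|)); first by rewrite gt_eqF.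
  by rewrite [LHS]H [RHS]mulrAC divfK ?gt_eqF// mulrACA [LHS]mulrC.
- by move=> J; apply: measurableI => //; exact: measurable_orthant.
- move=> J J'; rewrite /= !mem_enum !powersetE => JE JE' [x [[_ xJ] [_ xJ']]].
  apply/setP => k; have [kE|kE] := boolP (k \in E); last first.
    by rewrite !(contraNF (fintype.subsetP _ k) kE).
  have := xJ _ kE; have := xJ' _ kE.
  by do 2 case: (k \in _) => //; [rewrite leNgt => /negP|move=> ? /=; rewrite leNgt => /negP].
apply/seteqP; split => [x Wx|x [J _ []//]].
exists [set k in E | 0 <= x 0 k]%SET => /=.
  by rewrite mem_enum powersetE; apply/fintype.subsetP => k; rewrite inE => /andP[].
by split => // k kE; rewrite inE kE/= ltNge; case: (0 <= x 0 k).
Qed.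

End orthants.

(** * Anti-blocking bodies as convex down-sets *)

Section anti_blocking.
Variables (R : realType) (n : nat).
Implicit Types (K : set 'rV[R]_n).

Definition segment_closed K : Prop :=
  forall x y (t : R), K x -> K y -> 0 <= t <= 1 -> K ((1 - t) *: x + t *: y).

Lemma convex_setE K : convex_set K <-> segment_closed K.
Proof.
split=> [cK x y t Kx Ky /andP[t0 t1]|cK x y l]; last first.
  rewrite !inE => Kx Ky; have := cK y x l%:num Ky Kx.
  rewrite addrC; apply.
  by rewrite ge0/= le1.
have /set_mem := cK y x (Itv01 t0 t1) (mem_set Ky) (mem_set Kx).
by rewrite addrC.
Qed.

Lemma coord_vspaceP (I : {set 'I_n}) (x : 'rV[R]_n) :
  x \in coord_vspace R I <-> coord_proj I x = x.
Proof.
split=> [/mem_coord_vspace xI|<-]; last exact: (coord_proj_orthogonal I x).1.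
by apply/rowP => k; rewrite mxE; case: ifPn => // /xI ->.
Qed.

(** Coordinates are lowered one at a time: the required point is a convex combination of the current
    one and of its projection along e_k. *)
Lemma anti_blocking_downset K : anti_blocking K ->
  [/\ compact K, downset K, segment_closed K & K 0].
Proof.
move=> [[[z Kz] cK /convex_setE sK] K0 pK].
have projK I x : K x -> K (coord_proj I x).
  by move=> Kx; have := pK I => /seteqP[+ _]; case/(_ (coord_proj I x)) => //; exists x.
have K00 : K 0.
  by rewrite (_ : 0 = coord_proj finset.set0 z); [exact: projK|apply/rowP => k; rewrite !mxE inE].
split=> //; split=> // x y Kx yx.
have step (l : seq 'I_n) : K (\row_k (if k \in l then y 0 k else x 0 k)).
  elim: l => [|k l IH].
    by rewrite (_ : \row_k _ = x)//; apply/rowP => k; rewrite mxE.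
  set v := (X in K X) in IH.
  have /andP[yk0 ykv] : 0 <= y 0 k <= v 0 k.
    by rewrite mxE; case: ifP => // _; rewrite lexx andbT; have /andP[] := yx k.
  have vk0 := le_trans yk0 ykv.
  have [th th01 thE] : exists2 th, 0 <= th <= 1 & y 0 k = th * v 0 k.
    have [v0|v0] := eqVneq (v 0 k) 0.
      by exists 0; rewrite ?lexx ?ler01// mul0r; apply/le_anti; rewrite yk0 -v0 ykv.
    have vp : 0 < v 0 k by rewrite lt_neqAle eq_sym v0.
    by exists (y 0 k / v 0 k); rewrite ?divfK// divr_ge0//= ler_pdivrMr// mul1r.
  rewrite (_ : \row_k _ = (1 - th) *: coord_proj (~: [set k]%SET) v + th *: v).
    by apply: sK => //; exact: projK.
  apply/rowP => j; rewrite rv_lin [in LHS]mxE [coord_proj _ _ _ _]mxE in_cons !inE.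
  have [->|jk] := eqVneq j k; first by rewrite mulr0 add0r.
  by rewrite -mulrDl subrK mul1r mxE.
have := step (enum 'I_n); rewrite (_ : \row_k _ = y)//.
by apply/rowP => k; rewrite mxE mem_enum.
Qed.

Lemma downset_anti_blocking K : compact K -> downset K -> segment_closed K -> K 0 ->
  anti_blocking K.
Proof.
move=> cK dK sK K0; split.
- by split => //; [exists 0|exact/convex_setE].
- by move=> x Kx k; exact: dK.1.
move=> I; apply/seteqP; split => x.
  move=> [y Ky <-]; split; first by apply: coord_proj_downset => //; exists y.
  by apply/coord_vspaceP; exact: coord_projK.
by move=> [Kx /coord_vspaceP xI]; exists x.
Qed.

Lemma mu_proj_image J (L : set 'rV[R]_n) : coord_proj J @` L `<=` L ->
  mu J (coord_proj J @` L) = mu J L.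
Proof.
move=> LJ; rewrite -mu_coord_proj -[RHS]mu_coord_proj; congr (mu J _).
apply/seteqP; split => x /= Lx; first exact: LJ.
by exists (coord_proj J x) => //; rewrite coord_projK.
Qed.

Lemma coord_volume_proj J (L : set 'rV[R]_n) : coord_proj J @` L `<=` L ->
  coord_volume J (coord_proj J @` L) = fine (mu J L).
Proof.
move=> LJ; rewrite coord_volumeE ?mu_proj_image//.
by move=> _ [x _ <-]; apply/coord_vspaceP; exact: coord_projK.
Qed.

Lemma volumeE (L : set 'rV[R]_n) : compact L -> volume L = fine (mu [set: 'I_n]%SET L).
Proof. by move=> cL; rewrite /volume mu_setT//; exact: compact_measurable_rv. Qed.

Lemma power_sum_opp_proj (s : R) J (A B : set 'rV[R]_n) : downset A -> downset B ->
  coord_proj J @` power_sum s A (-%R @` B) `<=` power_sum s A (-%R @` B).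
Proof.
move=> dA dB _ [_ [a [_ [t [Aa [b Bb <-] t01 ->]]]] <-].
exists (coord_proj J a), (- coord_proj J b), t; split => //.
- by apply: coord_proj_downset => //; exists a.
- by exists (coord_proj J b) => //; apply: coord_proj_downset => //; exists b.
by apply/rowP => k; rewrite mxE !rv_lin !mxE; case: ifP => // _; rewrite oppr0 !mulr0 addr0.
Qed.

(** For [p = 1] the exponent is 0, both coefficients are 1, and the general formula gives the
    Minkowski sum. *)
Lemma lp_sumE (p : R) (q : \bar R) K L : 1 <= p -> (1 < q)%E ->
  ((p%:E)^-1 + q^-1 = 1)%E -> lp_sum p q K L = power_sum (rinv q) K L /\ 0 <= rinv q.
Proof.
move=> p1 q1 pq; have p0 : 0 < p := lt_le_trans ltr01 p1.
have rq : rinv q = 1 - p^-1.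
  move: pq; rewrite /rinv inver gt_eqF//.
  by case: (q^-1)%E => //= r; rewrite -EFinD => -[<-]; rewrite addrC addKr.
have rq0 : 0 <= rinv q by rewrite rq subr_ge0 invf_le1.
split => //; rewrite /lp_sum; case: eqP => // pE.
have -> : rinv q = 0 by rewrite rq pE invr1 subrr.
apply/seteqP; split => z.
  move=> [x Kx [y Ly ->]]; exists x, y, 0; split => //; first by rewrite lexx ler01.
  by rewrite !powRr0 !scale1r.
by move=> [x [y [t [Kx Ly _ ->]]]]; exists x => //; exists y => //; rewrite !powRr0 !scale1r.
Qed.

End anti_blocking.

Section berwald_degenerate.
Variables (R : realType) (n : nat).
Implicit Types (J P Q : {set 'I_n}).

Lemma mu_set0 (A : set 'rV[R]_n) : A 0 -> mu finset.set0 A = 1%E.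
Proof.
move=> A0; rewrite -mu_coord_proj (_ : [set x | _] = mbox (fun=> setT)); last first.
  apply/seteqP; split => x //= _; rewrite (_ : coord_proj _ _ = 0)//.
  by apply/rowP => k; rewrite !mxE inE.
by rewrite mu_mbox// big1// => k _; rewrite /fac inE diracT.
Qed.

Lemma cone_vol0l a : cone_vol R 0 a = 1.
Proof. by rewrite /cone_vol fact0 mul1n divff// pnatr_eq0 -lt0n fact_gt0. Qed.

Lemma cone_vol0r a : cone_vol R a 0 = 1.
Proof. by rewrite /cone_vol fact0 muln1 addn0 divff// pnatr_eq0 -lt0n fact_gt0. Qed.

Variable A : set 'rV[R]_n.
Hypotheses (cA : compact A) (dA : downset A) (sA : segment_closed A) (A0 : A 0).

Let a J : R := fine (mu J A).

(** Adds the cases without levels to compare: equality when [P] is empty, and the product bound of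
    [mu_triple_le] when [J] is empty. *)
Lemma berwald_le J P Q : [disjoint J & P]%B -> [disjoint J & Q]%B -> [disjoint P & Q]%B ->
  (0 < #|Q|)%N ->
  a (J :|: (P :|: Q)) * a J * (cone_vol R #|J| #|P| * cone_vol R #|J| #|Q|) <=
  cone_vol R #|J| (#|P| + #|Q|) * (a (J :|: P) * a (J :|: Q)).
Proof.
move=> JP JQ PQ Q0; have [i Ai] := compact_cube cA.
have mA := compact_measurable_rv cA.
have [P0|] := posnP #|P|.
  rewrite P0 cone_vol0r mul1r add0n (cards0_eq P0) finset.set0U finset.setU0.
  by rewrite mulrC (mulrC (a J)).
have [J0 P0|J0 P0] := posnP #|J|; last exact: (berwald mA dA Ai sA).
rewrite J0 !cone_vol0l (cards0_eq J0) !finset.set0U !mulr1 mul1r /a mu_set0// mulr1.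
have disj0 (G : {set 'I_n}) : [disjoint finset.set0 & G]%B by apply/pred0P => k; rewrite /= inE.
have sv G x : sect_vol finset.set0 G A x = mu G A.
  rewrite -mu_coord_proj /sect_vol; congr (mu G _); apply/seteqP.
  have E y : join finset.set0 G (x, y) = coord_proj G y.
    by apply/rowP => k; rewrite joinE inE add0r mxE.
  by split => y /=; rewrite /sect/= E.
have := mu_triple_le (disj0 P) (disj0 Q) PQ mA dA.
under eq_integral do rewrite !sv.
rewrite integral_cst// [X in (_ * X)%E]mu_set0// mule1 finset.set0U => H.
by rewrite -lee_fin EFinM !fineK// ?(mu_fin _ mA Ai).
Qed.

End berwald_degenerate.

(** * Sharp constant *)

Section coefficients.
Variable R : realType.

Lemma natr_bin (n m : nat) : (m <= n)%N ->
  'C(n, m)%:R = n`!%:R / (m`!%:R * (n - m)`!%:R) :> R.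
Proof.
by move=> mn; rewrite -(bin_fact mn) !natrM mulfK.
Qed.

(** Identifies [d2] with the constant of [berwald]. *)
Lemma d2_cone_vol (k p q : nat) : d2 R (k + p + q) (k + p) (k + q) =
  cone_vol R k (p + q) / (cone_vol R k p * cone_vol R k q).
Proof.
have E : ((k + p) + (k + q) - (k + p + q) = k)%N by lia.
rewrite /d2 E natrM !natr_bin; [|lia..].
rewrite -addnA !addKn /cone_vol !natrM; field.
by rewrite -?natrM !pnatr_eq0 -!lt0n !fact_gt0.
Qed.

Variable q : \bar R.
Hypothesis q0 : 0 <= rinv q.

(** The weight w k l of the overview. *)
Definition orthant_coef (k l : nat) : R :=
  gamma_fun (1 + k%:R * rinv q) * gamma_fun (1 + l%:R * rinv q) /
  gamma_fun (1 + (k + l)%:R * rinv q).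

Let gm0 m : 0 < gamma_fun (1 + m%:R * rinv q).
Proof. by rewrite gamma_fun_gt0// mulr_ge0. Qed.

Lemma orthant_coef_gt0 k l : 0 < orthant_coef k l.
Proof. by rewrite divr_gt0 ?mulr_gt0. Qed.

Lemma orthant_coefC k l : orthant_coef k l = orthant_coef l k.
Proof. by rewrite /orthant_coef addnC (mulrC (gamma_fun (1 + k%:R * rinv q))). Qed.

(** Here [k], [a], [b] are the sizes of [J], [E :\: J] and [~: E]; the first ratio compares the
    weight of a summand over [E] with that of its partner over the whole space. *)
Lemma nu_termE (k a b : nat) : nu_term (k + a + b) q (k + a) (k + b) =
  orthant_coef k a / orthant_coef (k + b) a *
  (cone_vol R k (a + b) / (cone_vol R k a * cone_vol R k b)).
Proof.
have E : ((k + a) + (k + b) - (k + a + b) = k)%N by lia.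
rewrite /nu_term d2_cone_vol E [LHS]mulrC /orthant_coef (addnAC k b a); congr (_ * _).
set x := gamma_fun _; set y := gamma_fun _; set z := gamma_fun _; set w := gamma_fun _.
set v := gamma_fun _.
have x0 : 0 < x by exact: gm0.
have y0 : 0 < y by exact: gm0.
have z0 : 0 < z by exact: gm0.
have w0 : 0 < w by exact: gm0.
have v0 : 0 < v by exact: gm0.
by move: x y z w v x0 y0 z0 w0 v0 => x y z w v *; field; rewrite !gt_eqF.
Qed.

End coefficients.

Section orthant_sum.
Variables (R : realType) (n : nat) (wt : nat -> nat -> R).
Hypotheses (wt0 : forall k l, 0 <= wt k l) (wtC : forall k l, wt k l = wt l k).

Definition orthant_sum (a b : {set 'I_n} -> R) (E : {set 'I_n}) : R :=
  \sum_(J in powerset E) wt #|J| #|E :\: J| * (a J * b (E :\: J)).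

Let T := [set: 'I_n]%SET.

(** Compares the summand [J] over [E] with the summand [J :|: ~: E] over all coordinates; both carry
    the factor [b (E :\: J)], which is left out. *)
Definition berwald_like (c : R) (E : {set 'I_n}) (a : {set 'I_n} -> R) : Prop :=
  forall J : {set 'I_n}, J \subset E ->
    wt #|J| #|E :\: J| * (a T * a J) <=
    c * (wt #|J :|: ~: E| #|E :\: J| * (a E * a (J :|: ~: E))).

(* [J] is paired with [J :|: ~: E] in the summand of [a] and with itself in that of
   [b]; these sets are distinct because only the former meet [~: E]. *)
Lemma orthant_sum_le (a b : {set 'I_n} -> R) (c : R) (E : {set 'I_n}) :
  (forall J, 0 <= a J) -> (forall J, 0 <= b J) -> 0 <= c -> 0 < a E -> 0 < b E ->
  (0 < #|~: E|)%N -> berwald_like c E a -> berwald_like c E b ->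
  (a T / a E + b T / b E) * orthant_sum a b E <= c * orthant_sum a b T.
Proof.
move=> a0 b0 c0 aE bE E0 Ba Bb.
pose t (F : {set 'I_n}) := wt #|F| #|T :\: F| * (a F * b (T :\: F)).
have t0 F : 0 <= t F by rewrite mulr_ge0// mulr_ge0.
have first_le J : J \in powerset E ->
    a T / a E * (wt #|J| #|E :\: J| * (a J * b (E :\: J))) <= c * t (J :|: ~: E).
  rewrite powersetE => JE; have TF : T :\: (J :|: ~: E) = E :\: J.
    by apply/setP => k; rewrite !inE negb_or negbK andbT andbC.
  rewrite /t TF; have := ler_wpM2r (b0 (E :\: J)) (Ba _ JE).
  rewrite -[leRHS](mulrA c) => H; rewrite -(ler_pM2l aE).
  apply: le_trans (_ : _ <= wt #|J| #|E :\: J| * (a T * a J) * b (E :\: J)) _.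
    by rewrite le_eqVlt; apply/orP; left; apply/eqP; field; rewrite gt_eqF.
  by apply: le_trans H _; rewrite le_eqVlt; apply/orP; left; apply/eqP; ring.
have second_le J : J \in powerset E ->
    b T / b E * (wt #|J| #|E :\: J| * (a J * b (E :\: J))) <= c * t J.
  rewrite powersetE => JE; have TJ : T :\: J = (E :\: J) :|: ~: E.
    apply/setP => k; rewrite !inE andbT; have [kJ|kJ] := boolP (k \in J).
      by rewrite (fintype.subsetP JE _ kJ).
    by case: (k \in E).
  have DD : E :\: (E :\: J) = J.
    apply/setP => k; rewrite !inE; have [kJ|kJ] := boolP (k \in J).
      by rewrite (fintype.subsetP JE _ kJ).
    by case: (k \in E).
  (* The summand [J] carries [b] at [E :\: J], so the inequality for [b] is taken at that set, and
     symmetry of the weights restores the order. *)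
  have := Bb (E :\: J) (subsetDl _ _).
  rewrite DD -TJ /t => /(ler_wpM2r (a0 J)) H; rewrite -(ler_pM2l bE).
  apply: le_trans (_ : _ <= wt #|E :\: J| #|J| * (b T * b (E :\: J)) * a J) _.
    by rewrite (wtC #|J|) le_eqVlt; apply/orP; left; apply/eqP; field; rewrite gt_eqF.
  apply: le_trans H _; rewrite (wtC #|J|).
  by rewrite le_eqVlt; apply/orP; left; apply/eqP; ring.
rewrite mulrDl /orthant_sum !mulr_sumr.
apply: le_trans (lerD (ler_sum _ first_le) (ler_sum _ second_le)) _.
pose h (J : {set 'I_n}) := J :|: ~: E.
have h_inj : {in powerset E &, injective h}.
  move=> J K; rewrite !powersetE => JE KE /setP JK; apply/setP => k.
  have := JK k; rewrite !inE; have [kE|kE] := boolP (k \in E); first by rewrite !orbF.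
  by rewrite (contraNF (fintype.subsetP JE k) kE) (contraNF (fintype.subsetP KE k) kE).
rewrite -(big_imset (fun F => c * t F) h_inj)/=.
have disj : [disjoint (h @: powerset E)%SET & powerset E]%B.
  apply/pred0P => F /=; apply/negP => /andP[/imsetP[J _ ->]]; rewrite powersetE => /fintype.subsetP H.
  have [k kE] := card_gt0P E0; have := H k; rewrite !inE in kE *; rewrite kE orbT => /(_ isT) kE'.
  by rewrite kE' in kE.
rewrite -bigU// big_mkcond [leRHS]big_mkcond; apply: ler_sum => F _.
by rewrite [F \in powerset T]powersetE finset.subsetT; case: ifP => // _; exact: (mulr_ge0 c0 (t0 F)).
Qed.

End orthant_sum.

(** * Upper bound for the constant *)

Section upper_bound.
Variables (R : realType) (n : nat) (q : \bar R).
Hypothesis q0 : 0 <= rinv q.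
Implicit Types (E J : {set 'I_n}) (A B : set 'rV[R]_n).

Let T := [set: 'I_n]%SET.

Definition vol A J : R := fine (mu J A).

Lemma vol_ge0 A J : 0 <= vol A J.
Proof. exact: fine_ge0. Qed.

Lemma vol_set0 A : A 0 -> vol A finset.set0 = 1.
Proof. by move=> A0; rewrite /vol mu_set0. Qed.

Lemma vol_power_sum A B E : anti_blocking A -> anti_blocking B ->
  vol (power_sum (rinv q) A (-%R @` B)) E = orthant_sum (orthant_coef q) (vol A) (vol B) E.
Proof.
move=> /anti_blocking_downset[cA dA _ A0] /anti_blocking_downset[cB dB _ B0].
have := mu_power_sum_opp q0 cA cB dA dB A0 B0 E; rewrite -/(vol _ _) => ->.
apply: eq_bigr => J; rewrite powersetE => JE.
rewrite /orthant_coef (_ : (#|J| + #|E :\: J|)%N = #|E|)//.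
by rewrite -(cardsID J E) (finset.setIidPr JE).
Qed.

Lemma orthant_sum_ge (wt : nat -> nat -> R) (a b : {set 'I_n} -> R) E J :
  (forall k l, 0 <= wt k l) -> (forall J, 0 <= a J) -> (forall J, 0 <= b J) -> J \subset E ->
  wt #|J| #|E :\: J| * (a J * b (E :\: J)) <= orthant_sum wt a b E.
Proof.
move=> wt0 a0 b0 JE; rewrite /orthant_sum (bigD1 J) ?powersetE//= lerDl.
by apply: sumr_ge0 => K _; rewrite mulr_ge0// mulr_ge0.
Qed.

Let wt0 k l : 0 <= orthant_coef q k l.
Proof. by rewrite ltW// orthant_coef_gt0. Qed.

(** The summand [J = E] alone is positive, the section of [B] by {0} having volume 1. *)
Lemma vol_power_sum_gt0 A B E : anti_blocking A -> anti_blocking B -> 0 < vol A E ->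
  0 < vol (power_sum (rinv q) A (-%R @` B)) E.
Proof.
move=> hA hB aE; rewrite vol_power_sum//.
have [cB dB _ B0] := anti_blocking_downset hB.
apply: lt_le_trans (orthant_sum_ge wt0 (vol_ge0 A) (vol_ge0 B) (subxx E)).
by rewrite finset.setDv vol_set0// mulr1 mulr_gt0// orthant_coef_gt0.
Qed.

(** The denominator on the right is positive by [vol_power_sum_gt0] and can be cleared. *)
Lemma nu_admissibleE (p : R) (i : nat) (c : R) : 1 <= p -> (1 < q)%E ->
  ((p%:E)^-1 + q^-1 = 1)%E ->
  nu_admissible n p q i c <-> forall A B E, anti_blocking A -> anti_blocking B ->
    #|E| = i -> 0 < vol A E -> 0 < vol B E ->
    (vol A T / vol A E + vol B T / vol B E) *
      orthant_sum (orthant_coef q) (vol A) (vol B) E <=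
    c * orthant_sum (orthant_coef q) (vol A) (vol B) T.
Proof.
move=> p1 q1 pq.
have main A B E : anti_blocking A -> anti_blocking B -> 0 < vol A E ->
    (volume A / coord_volume E (coord_proj E @` A) +
     volume B / coord_volume E (coord_proj E @` B) <=
     c * (volume (lp_sum p q A (-%R @` B)) /
         coord_volume E (coord_proj E @` lp_sum p q A (-%R @` B)))) =
    ((vol A T / vol A E + vol B T / vol B E) *
      orthant_sum (orthant_coef q) (vol A) (vol B) E <=
     c * orthant_sum (orthant_coef q) (vol A) (vol B) T).
  move=> hA hB aE; have w0 := vol_power_sum_gt0 hA hB aE; rewrite -!vol_power_sum//.
  have [cA dA _ _] := anti_blocking_downset hA; have [cB dB _ _] := anti_blocking_downset hB.
  have [-> _] := lp_sumE A (-%R @` B) p1 q1 pq.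
  have cW : compact (power_sum (rinv q) A (-%R @` B)).
    by apply: compact_power_sum => //; exact: compact_oppr_image.
  rewrite !volumeE// coord_volume_proj; last exact: coord_proj_downset.
  rewrite coord_volume_proj; last exact: coord_proj_downset.
  rewrite coord_volume_proj; last exact: power_sum_opp_proj.
  by rewrite mulrA ler_pdivlMr.
have cv A E : anti_blocking A -> coord_volume E (coord_proj E @` A) = vol A E.
  move=> /anti_blocking_downset[cA dA _ _].
  by rewrite coord_volume_proj//; exact: coord_proj_downset.
split=> H A B E hA hB hE; first by move=> aE bE; rewrite -main//; apply: H; rewrite ?cv.
rewrite (cv A)// (cv B)// => aE bE; have := H A B E hA hB hE aE bE.
by rewrite -main// (cv A)// (cv B).
Qed.

(** The constant required for [J] is [nu_term] at [j = #|J :|: ~: E|]. *)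
Lemma berwald_like_vol A E c : anti_blocking A -> (0 < #|~: E|)%N ->
  (forall j, (j < n.+1)%N -> (n <= #|E| + j)%N -> nu_term n q #|E| j <= c) ->
  berwald_like (orthant_coef q) c E (vol A).
Proof.
move=> /anti_blocking_downset[cA dA sA A0] E0 hc J JE.
have JP : [disjoint J & E :\: J]%B.
  by apply/pred0P => k /=; rewrite !inE; case: (k \in J).
have EE : [disjoint E & ~: E]%B by apply/pred0P => k /=; rewrite !inE andbN.
have JQ : [disjoint J & ~: E]%B.
  apply/pred0P => k /=; rewrite !inE; apply/negP => /andP[/(fintype.subsetP JE) ->].
  by [].
have PQ : [disjoint E :\: J & ~: E]%B.
  by apply/pred0P => k /=; rewrite !inE; case: (k \in E); rewrite ?andbF.
have JPE : J :|: E :\: J = E.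
  apply/setP => k; rewrite !inE; have [kJ|//] := boolP (k \in J).
  by rewrite (fintype.subsetP JE).
have JPQT : J :|: (E :\: J :|: ~: E) = T.
  by rewrite finset.setUA JPE; apply/setP => k; rewrite !inE orbN.
have := berwald_le cA dA sA A0 JP JQ PQ E0; rewrite JPQT JPE -!/(vol _ _).
have iE : #|E| = (#|J| + #|E :\: J|)%N by rewrite -card_disjointU// JPE.
have nE : n = (#|J| + #|E :\: J| + #|~: E|)%N.
  by rewrite -iE -card_disjointU// finset.setUCr cardsT card_ord.
rewrite (card_disjointU JQ); set k := #|J| in iE nE *; set a := #|E :\: J| in iE nE *.
set b := #|~: E| in nE *.
have := hc (k + b)%N; rewrite iE {1 2 3}nE nu_termE// => /(_ _ _) hcc.
have {hcc} : orthant_coef q k a / orthant_coef q (k + b) a *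
    (cone_vol R k (a + b) / (cone_vol R k a * cone_vol R k b)) <= c by apply: hcc; lia.
have v1 := cone_vol_gt0 R k a; have v2 := cone_vol_gt0 R k b.
have w1 := orthant_coef_gt0 q0 k a; have w2 := orthant_coef_gt0 q0 (k + b) a.
move: (cone_vol R k a) (cone_vol R k b) (cone_vol R k (a + b)) (orthant_coef q k a)
  (orthant_coef q (k + b) a) v1 v2 w1 w2 => x y z u v x0 y0 u0 v0 Hc H.
have X : 0 <= vol A E * vol A (J :|: ~: E) by rewrite mulr_ge0 ?vol_ge0.
move: (vol A T * vol A J) (vol A E * vol A (J :|: ~: E)) X H => L M M0 H.
have {}H : L <= z * M / (x * y) by rewrite ler_pdivlMr ?mulr_gt0.
apply: le_trans (ler_wpM2l (ltW u0) H) _.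
have := ler_wpM2r (mulr_ge0 (ltW v0) M0) Hc; apply: le_trans.
by rewrite le_eqVlt; apply/orP; left; apply/eqP; field; rewrite !gt_eqF.
Qed.

End upper_bound.

(** * Sharpness of the constant *)

Section lower_bound.
Variables (R : realType) (n : nat) (q : \bar R).
Hypothesis q0 : 0 <= rinv q.
Implicit Types (E J D G : {set 'I_n}).

Let T := [set: 'I_n]%SET.

Lemma anti_blocking_model_cone J : anti_blocking (@model_cone R n J).
Proof.
apply: downset_anti_blocking.
- exact: compact_model_cone.
- exact: downset_model_cone.
- by move=> x y t; exact: convex_model_cone.
- by split=> [k|j l _ _]; rewrite !mxE ?addr0 ?lexx ler01.
Qed.

Definition box (b : 'I_n -> R) : set 'rV[R]_n := [set x | forall k, 0 <= x 0 k <= b k].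

Lemma anti_blocking_box (b : 'I_n -> R) : (forall k, 0 <= b k) -> anti_blocking (box b).
Proof.
move=> b0; apply: downset_anti_blocking.
- have := @rV_compact R n (fun k => `[0, b k]%classic) (fun k => @segment_compact R 0 (b k)).
  congr (compact _); apply/seteqP; split => x bx k; have := bx k; rewrite /= in_itv//.
- split=> [x bx k|x y bx yx k]; first by case/andP: (bx k).
  by have /andP[-> /le_trans->//] := yx k; case/andP: (bx k).
- move=> x y t bx byy /andP[t0 t1] k; rewrite rv_lin; have t1' : 0 <= 1 - t by rewrite subr_ge0.
  have /andP[x0 xb] := bx k; have /andP[y0 yb] := byy k.
  rewrite addr_ge0 ?mulr_ge0//=; have := ler_wpM2l t1' xb; have := ler_wpM2l t0 yb; lra.
- by move=> k; rewrite mxE lexx b0.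
Qed.

Lemma vol_box (b : 'I_n -> R) G : (forall k, 0 <= b k) -> vol (box b) G = \prod_(k in G) b k.
Proof.
move=> b0; rewrite /vol -mu_coord_proj -[RHS]/(fine (_%:E)) -(mu_rect (fun k _ => b0 k)).
congr (fine (mu G _)); apply/seteqP; split => x /= bx k.
  by move=> kG; have := bx k; rewrite mxE kG.
by rewrite mxE; case: ifPn => [/bx//|_]; rewrite lexx b0.
Qed.

Definition thin_box D (M : R) : set 'rV[R]_n := box (fun k => if k \in D then M else M^-1).

Lemma vol_thin_box D M : 0 < M -> vol (thin_box D M) D = M ^+ #|D|.
Proof.
move=> M0; rewrite vol_box; last by move=> k; case: ifP => _; rewrite ?invr_ge0 ltW.
by rewrite -prodr_const; apply: eq_bigr => k ->.
Qed.

(** A set other than [D] either lacks a side of length [M] or contains one of length 1/M; either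
    costs a factor [M]. *)
Lemma vol_thin_box_le D G (M : R) : 1 <= M -> G != D ->
  vol (thin_box D M) G <= M ^+ #|D| / M.
Proof.
move=> M1 GD; have M0 : 0 < M := lt_le_trans ltr01 M1.
have Mi : M^-1 <= 1 by rewrite invf_le1.
rewrite vol_box; last by move=> k; case: ifP => _; rewrite ?invr_ge0 ltW.
rewrite -prodr_const big_mkcond [X in _ <= X / M]big_mkcond/=.
have [l lGD] : exists l, (l \in G) != (l \in D).
  apply/existsP; apply: contraR GD; rewrite negb_exists => /forallP H.
  by apply/eqP/setP => l; apply/eqP; have := H l; rewrite negbK.
rewrite (bigD1 l)//= [X in _ <= X / M](bigD1 l)//= mulrAC; apply: ler_pM.
- by case: ifP => // _; case: ifP => _; rewrite ?invr_ge0 ltW.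
- by apply: prodr_ge0 => k _; case: ifP => // _; case: ifP => _; rewrite ?invr_ge0 ltW.
- by move: lGD; case: (l \in G); case: (l \in D) => //= _; rewrite ?div1r ?divff ?gt_eqF.
- apply: ler_prod => k _; case: (k \in G); case: (k \in D); rewrite ?lexx ?ler01 ?M1 ?Mi ?ltW ?invr_gt0//.
Qed.

Lemma le_of_vanishing (x z C : R) : (forall M, 1 <= M -> x <= z + C / M) -> x <= z.
Proof.
move=> H; rewrite leNgt; apply/negP => zx; have d0 : 0 < x - z by rewrite subr_gt0.
(* Large enough for C / M < x - z, and at least 1. *)
pose M := `|C| / (x - z) + 1.
have M1 : 1 <= M by rewrite lerDr divr_ge0// ltW.
have M0 : 0 < M := lt_le_trans ltr01 M1.
have := H M M1; rewrite -lerBlDl leNgt => /negP; apply.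
rewrite ltr_pdivrMr// /M mulrDr mulr1 mulrC divfK ?gt_eqF//.
by rewrite (le_lt_trans (ler_norm C))// ltrDl.
Qed.

(** The cone is tested against the thin box for [E :\: J]. After division by M^#|D|, the sum over
    all coordinates retains in the limit only the summand [F = J :|: ~: E], for which the box enters
    through [D]. *)
Lemma nu_term_le E J (c : R) : J \subset E ->
  (forall A B, anti_blocking A -> anti_blocking B -> 0 < vol A E -> 0 < vol B E ->
    (vol A T / vol A E + vol B T / vol B E) *
      orthant_sum (orthant_coef q) (vol A) (vol B) E <=
    c * orthant_sum (orthant_coef q) (vol A) (vol B) T) ->
  0 <= c /\ nu_term n q #|E| (#|J| + (n - #|E|)) <= c.
Proof.
move=> JE H; pose D := E :\: J; pose F := J :|: ~: E; pose A := @model_cone R n J.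
have hA : anti_blocking A := anti_blocking_model_cone J.
have wt0 k l : 0 <= orthant_coef q k l by rewrite ltW// orthant_coef_gt0.
have hB M : 1 <= M -> anti_blocking (thin_box D M).
  move=> M1; apply: anti_blocking_box => k.
  by case: ifP => _; rewrite ?invr_ge0 (le_trans ler01).
have bG M G : 1 <= M -> 0 < vol (thin_box D M) G.
  move=> M1; have M0 : 0 < M := lt_le_trans ltr01 M1.
  rewrite vol_box; last by move=> k; case: ifP => _; rewrite ?invr_ge0 ltW.
  by apply: prodr_gt0 => k _; case: ifP => _; rewrite ?invr_gt0.
have JD : [disjoint J & D]%B by apply/pred0P => k /=; rewrite !inE; case: (k \in J).
have JDE : J :|: D = E.
  apply/setP => k; rewrite !inE; have [kJ|//] := boolP (k \in J).
  by rewrite (fintype.subsetP JE).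
have ED : [disjoint E & ~: E]%B by apply/pred0P => k /=; rewrite !inE andbN.
have JQ : [disjoint J & ~: E]%B.
  by apply/pred0P => k /=; rewrite !inE; apply/negP => /andP[/(fintype.subsetP JE) ->].
have DQ : [disjoint D & ~: E]%B.
  by apply/pred0P => k /=; rewrite !inE; case: (k \in E); rewrite ?andbF.
have TF : T :\: F = D by apply/setP => k; rewrite !inE negb_or negbK andbT andbC.
have FT : T :\: D = F by rewrite -TF; apply/setP => k; rewrite !inE !andbT negbK.
have iE : #|E| = (#|J| + #|D|)%N by rewrite -card_disjointU// JDE.
have nE : n = (#|J| + #|D| + #|~: E|)%N.
  by rewrite -iE -card_disjointU// finset.setUCr cardsT card_ord.
have aE : vol A E = cone_vol R #|J| #|D| by rewrite -{1}JDE /vol mu_model_cone.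
have aJ : vol A J = 1.
  have J0 : [disjoint J & finset.set0]%B by apply/pred0P => k; rewrite /= inE andbF.
  have := @mu_model_cone R n J finset.set0 J0; rewrite finset.setU0 cards0 => vJ.
  by rewrite /vol vJ; exact: cone_vol0r.
have aF : vol A F = cone_vol R #|J| #|~: E| by rewrite /vol mu_model_cone.
have aT : vol A T = cone_vol R #|J| (#|D| + #|~: E|).
  rewrite -(card_disjointU DQ); have := @mu_model_cone R n J _ (disjoint_setUr JD JQ).
  by rewrite finset.setUA JDE finset.setUCr => vT; rewrite /vol vT.
have aE0 : 0 < vol A E by rewrite aE cone_vol_gt0.
have aT0 : 0 < vol A T by rewrite aT cone_vol_gt0.
(* Only the ratio of volumes of the cone and the summand [J] are kept on the left. *)
have lower M : 1 <= M -> vol A T / vol A E * orthant_coef q #|J| #|D| * M ^+ #|D| <=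
    c * orthant_sum (orthant_coef q) (vol A) (vol (thin_box D M)) T.
  move=> M1; apply: le_trans (H _ _ hA (hB _ M1) aE0 (bG _ _ M1)).
  rewrite -mulrA; apply: ler_pM.
  - by rewrite divr_ge0 ?vol_ge0.
  - by rewrite mulr_ge0// exprn_ge0// (le_trans ler01).
  - by rewrite lerDl divr_ge0 ?vol_ge0.
  apply: le_trans (orthant_sum_ge wt0 (vol_ge0 A) (vol_ge0 (thin_box D M)) JE).
  by rewrite -/D aJ mul1r vol_thin_box// (lt_le_trans ltr01).
have sumT0 M : 1 <= M -> 0 < orthant_sum (orthant_coef q) (vol A) (vol (thin_box D M)) T.
  move=> M1; have := orthant_sum_ge wt0 (vol_ge0 A) (vol_ge0 (thin_box D M)) (finset.subsetT T).
  by apply: lt_le_trans; rewrite mulr_gt0 ?orthant_coef_gt0// mulr_gt0// bG.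
(* Allows multiplying the upper estimate by [c], and matches the default value 0 of the maximum in
   the theorem. *)
have c0 : 0 <= c.
  have := lower 1 (lexx 1); rewrite expr1n mulr1 => L; rewrite -(pmulr_lge0 c (sumT0 _ (lexx 1))).
  by apply: le_trans L; rewrite mulr_ge0// divr_ge0 ?vol_ge0.
split => //.
(* Bounds the summands other than [F], once the factor M^#|D| / M of the box is taken out. *)
pose C := \sum_(K in powerset T) orthant_coef q #|K| #|T :\: K| * vol A K.
have upper M : 1 <= M -> orthant_sum (orthant_coef q) (vol A) (vol (thin_box D M)) T <=
    M ^+ #|D| * (orthant_coef q #|F| #|D| * vol A F + C / M).
  move=> M1; have M0 : 0 < M := lt_le_trans ltr01 M1.
  rewrite /orthant_sum (bigD1 F) ?powersetE ?finset.subsetT//= TF vol_thin_box// mulrDr.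
  apply: lerD; first by rewrite mulrA mulrC.
  have -> : M ^+ #|D| * (C / M) = C * (M ^+ #|D| / M) by rewrite mulrCA.
  rewrite /C mulr_suml [leRHS](bigD1 F) ?powersetE ?finset.subsetT//=.
  have MD0 : 0 <= M ^+ #|D| / M by rewrite divr_ge0 ?exprn_ge0 ?ltW.
  rewrite -[leLHS]add0r; apply: lerD; first by apply: (mulr_ge0 _ MD0); rewrite mulr_ge0// vol_ge0.
  apply: ler_sum => K /andP[_ KF]; rewrite -mulrA ler_wpM2l// ler_wpM2l ?vol_ge0//.
  apply: vol_thin_box_le => //; apply: contra KF => /eqP TK.
  by rewrite -FT -TK; apply/eqP/setP => k; rewrite !inE !andbT negbK.
have {lower upper}bound : vol A T / vol A E * orthant_coef q #|J| #|D| <=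
    c * (orthant_coef q #|F| #|D| * vol A F).
  apply: (@le_of_vanishing _ _ (c * C)) => M M1.
  have MD0 : 0 < M ^+ #|D| by rewrite exprn_gt0// (lt_le_trans ltr01).
  rewrite -(ler_pM2r MD0); apply: (le_trans (lower _ M1)).
  apply: (le_trans (ler_wpM2l c0 (upper _ M1))).
  by rewrite mulrCA [leLHS]mulrC mulrDr (mulrA c C).
rewrite iE; have -> : (#|J| + (n - (#|J| + #|D|)) = #|J| + #|~: E|)%N.
  by move: nE; move: #|J| #|D| #|~: E| => k d e ->; rewrite addKn.
have -> : nu_term n q (#|J| + #|D|) (#|J| + #|~: E|) =
  nu_term (#|J| + #|D| + #|~: E|) q (#|J| + #|D|) (#|J| + #|~: E|) by rewrite -nE.
rewrite nu_termE//; move: bound; rewrite aT aE aF /F card_disjointU//.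
have v1 := cone_vol_gt0 R #|J| #|D|; have v2 := cone_vol_gt0 R #|J| #|~: E|.
have w2 := orthant_coef_gt0 q0 (#|J| + #|~: E|) #|D|.
move: (cone_vol R #|J| #|D|) (cone_vol R #|J| #|~: E|) (cone_vol R #|J| (#|D| + #|~: E|))
  (orthant_coef q #|J| #|D|) (orthant_coef q (#|J| + #|~: E|) #|D|) v1 v2 w2.
move=> x y z u v x0 y0 v0; rewrite -ler_pdivrMr ?mulr_gt0//; apply: le_trans.
by rewrite le_eqVlt; apply/orP; left; apply/eqP; field; rewrite !gt_eqF.
Qed.

End lower_bound.

Lemma card_ord_lt (n m : nat) : (m <= n)%N -> #|[set x : 'I_n | (x < m)%N]%SET| = m.
Proof.
move=> mn; have widen_inj : injective (widen_ord mn).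
  by move=> x y /(congr1 val)/= xy; apply: val_inj.
rewrite -[RHS]card_ord -(card_imset predT widen_inj).
apply: eq_card => x; rewrite !inE; apply/idP/imsetP => [xm|[y _ ->]]; last exact: (ltn_ord y).
by exists (Ordinal xm) => //; apply: val_inj.
Qed.

Theorem theorem16 (R : realType) (n i : nat) (p : R) (q : \bar R)
    (hi : (0 < i < n)%N) (hp : 1 <= p) (hq : (1 < q)%E)
    (hpq : ((p%:E)^-1 + q^-1 = 1)%E) (nu : R) :
  (nu_admissible n p q i nu /\
   forall c : R, nu_admissible n p q i c -> nu <= c) <->
  nu = \big[Num.max/0]_(j < n.+1 | (n <= i + j)%N) nu_term n q i j.
Proof.
have [_ q0] := @lp_sumE R n p q set0 set0 hp hq hpq; have /andP[i0 lt_in] := hi.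
have admissibleP c := @nu_admissibleE R n q q0 p i c hp hq hpq.
set m := \big[Num.max/0]_(_ < _ | _) _.
have upper : nu_admissible n p q i m.
  apply/admissibleP => A B E hA hB Ei aE bE.
  have E0 : (0 < #|~: E|)%N by rewrite cardsCs finset.setCK card_ord Ei subn_gt0.
  have nu_le j : (j < n.+1)%N -> (n <= #|E| + j)%N -> nu_term n q #|E| j <= m.
    by rewrite Ei => jn nij; exact: (@le_bigmax_cond _ _ _ 0 (Ordinal jn)).
  apply: orthant_sum_le.
  - by move=> k l; rewrite ltW// orthant_coef_gt0.
  - exact: orthant_coefC.
  - exact: vol_ge0.
  - exact: vol_ge0.
  - exact: bigmax_ge_id.
  - exact: aE.
  - exact: bE.
  - exact: E0.
  - exact: berwald_like_vol.
  - exact: berwald_like_vol.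
have lower c : nu_admissible n p q i c -> m <= c.
  move=> /admissibleP H.
  pose E := [set x : 'I_n | (x < i)%N]%SET; have Ei : #|E| = i by rewrite card_ord_lt// ltnW.
  have HJ k : (k <= i)%N -> 0 <= c /\ nu_term n q i (k + (n - i)) <= c.
    move=> ki; pose J := [set x : 'I_n | (x < k)%N]%SET.
    have JE : J \subset E by apply/fintype.subsetP => x; rewrite !inE => /leq_trans; apply.
    have Jk : #|J| = k by rewrite card_ord_lt// (leq_trans ki)// ltnW.
    rewrite -Ei -Jk; apply: nu_term_le => //.
    by move=> A B hA hB aE bE; exact: H.
  apply: bigmax_le => [|j nij]; first by case: (HJ 0%N (leq0n _)).
  (* Every index [j] of the maximum arises from a subset of [E] with i + j - n elements. *)
  have ji : (i + j - n <= i)%N by have := ltn_ord j; lia.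
  have [_] := HJ _ ji; rewrite (_ : (i + j - n + (n - i))%N = j)//; lia.
split=> [[nu_adm nu_min]|->]; last by split.
by apply/le_anti; rewrite lower// nu_min.
Qed.
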